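(* Let $T>0$. For any $F\in L^2_{\mathbb{C}}(\Omega,\mathcal{F}_T^L,P)$, there exists a unique predictable $\mathbb{C}$-valued process $\psi=\{\psi(t,x,z);\,t\in[0,T],\,x\in\mathbb{R}^d,\,z\in\mathbb{R}_0\}$ satisfying $$E\int_0^T\int_{\mathbb{R}^d}\int_{\mathbb{R}_0}|\psi(t,x,z)|^2\,\nu(dz)\,dx\,dt<\infty$$ such that $$F=E(F)+\int_0^T\int_{\mathbb{R}^d}\int_{\mathbb{R}_0}\psi(t,x,z)\,\widehat N(dt,dx,dz).$$ Here uniqueness is understood up to equality $P\times\mu$-almost everywhere on $\Omega\times[0,T]\times\mathbb{R}^d\times\mathbb{R}_0$.
   Context: Let $\mathbb{R}_0=\mathbb{R}\setminus\{0\}$ and let $\nu$ be a Lévy measure on $\mathbb{R}$: $\int_{\mathbb{R}_0}(1\wedge|z|^2)\,\nu(dz)<\infty$, $\nu(\{0\})=0$, and assume moreover $v:=\int_{\mathbb{R}_0}z^2\,\nu(dz)<\infty$. On a probability space $(\Omega,\mathcal{F},P)$, $N$ is a Poisson random measure on $\mathbb{R}_+\times\mathbb{R}^d\times\mathbb{R}_0$ with intensity $\mu=dt\,dx\,\nu(dz)$, and $\widehat N(A)=N(A)-\mu(A)$ for Borel $A$ with $\mu(A)<\infty$. Let $\mathcal{B}_b(\mathbb{R}^d)$ and $\mathcal{B}_b(\mathbb{R}_+\times\mathbb{R}^d)$ be the bounded Borel sets of $\mathbb{R}^d$ and $\mathbb{R}_+\times\mathbb{R}^d$, and $\mathcal{B}_b(\mathbb{R}_0)$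 the Borel subsets of $\mathbb{R}_0$ bounded away from $0$. The filtration is $\mathcal{F}_t=\sigma(\{N([0,s]\times B\times\Gamma):0\le s\le t,\ B\in\mathcal{B}_b(\mathbb{R}^d),\ \Gamma\in\mathcal{B}_b(\mathbb{R}_0)\})$. An elementary process is one of the form $H(\omega,t,x,z)=X(\omega)1_{(a,b]}(t)1_A(x)1_\Gamma(z)$ with $0\le a<b$, $X$ bounded and $\mathcal{F}_a$-measurable, $A\in\mathcal{B}_b(\mathbb{R}^d)$, $\Gamma\in\mathcal{B}_b(\mathbb{R}_0)$. A process is predictable if it is measurable with respect to the $\sigma$-field on $\Omega\times\mathbb{R}_+\times\mathbb{R}^d\times\mathbb{R}_0$ generated by linear combinations of elementary processes. For predictable $H$ with $E\int_0^t\int_{\mathbb{R}^d}\int_{\mathbb{R}_0}|H|^2\,\nu(dz)dxds<\infty$, the integral $\int_0^t\int\int H\,d\widehat N$ is the Itô-type integral: the linear isometric extension, from $L^2(P\times\mu)$ on $\Omega\times[0,t]\times\mathbb{R}^d\times\mathbb{R}_0$ to $L^2(\Omega)$, of the obvious integral of elementary processes (for $\mathbb{C}$-valued integrands, real and imaginary parts are integrated separately). The Lévy white noise is $L(B)=\int_{B\times\mathbb{R}_0}z\,\widehat N(ds,dx,dz)$ for $B\in\mathcal{B}_b(\mathbb{R}_+\times\mathbb{R}^d)$. Write $L_s(B)=L([0,s]\times B)$ for $B\in\mathcal{B}_b(\mathbb{R}^d)$ and $\mathcal{F}_t^L=\sigma(\{L_s(B):0\le s\le t,\ B\in\mathcal{B}_b(\mathbb{R}^d)\})$.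 $L^2_{\mathbb{C}}(\Omega,\mathcal{F}_T^L,P)$ is the space of $\mathbb{C}$-valued square-integrable $\mathcal{F}_T^L$-measurable random variables. *)

(* Defs.v *)
From HB Require Import structures.
From mathcomp Require Import all_boot all_order all_algebra.
From mathcomp Require Import all_classical all_reals all_analysis.
From mathcomp Require Import measurable_realfun.
From mathcomp Require Import complex.

Set Implicit Arguments.
Unset Strict Implicit.
Unset Printing Implicit Defensive.

Import Order.TTheory GRing.Theory Num.Theory.
Import numFieldNormedType.Exports.

Local Open Scope classical_set_scope.
Local Open Scope ring_scope.

Section sigma_fields.
Context {U : Type} {d' : measure_display} {V : measurableType d'}.

(* on D, the sigma-field generated by the restrictions to D of X i, i in J *)
Definition sigma_family (D : set U) {I : Type} (J : set I) (X : I -> U -> V) :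
    set (set U) :=
  <<s D, \bigcup_(i in J) preimage_set_system D (X i) measurable >>.

(* the restriction of f to D is G-measurable *)
Definition measurable_wrt (D : set U) (G : set (set U)) (f : U -> V) : Prop :=
  preimage_set_system D f measurable `<=` G.

End sigma_fields.

(* A point (t, x, z) of R_+ x R^d x R_0 is encoded in R x R^d x R: functions
   are total, but only their values at t >= 0 and z != 0 matter.  The
   sigma-field on d.-tuple R is generated by the coordinates, i.e. Borel. *)
Notation txz R d := (R * d.-tuple R * R)%type.

Section space.
Context {R : realType}.

Definition R0 : set R := ~` [set 0].

Definition bounded_borel_Rd (d : nat) (B : set (d.-tuple R)) : Prop :=
  measurable B /\ exists M : R, forall x, B x -> forall i, `|tnth x i| <= M.

(* bounded Borel subsets of R_+ x R^d *)
Definition bounded_borel_tx (d : nat) (B : set (R * d.-tuple R)) : Prop :=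
  [/\ measurable B, B `<=` `[0, +oo[ `*` setT &
      exists M : R, forall p, B p -> p.1 <= M /\ forall i, `|tnth p.2 i| <= M].

(* Borel subsets of R_0 that are bounded away from 0 (not nec. bounded) *)
Definition borel_away_from_0 (G : set R) : Prop :=
  measurable G /\ exists2 e : R, 0 < e & forall z, G z -> e <= `|z|.

Fixpoint lebesgue_tuple (n : nat) : set (n.-tuple R) -> \bar R :=
  match n with
  | 0 => fun A => \d_[tuple] A
  | m.+1 => fun A =>
      ((lebesgue_measure : set R -> \bar R) \x @lebesgue_tuple m)%E
        [set p : R * m.-tuple R | A [tuple of p.1 :: p.2]]
  end.

Definition levy_measure (nu : {measure set R -> \bar R}) : Prop :=
  nu [set 0] = 0%E /\
  (\int[nu]_(z in R0) (Num.min 1 (`|z| ^+ 2))%:E < +oo)%E.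

(* dt dx nu(dz) as a measure on R x R^d x R that vanishes off R_+ x R^d x R_0
   (for z = 0, because nu {0} = 0) *)
Definition intensity (d : nat) (nu : {measure set R -> \bar R}) :
    set (txz R d) -> \bar R :=
  ((mrestr (lebesgue_measure : set R -> \bar R) (measurable_itv `[0%R, +oo[)
     \x @lebesgue_tuple d) \x nu)%E.

End space.

(* The second argument of poisson_prob is a dummy. *)
Definition poisson_random_measure {dO dE : measure_display}
    {Omega : measurableType dO} {E : measurableType dE} {R : realType}
    (P : probability Omega R) (mu : set E -> \bar R)
    (N : Omega -> {measure set E -> \bar R}) : Prop :=
  [/\ forall A, measurable A -> measurable_fun setT (fun w => N w A : \bar R),
      forall A, measurable A -> (mu A < +oo)%E -> forall k : nat,
        P [set w | N w A = k%:R%:E] = poisson_prob (fine (mu A)) k [set k],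
      forall A, measurable A -> mu A = +oo%E ->
        P [set w | N w A = +oo%E] = 1%E &
      forall (n : nat) (A : 'I_n -> set E) (Y : 'I_n -> set (\bar R)),
        (forall i, measurable (A i)) -> (forall i, measurable (Y i)) ->
        trivIset setT A ->
        P (\bigcap_(i in setT) [set w | Y i (N w (A i))]) =
        (\prod_(i < n) P [set w | Y i (N w (A i))])%E].

Section stochastic_integral.
Context {dO : measure_display} {Omega : measurableType dO} {R : realType}.
Context {d : nat}.
Variables (P : probability Omega R) (nu : {measure set R -> \bar R}).
Variables (N : Omega -> {measure set (txz R d) -> \bar R}).

(* the filtration (F_t) of N *)
Definition filtrationN (t : R) : set (set Omega) :=
  sigma_family setT
    [set i : R * set (d.-tuple R) * set R |
      [/\ 0 <= i.1.1 <= t, bounded_borel_Rd i.1.2 & borel_away_from_0 i.2]]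
    (fun i w => N w (`[0, i.1.1] `*` i.1.2 `*` i.2) : \bar R).

Record elementary := Elementary {
  el_a : R;
  el_b : R;
  el_X : Omega -> R;
  el_A : set (d.-tuple R);
  el_G : set R;
  _ : 0 <= el_a < el_b;
  _ : exists M : R, forall w, `|el_X w| <= M;
  _ : measurable_wrt setT (filtrationN el_a) el_X;
  _ : bounded_borel_Rd el_A;
  _ : borel_away_from_0 el_G }.

Definition elementary_process (e : elementary) (q : Omega * txz R d) : R :=
  let: (w, (t, x, z)) := q in
  el_X e w * \1_`]el_a e, el_b e] t * \1_(el_A e) x * \1_(el_G e) z.

(* Linear combinations are lists of pairs (coefficient, elementary process). *)
Definition simple_process (s : seq (R * elementary)) (q : Omega * txz R d) : R :=
  \sum_(ce <- s) ce.1 * elementary_process ce.2 q.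

(* Omega x I x R^d x R_0 *)
Definition slab (I : set R) : set (Omega * txz R d) :=
  setT `*` (I `*` setT `*` R0).

Definition predictable_sigma : set (set (Omega * txz R d)) :=
  sigma_family (slab `[0, +oo[) setT simple_process.

(* predictability of a process indexed by [0, T] x R^d x R_0; the slab over
   [0, T] belongs to predictable_sigma *)
Definition predictable (T : R) (H : Omega * txz R d -> R) : Prop :=
  measurable_wrt (slab `[0, T]) predictable_sigma H.

(* N(A) - mu(A), for mu(A) finite *)
Definition Nhat (A : set (txz R d)) (w : Omega) : R :=
  fine (N w A) - fine (intensity nu A).

(* integrals over [0, T] x R^d x R_0 *)
Definition elementary_integral (T : R) (e : elementary) (w : Omega) : R :=
  el_X e w *
  Nhat (`]Num.min (el_a e) T, Num.min (el_b e) T] `*` el_A e `*` el_G e) w.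

Definition simple_integral (T : R) (s : seq (R * elementary)) (w : Omega) : R :=
  \sum_(ce <- s) ce.1 * elementary_integral T ce.2 w.

(* E int_0^T int int |H|^2 nu(dz) dx dt *)
Definition energy (T : R) (H : Omega * txz R d -> R) : \bar R :=
  (\int[P]_w \int[lebesgue_measure : set R -> \bar R]_(t in `[0%R, T])
     \int[@lebesgue_tuple R d]_x \int[nu]_(z in R0)
       (`|H (w, (t, x, z))| ^+ 2)%:E)%E.

(* J is a version of int_0^T int int H dNhat.  The graph of the isometric
   extension is the closure, in L^2(P x mu) x L^2(P), of the graph of the
   integral on linear combinations of elementary processes. *)
Definition is_stoch_integral (T : R) (H : Omega * txz R d -> R)
    (J : Omega -> R) : Prop :=
  measurable_fun setT J /\
  exists s : nat -> seq (R * elementary),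
    (fun n => energy T (fun q => simple_process (s n) q - H q))
      @ \oo --> 0%E /\
    (fun n => 'E_P[fun w => (`|simple_integral T (s n) w - J w| ^+ 2)%R]%E)
      @ \oo --> 0%E.

(* L B is a version of int_{B x R_0} z dNhat, for every bounded Borel B.  At
   t = 0 the integrand is predictable only up to a P x mu-null set, which
   is_stoch_integral does not see. *)
Definition levy_white_noise (L : set (R * d.-tuple R) -> Omega -> R) : Prop :=
  forall B, bounded_borel_tx B ->
  forall T : R, 0 <= T -> B `<=` `[0, T] `*` setT ->
    is_stoch_integral T (fun '(w, (t, x, z)) => \1_B (t, x) * z) (L B).

Definition filtrationL (L : set (R * d.-tuple R) -> Omega -> R) (t : R) :
    set (set Omega) :=
  sigma_family setT
    [set i : R * set (d.-tuple R) | 0 <= i.1 <= t /\ bounded_borel_Rd i.2]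
    (fun i => L (`[0, i.1] `*` i.2)).

Definition L2C (G : set (set Omega)) (F : Omega -> R[i]) : Prop :=
  [/\ measurable_wrt setT G (fun w => complex.Re (F w)),
      measurable_wrt setT G (fun w => complex.Im (F w)) &
      ('E_P[fun w => (Normc.normc (F w) ^+ 2)%R] < +oo)%E].

Definition expectationC (F : Omega -> R[i]) : R[i] :=
  Complex (fine 'E_P[fun w => complex.Re (F w)]%E)
          (fine 'E_P[fun w => complex.Im (F w)]%E).

Definition predictableC (T : R) (psi : Omega * txz R d -> R[i]) : Prop :=
  predictable T (fun q => complex.Re (psi q)) /\
  predictable T (fun q => complex.Im (psi q)).

Definition energyC (T : R) (psi : Omega * txz R d -> R[i]) : \bar R :=
  energy T (fun q => Normc.normc (psi q)).

Definition is_stoch_integralC (T : R) (psi : Omega * txz R d -> R[i])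
    (J : Omega -> R[i]) : Prop :=
  is_stoch_integral T (fun q => complex.Re (psi q)) (fun w => complex.Re (J w))
  /\
  is_stoch_integral T (fun q => complex.Im (psi q)) (fun w => complex.Im (J w)).

Definition is_representation (T : R) (F : Omega -> R[i])
    (psi : Omega * txz R d -> R[i]) : Prop :=
  [/\ predictableC T psi, (energyC T psi < +oo)%E &
      exists2 J, is_stoch_integralC T psi J &
        {ae P, forall w, F w = expectationC F + J w}].

End stochastic_integral.

(* Main.v *)
From HB Require Import structures.
Require Import Defs.
From mathcomp Require Import all_boot all_order all_algebra.
From mathcomp Require Import all_classical all_reals all_analysis.
From mathcomp Require Import measurable_realfun.
From mathcomp Require Import complex ring lra.

(** The integral is an isometry from simple processes into [L^2(P)], so it is
enough to approximate [F] in [L^2] by constants plus integrals of simple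
processes: the integrands then form a Cauchy sequence, and uniqueness is
immediate.

The key case is a Laplace functional [exp(-X_T)], where
[X_t = sum_j N([0, min t s_j] x C_j)].  Up to a constant it is the terminal
value of the martingale [M_t = exp(Lambda_t - X_t)].  On a grid of mesh
[T / n], independence of the increments gives
[M_(i+1) - M_i = M_i (Z_i + zeta_i)], where [Z_i] is the first order part, an
integral of constants against the compensated measure, and [zeta_i] is
centred, independent of the past and of variance [O(n^-2)].  The terms
[M_i zeta_i] are orthogonal, so [M_T - 1 - sum_i M_i Z_i] has variance
[O(1/n)], and [M_i Z_i] is the integral of a simple process.  A monotone class
argument extends the approximation to the sigma-field of [N] up to time [T],
and the sigma-field of the white noise is contained in its completion. *)

Set Implicit Arguments.
Unset Strict Implicit.
Unset Printing Implicit Defensive.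

Import Order.TTheory GRing.Theory Num.Theory.
Import numFieldNormedType.Exports.

Local Open Scope classical_set_scope.
Local Open Scope ring_scope.

(** * Monotone classes and Laplace functionals *)

(** The sets [[0, s_j] x C_j] overlap, so their counts are dependent and the exponential does not
    factor over them. It factors over the sets of points covered exactly [k] times, which are
    disjoint and carry the weight [k]; but these are not rectangles, so a constant times their
    compensated counts is not the integral of an elementary process. Inclusion-exclusion reconciles
    the two descriptions: a function of the number of overlaps, here [e^-k - 1], is also a
    combination of indicators of intersections of rectangles, and both forms have the same integral
    against [mu] and, almost surely, against [N w].

    Exponentials are chosen because they are bounded and closed under products, as the monotone
    class argument demands, and because the second moments of a step reduce to one number [q]: the
    error has variance [e^q - 1 - q].

    The completion is forced by the white noise: [L(B)] is given only as an [L^2] limit, and even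
    the count over []a, b]] is the difference of the counts over [[0, b]] and [[0, a]] only where
    these are finite. *)

Section monotone_class.
Context {U : Type} {R : realType}.
Implicit Types (H K : set (U -> R)) (A B : set U).

(** Closure is under all bounded pointwise limits: the step functions below are limits of
    polynomials, and there is then no monotonicity to check. *)
Record bounded_monotone_class H : Prop := BoundedMonotoneClass {
  bmc1 : H (cst 1);
  bmcDZ : forall a f g, H f -> H g -> H (fun x => a * f x + g x);
  bmc_lim : forall (f : nat -> U -> R) (M : R) g, (forall n, H (f n)) ->
    (forall n x, `|f n x| <= M) -> (forall x, f n x @[n --> \oo] --> g x) ->
    H g }.

Lemma bernoulli_sub (x : R) n : 0 <= x <= 1 -> 1 - n%:R * x <= (1 - x) ^+ n.
Proof.
move=> /andP[x0 x1]; elim: n => [|n ih]; first by rewrite mul0r subr0 expr0.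
rewrite exprS; apply: le_trans (ler_wpM2l _ ih); last by lra.
rewrite -natr1; have : 0 <= n%:R * x * x by rewrite !mulr_ge0.
by nra.
Qed.

(** The upper companion of Bernoulli's inequality, [(1 - x)^n <= 1 / (1 + n x)]; it follows from
    [(1 - x) (1 + (n+1) x) <= 1 + n x]. *)
Lemma bernoulli_inv (x : R) n : 0 <= x <= 1 -> (1 - x) ^+ n * (1 + n%:R * x) <= 1.
Proof.
move=> /andP[x0 x1]; elim: n => [|n ih]; first by rewrite mul0r addr0 expr0 mulr1.
rewrite exprS; apply: le_trans ih.
rewrite mulrAC mulrC ler_wpM2l ?exprn_ge0 ?subr_ge0//.
rewrite -natr1; have : 0 <= n%:R * x * x by rewrite !mulr_ge0.
by nra.
Qed.

(** With [z = y^2], the sequence [n y^n] is bounded by the upper Bernoulli inequality, and the other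
    factor [y^n] tends to 0. *)
Lemma cvg_natmul_geometric (z : R) : 0 <= z < 1 ->
  n%:R * z ^+ n @[n --> \oo] --> (0 : R).
Proof.
move=> /andP[z0 z1].
have [->|zn0] := eqVneq z 0.
  apply: cvg_near_cst; exists 1%N => // -[|n] _ //=.
  by rewrite expr0n/= mulr0.
pose y := Num.sqrt z.
have y0 : 0 < y by rewrite sqrtr_gt0 lt_neqAle eq_sym zn0.
have y1 : y < 1 by rewrite -sqrtr1 ltr_sqrt.
have ny n : n%:R * y ^+ n <= (1 - y)^-1.
  have b := @bernoulli_inv (1 - y) n; rewrite subKr in b.
  rewrite -[leRHS]mul1r ler_pdivlMr ?subr_gt0//.
  apply: le_trans (b _); last by lra.
  rewrite (_ : _ * (1 - y) = y ^+ n * (n%:R * (1 - y))); last by ring.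
  by rewrite [leRHS]mulrDr mulr1 lerDr exprn_ge0// ltW.
apply: (@squeeze_cvgr _ _ _ _ (cst 0) (fun n => (1 - y)^-1 * y ^+ n)).
- near=> n; rewrite mulr_ge0 ?exprn_ge0//=.
  rewrite -(sqr_sqrtr z0) -/y expr2 exprMn mulrA.
  by rewrite ler_wpM2r// exprn_ge0// ltW.
- exact: cvg_cst.
- by rewrite -(mulr0 (1 - y)^-1); apply: cvgMr; apply: cvg_expr; rewrite ger0_norm ?ltW.
Unshelve. all: by end_near. Qed.

(* Brosowski-Deutsch: these polynomials converge to a step function at 1/2;
   the factor n forces the limit 0 at 1/2 itself. *)
Lemma cvg_step_polynomial (v : R) : 0 <= v <= 1 ->
  (1 - v ^+ n) ^+ (n * 2 ^ n) @[n --> \oo] --> ((v < 2^-1)%R%:R : R).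
Proof.
move=> /andP[v0 v1].
have vn n : 0 <= v ^+ n <= 1 by rewrite exprn_ge0//= exprn_ile1.
case: ltP => v2 /=.
  (* Bernoulli with [x = v^n] and exponent [n 2^n]; here [2 v < 1]. *)
  apply: (@squeeze_cvgr _ _ _ _ (fun n => 1 - n%:R * (2 * v) ^+ n) (cst 1)).
  - near=> n; apply/andP; split.
      by rewrite exprMn mulrA -natrX -natrM bernoulli_sub.
    by rewrite exprn_ile1//; have /andP[] := vn n; lra.
  - rewrite -[X in _ --> X]subr0; apply: cvgB; first exact: cvg_cst.
    by apply: cvg_natmul_geometric; lra.
  - exact: cvg_cst.
(* Here [2^n v^n >= 1], so the exponent times [v^n] is at least [n] and the upper Bernoulli bound
   gives [1 / (n + 1)]. *)
apply: (@squeeze_cvgr _ _ _ _ (cst 0) (fun n => n.+1%:R^-1)).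
- near=> n; rewrite exprn_ge0/=; last by have /andP[] := vn n; lra.
  rewrite -[leRHS]mul1r ler_pdivlMr//.
  apply: le_trans (bernoulli_inv (n * 2 ^ n) (vn n)).
  rewrite ler_wpM2l ?exprn_ge0//; first by have /andP[] := vn n; lra.
  rewrite -nat1r lerD2l natrM -mulrA -[leLHS]mulr1 ler_wpM2l// natrX -exprMn.
  by rewrite exprn_ege1//; lra.
- exact: cvg_cst.
- exact: cvg_harmonic.
Unshelve. all: by end_near. Qed.

Section mult_class.
Variables (H : set (U -> R)) (Hbmc : bounded_monotone_class H).
Hypothesis HM : forall f g, H f -> H g -> H (fun x => f x * g x).

Lemma bmc_cst a : H (cst a).
Proof.
rewrite (_ : cst a = fun x => (a - 1) * (cst 1 x : R) + cst 1 x).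
  exact: (bmcDZ Hbmc _ (bmc1 Hbmc) (bmc1 Hbmc)).
by apply/funext => x /=; lra.
Qed.

Lemma bmc_exp f n : H f -> H (fun x => f x ^+ n).
Proof.
move=> Hf; elim: n => [|n ih]; first exact: (bmc_cst 1).
rewrite (_ : (fun _ => _) = fun x => f x * f x ^+ n); first exact: HM.
by apply/funext => x; rewrite exprS.
Qed.

(** An affine change of variable sends [f] into [[0, 1]] and [c] to 1/2; the step polynomials then
    stay in [H], which is an algebra, and converge boundedly to the indicator. *)
Lemma bmc_lt f (M c : R) : H f -> (forall x, `|f x| <= M) ->
  H (\1_[set x | f x < c]).
Proof.
move=> Hf fM.
pose r := (2 * (`|M| + `|c| + 1))^-1.
have r0 : 0 < r by rewrite invr_gt0; have := normr_ge0 M; have := normr_ge0 c; lra.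
pose v x := r * f x + (2^-1 - r * c).
have v01 x : 0 <= v x <= 1.
  have : `|r * (f x - c)| <= 2^-1.
    rewrite normrM (gtr0_norm r0) -ler_pdivlMl// /r invrK.
    rewrite (le_trans (ler_normB _ _))//.
    have := fM x; have := ler_norm M; lra.
  by rewrite ler_norml /v => /andP[]; lra.
have vc x : (v x < 2^-1) = (f x < c).
  by rewrite /v -(ltr_pM2l r0 (f x)); apply/idP/idP; lra.
have Hv : H v by apply: (bmcDZ Hbmc) => //; exact: bmc_cst.
apply: (bmc_lim Hbmc (f := fun n x => (1 - v x ^+ n) ^+ (n * 2 ^ n)) (M := 1)).
- move=> n; apply: bmc_exp.
  rewrite (_ : (fun _ => _) = fun x => -1 * v x ^+ n + cst 1 x).
    by apply: (bmcDZ Hbmc); [exact: bmc_exp|exact: bmc1].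
  by apply/funext => x /=; lra.
- move=> n x; have /andP[v0 v1] := v01 x.
  have : 0 <= v x ^+ n <= 1 by rewrite exprn_ge0//= exprn_ile1.
  move=> /andP[? ?].
  by rewrite ger0_norm ?exprn_ge0 ?exprn_ile1//; lra.
- move=> x; rewrite indicE [_ \in _](_ : _ = (v x < 2^-1)); last first.
    by rewrite vc; apply/idP/idP; rewrite inE.
  exact: cvg_step_polynomial.
Qed.

Lemma bmc_sigma_algebra : sigma_algebra setT [set A | H \1_A].
Proof.
have HC A : H \1_A -> H \1_(~` A).
  move=> HA; rewrite (_ : \1_(~` A) = fun x => -1 * \1_A x + cst 1 x).
    by apply: (bmcDZ Hbmc) => //; exact: bmc1.
  apply/funext => x /=; rewrite !indicE in_setC.
  by case: (x \in A) => /=; lra.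
have HI A B : H \1_A -> H \1_B -> H \1_(A `&` B).
  move=> HA HB; rewrite (_ : \1_(A `&` B) = fun x => \1_A x * \1_B x).
    exact: HM.
  by rewrite indicI.
split.
- by rewrite /= indic0; exact: (bmc_cst 0).
- by move=> A; rewrite /= setTD; exact: HC.
- move=> F HF.
  (* The complement of the union is a decreasing limit of finite intersections, whose indicators are
     products. *)
  pose G n := \bigcap_(i < n) ~` F i.
  have HG n : H \1_(G n).
    elim: n => [|n ih].
      rewrite (_ : G 0%N = setT); last by rewrite /G; apply/seteqP; split.
      by rewrite indicT; exact: bmc1.
    rewrite (_ : G n.+1 = G n `&` ~` F n); first by apply: HI => //; exact: HC (HF n).
    apply/seteqP; split => x /=.
      move=> Gx; split; last exact: Gx (ltnSn n).
      by move=> i /= /ltnW ?; exact: Gx.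
    move=> [Gx Fx] i /=; rewrite ltnS leq_eqVlt => /orP[/eqP->//|]; exact: Gx.
  rewrite /= -[X in \1_X]setCK; apply: HC.
  apply: (bmc_lim Hbmc (f := fun n => \1_(G n)) (M := 1)) => //.
    by move=> n x; rewrite indicE; case: (_ \in _); rewrite ?normr1 ?normr0.
  move=> x; have [[i _ Fi]|nF] := pselect ((\bigcup_k F k) x).
    apply: cvg_near_cst; exists i.+1 => // n /= ni.
    rewrite !indicE memNset; last by move=> /(_ i ni).
    by rewrite memNset// => /(_ _); apply; exists i.
  apply: cvg_near_cst; exists 0%N => // n _ /=.
  rewrite !indicE !mem_set// => i _ Fi; apply: nF; by exists i.
Qed.

End mult_class.

Lemma cvg_norm_le (u : nat -> R) (l M : R) : u n @[n --> \oo] --> l ->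
  (forall n, `|u n| <= M) -> `|l| <= M.
Proof.
move=> ul uM; have cv : `|u n| @[n --> \oo] --> `|l| by exact: cvg_norm.
rewrite -(cvg_lim _ cv)//; apply: limr_le; first by apply/cvg_ex; exists `|l|.
exact: nearW.
Qed.

Section generated.
Variable K : set (U -> R).
Hypothesis Kbnd : forall f, K f -> exists M : R, forall x, `|f x| <= M.
Hypothesis KM : forall f g, K f -> K g -> K (fun x => f x * g x).

(** The smallest bounded monotone class containing [K], cut down to bounded functions:
    multiplication by a fixed member must preserve bounded limits. *)
Definition gen_bmc : set (U -> R) := [set f | (exists M : R, forall x, `|f x| <= M) /\
  forall H, bounded_monotone_class H -> K `<=` H -> H f].

Lemma sub_gen_bmc : K `<=` gen_bmc.
Proof. by move=> f Kf; split; [exact: Kbnd|move=> H _; exact]. Qed.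

Lemma gen_bmc_closed : bounded_monotone_class gen_bmc.
Proof.
split.
- split; first by exists 1 => x; rewrite normr1.
  by move=> H Hc _; exact: bmc1.
- move=> a f g [[M fM] Hf] [[M' gM] Hg]; split.
    exists (`|a| * M + M') => x.
    rewrite (le_trans (ler_normD _ _))// lerD// normrM ler_wpM2l//.
  by move=> H Hc KH; apply: (bmcDZ Hc); [exact: Hf|exact: Hg].
- move=> f M g Hf fM fg; split.
    by exists M => x; apply: (cvg_norm_le (fg x)).
  move=> H Hc KH; apply: (bmc_lim Hc _ fM fg) => n.
  by have [_] := Hf n; apply.
Qed.

(** Stability under products is transferred from [K] one factor at a time: for fixed [h], the
    functions whose product with [h] lies in the class form a bounded monotone class. *)
Lemma gen_bmcM f g : gen_bmc f -> gen_bmc g -> gen_bmc (fun x => f x * g x).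
Proof.
have closed h : gen_bmc h ->
    bounded_monotone_class [set f | gen_bmc (fun x => f x * h x)].
  move=> Gh; split => /=.
  - by rewrite (_ : (fun x => _) = h)//; apply/funext => x; rewrite mul1r.
  - move=> a f1 f2 H1 H2.
    rewrite (_ : (fun x => _) = fun x => a * (f1 x * h x) + f2 x * h x).
      exact: (bmcDZ gen_bmc_closed).
    by apply/funext => x; rewrite mulrDl mulrA.
  - move=> F M G HF FM FG; have [[M' hM] _] := Gh.
    apply: (bmc_lim gen_bmc_closed HF (M := M * M')).
      by move=> n x; rewrite normrM ler_pM.
    by move=> x; apply: cvgMl; exact: FG.
have GK h k : gen_bmc h -> K k -> gen_bmc (fun x => h x * k x).
  move=> [_ Gh] Kk; apply: (Gh [set f | gen_bmc (fun x => f x * k x)]).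
    by apply: closed; exact: sub_gen_bmc.
  by move=> k' Kk'; apply: sub_gen_bmc; exact: KM.
move=> [_ Gf] Gg; apply: (Gf [set f | gen_bmc (fun x => f x * g x)]).
  exact: closed.
move=> k Kk /=; rewrite (_ : (fun x => _) = fun x => g x * k x); first exact: GK.
by apply/funext => x; rewrite mulrC.
Qed.

End generated.

(** On [[0, +oo]] this is [e^-x] as a real number, with value 0 at [+oo]: counts are extended reals
    and may be infinite. *)
Definition expN (x : \bar R) : R := fine (expeR (- x)).

Lemma expNE x : (0 <= x)%E -> (expN x)%:E = expeR (- x).
Proof.
move=> x0; rewrite /expN fineK// fin_numElt.
rewrite (lt_le_trans _ (expeR_ge0 _)) ?ltNyr//=.
by rewrite (@le_lt_trans _ _ 1%E) ?ltry// -expeR0 lee_expeR oppe_le0.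
Qed.

Lemma expN_ge0_le1 x : (0 <= x)%E -> 0 <= expN x <= 1.
Proof.
by move=> x0; rewrite -!lee_fin expNE// expeR_ge0 -expeR0 lee_expeR oppe_le0.
Qed.

Lemma expND x y : (0 <= x)%E -> (0 <= y)%E -> expN (x + y)%E = expN x * expN y.
Proof.
move=> x0 y0; apply: EFin_inj; rewrite EFinM !expNE ?adde_ge0//.
by rewrite -expeRD oppeD// ge0_adde_def// inE.
Qed.

Lemma expN_fin (x : R) : expN x%:E = expR (- x). Proof. by []. Qed.

Lemma expN0 : expN 0%E = 1. Proof. by rewrite expN_fin oppr0 expR0. Qed.

Lemma expN_sum I (l : seq I) (x : I -> \bar R) :
  (forall i, (0 <= x i)%E) -> expN (\sum_(i <- l) x i)%E = \prod_(i <- l) expN (x i).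
Proof.
move=> x0; elim: l => [|i l ih]; first by rewrite !big_nil expN0.
by rewrite !big_cons expND ?sume_ge0// ih.
Qed.

Lemma measurable_fun_expN : measurable_fun setT expN.
Proof.
have mfin : measurable [set x : \bar R | x \is a fin_num].
  by rewrite -[X in measurable X]setTI; exact: emeasurable_fin_num.
rewrite (_ : expN = fun x => expR (- fine x) *
    \1_[set x : \bar R | x \is a fin_num] x).
  apply: measurable_funM => //; apply: measurableT_comp => //.
  by apply: measurableT_comp => //; exact: fine_measurable.
apply/funext => -[r| |]; rewrite indicE.
- by rewrite mem_set//= mulr1.
- by rewrite memNset//= mulr0.
- by rewrite memNset//= mulr0.
Qed.

(* A monotone class theorem: the Laplace functionals of finite sums form a
   multiplicative family that generates the sigma-field. *)
Lemma sigma_family_laplace I (J : set I) (X : I -> U -> \bar R)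
    (H : set (U -> R)) :
  (forall i x, (0 <= X i x)%E) ->
  bounded_monotone_class H ->
  (forall l : seq I, all (fun i => `[< J i >]) l ->
    H (fun x => expN (\sum_(i <- l) X i x)%E)) ->
  forall A, sigma_family setT J X A -> H \1_A.
Proof.
move=> X0 HH HL.
pose K : set (U -> R) := [set f | exists l : seq I, all (fun i => `[< J i >]) l
  /\ f = fun x => expN (\sum_(i <- l) X i x)%E].
have Kbnd f : K f -> exists M : R, forall x, `|f x| <= M.
  move=> [l [_ ->]]; exists 1 => x.
  have /andP[? ?] : 0 <= expN (\sum_(i <- l) X i x)%E <= 1.
    by apply: expN_ge0_le1; exact: sume_ge0.
  by rewrite ger0_norm.
have KM f g : K f -> K g -> K (fun x => f x * g x).
  move=> [l [Jl ->]] [l' [Jl' ->]]; exists (l ++ l'); split.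
    by rewrite all_cat Jl.
  by apply/funext => x; rewrite big_cat expND// sume_ge0.
have KH : K `<=` H by move=> f [l [Jl ->]]; exact: HL.
have cl := gen_bmc_closed K.
have clM f g : gen_bmc K f -> gen_bmc K g -> gen_bmc K (fun x => f x * g x).
  by move=> ? ?; exact: gen_bmcM.
have sS := bmc_sigma_algebra cl clM.
suff : sigma_family setT J X `<=` [set A | gen_bmc K \1_A].
  by move=> sub A /sub[_]; apply.
apply: smallest_sub => // _ [i Ji] [Y mY <-].
have sI := sigma_algebra_image (X i) sS.
have : <<s @ErealGenInftyO.G R >> Y by rewrite -[X in X Y]ErealGenInftyO.measurableE.
suff : <<s @ErealGenInftyO.G R >> `<=` image_set_system setT (X i) [set A | gen_bmc K \1_A] by exact.
apply: smallest_sub => // _ [r ->].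
rewrite /image_set_system /= setTI.
(* The rays []-oo, r[] generate the Borel sets; the decreasing exponential turns [X < r] into a
   strict sublevel set of [- expN X]. *)
rewrite (_ : _ @^-1` _ = [set x | - expN (X i x) < - expR (- r)]).
  have Ki : gen_bmc K (fun x => expN (X i x)).
    apply: sub_gen_bmc => //; exists [:: i]; split => /=.
      by rewrite andbT; exact/asboolP.
    by apply/funext => x; rewrite big_seq1.
  apply: (bmc_lt cl clM (M := 1)).
    rewrite (_ : (fun x => _) = fun x => (-2) * expN (X i x) + expN (X i x)).
      exact: (bmcDZ cl).
    by apply/funext => x; lra.
  move=> x; have /andP[? ?] := expN_ge0_le1 (X0 i x).
  by rewrite normrN ger0_norm.
apply/seteqP; split => x /=; rewrite in_itv/= ltrN2 -lte_fin expNE//.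
  by rewrite -[(expR _)%:E]/(expeR (- r%:E)) lte_expeR lteN2.
by rewrite -[(expR _)%:E]/(expeR (- r%:E)) lte_expeR lteN2.
Qed.

End monotone_class.

(** * Products of independent variables *)

Section independence.
Context {dO : measure_display} {Omega : measurableType dO} {R : realType}.
Variable P : probability Omega R.

Definition independent_events (A B : set Omega) : Prop :=
  P (A `&` B) = (P A * P B)%E.

Definition independent_RV (Y Z : Omega -> R) : Prop :=
  forall A B, measurable A -> measurable B ->
    independent_events (Y @^-1` A) (Z @^-1` B).

Section product.
Variables Y Z : Omega -> R.
Hypotheses (mY : measurable_fun setT Y) (mZ : measurable_fun setT Z).
Hypothesis YZ : independent_RV Y Z.

HB.instance Definition _ := isMeasurableFun.Build _ _ _ _ Y mY.
HB.instance Definition _ := isMeasurableFun.Build _ _ _ _ Z mZ.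

Let W w := (Y w, Z w).
Let mW : measurable_fun setT W.
Proof. exact: measurable_fun_pair. Qed.
HB.instance Definition _ := isMeasurableFun.Build _ _ _ _ W mW.

Let law_W A : measurable A ->
  pushforward P W A = (distribution P Y \x distribution P Z)%E A.
Proof.
move=> mA; apply/esym.
have := @product_measure_unique _ _ _ _ _
  (distribution P Y) (distribution P Z) (distribution P W).
by rewrite /distribution; apply.
Qed.

Let ge0_law_W (f : R * R -> \bar R) : measurable_fun setT f ->
  (forall p, (0 <= f p)%E) ->
  (\int[P]_w f (W w) = \int[P]_x \int[P]_y f (Y x, Z y))%E.
Proof.
move=> mf f0.
have -> : (\int[P]_w f (W w) =
    \int[(distribution P Y \x distribution P Z)%E]_p f p)%E.
  rewrite -[LHS](ge0_integral_pushforward mW P measurableT)//.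
  by apply: eq_measure_integral => A mA _; exact: law_W.
rewrite fubini_tonelli1// /fubini_F ge0_integral_distribution//.
- apply: eq_integral => x _ /=; rewrite ge0_integral_distribution//.
  exact: measurableT_comp mf _.
- exact: measurable_fun_fubini_tonelli_F mf f0.
- by move=> x; exact: integral_ge0.
Qed.

(** The law of [(Y, Z)] is the product of the marginal laws; Tonelli for [|y z|] gives
    integrability, then Fubini gives the product of the means. *)
Lemma independent_integrable :
  P.-integrable setT (EFin \o Y) -> P.-integrable setT (EFin \o Z) ->
  P.-integrable setT (EFin \o (fun w => Y w * Z w)) /\
  \int[P]_w (Y w * Z w) = \int[P]_w Y w * \int[P]_w Z w.
Proof.
move=> iY iZ.
have mf : measurable_fun setT (fun p : R * R => (p.1 * p.2)%:E).
  by apply/measurable_EFinP; exact: measurable_funM.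
have fin : (\int[P]_w `|(Y w * Z w)%:E| < +oo)%E.
  rewrite (ge0_law_W (f := fun p => `|(p.1 * p.2)%:E|)%E)//; last first.
    exact: measurableT_comp.
  under eq_integral => x _.
    under eq_integral do rewrite /= normrM EFinM.
    rewrite ge0_integralZl_EFin//; last first.
      by apply/measurable_EFinP; exact: measurableT_comp.
    over.
  rewrite ge0_integralZr//=; last 2 first.
  - by apply/measurable_EFinP; exact: measurableT_comp.
  - exact: integral_ge0.
  rewrite lte_mul_pinfty//; first exact: integral_ge0.
  - move: iY => /integrableP[_]; rewrite ge0_fin_numE//; exact: integral_ge0.
  - by move: iZ => /integrableP[].
have iYZ : P.-integrable setT (EFin \o (fun w => Y w * Z w)).
  apply/integrableP; split => //.
  by apply/measurable_EFinP; exact: measurable_funM.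
split => //.
have iW : (distribution P Y \x distribution P Z)%E.-integrable setT
    (fun p : R * R => (p.1 * p.2)%:E).
  apply/integrableP; split => //.
  rewrite (eq_measure_integral (pushforward P W)); last first.
    by move=> A mA _; apply/esym; exact: law_W.
  rewrite (ge0_integral_pushforward mW)//.
  exact: measurableT_comp.
have EZ : (\int[P]_w (Z w)%:E = (\int[P]_w Z w)%:E)%E.
  by rewrite fineK//; exact: integrable_fin_num.
apply: EFin_inj; rewrite EFinM !fineK; try exact: integrable_fin_num.
have -> : (\int[P]_w (Y w * Z w)%:E =
    \int[(distribution P Y \x distribution P Z)%E]_p (p.1 * p.2)%:E)%E.
  rewrite -[LHS](integral_pushforward mW (mu := P) (D := setT) (f := fun p : R * R => (p.1 * p.2)%:E))//.
  by apply: eq_measure_integral => A mA _; exact: law_W.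
rewrite -integral12_prod_meas1//= /fubini_F.
under eq_integral => x _.
  under eq_integral do rewrite EFinM.
  rewrite (@integral_distribution _ _ _ _ _ P Z (fun y => x%:E * y%:E)%E)//; last 2 first.
  - by apply/measurable_EFinP; exact: measurable_funM.
  - exact: integrableZl.
  rewrite /comp integralZl// EZ.
  over.
rewrite (@integral_distribution _ _ _ _ _ P Y (fun x => x%:E * _)%E)//; last 2 first.
- exact: emeasurable_funM.
- exact: integrableZr.
by rewrite /comp integralZr// EZ.
Qed.
End product.
End independence.

(** * Square-integrable functions *)

(** Gives access to the closure properties of measurable functions, over [g_sigma_algebraType G],
    for a sub-sigma-field of a space that already has its own sigma-field. *)
Lemma measurable_wrtP (T : pointedType) (G : set (set T)) d
    (V : measurableType d) (f : T -> V) : sigma_algebra setT G ->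
  measurable_wrt setT G f <->
  @measurable_fun _ _ (g_sigma_algebraType G) V setT f.
Proof.
move=> sG; split => [Gf _ Y mY|mf _ [Y mY <-]].
  by apply: sub_sigma_algebra; apply: Gf; exists Y.
have := mf measurableT Y mY.
by rewrite /measurable/= sigma_algebra_id.
Qed.

Section real_integrable.
Context {d : measure_display} {T : measurableType d} {R : realType}.
Variable m : {measure set T -> \bar R}.

Lemma integrableZ_EFin (a : R) (f : T -> R) : m.-integrable setT (EFin \o f) ->
  m.-integrable setT (EFin \o (fun x => a * f x)).
Proof.
move=> /(integrableZl measurableT a).
by apply: eq_integrable => // x _ /=; rewrite EFinM.
Qed.

Lemma integrableD_EFin (f g : T -> R) : m.-integrable setT (EFin \o f) ->
  m.-integrable setT (EFin \o g) ->
  m.-integrable setT (EFin \o (fun x => f x + g x)).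
Proof.
move=> intf intg; have := integrableD measurableT intf intg.
by apply: eq_integrable => // x _ /=; rewrite EFinD.
Qed.

Lemma Rintegral_sum I (l : seq I) (f : I -> T -> R) :
  (forall i, m.-integrable setT (EFin \o f i)) ->
  m.-integrable setT (EFin \o (fun x => \sum_(i <- l) f i x)) /\
  \int[m]_x (\sum_(i <- l) f i x) = \sum_(i <- l) \int[m]_x f i x.
Proof.
move=> intf; elim: l => [|i l [ih1 ih2]].
  under [X in EFin \o X]funext do rewrite big_nil.
  under [X in Rintegral _ _ X]funext do rewrite big_nil.
  rewrite big_nil Rintegral_cst// mul0r; split => //.
  exact: integrable0.
under [X in EFin \o X]funext do rewrite big_cons.
under [X in Rintegral _ _ X]funext do rewrite big_cons.
rewrite big_cons -ih2 RintegralD//; split => //.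
exact: integrableD_EFin.
Qed.

End real_integrable.

Section square_norm.
Context {d : measure_display} {T : measurableType d} {R : realType}.
Variable m : {measure set T -> \bar R}.
Implicit Types f g h : T -> R.

(** The square of the [L^2] norm, possibly infinite. Without the root, the triangle inequality
    carries a factor 2 on each term, which is why errors are quartered later on. *)
Definition sqnorm f : \bar R := (\int[m]_x (f x ^+ 2)%:E)%E.

Definition sqint f := measurable_fun setT f /\ (sqnorm f < +oo)%E.

Lemma sqnorm_ge0 f : (0 <= sqnorm f)%E.
Proof. by apply: integral_ge0 => x _; rewrite lee_fin sqr_ge0. Qed.

Lemma measurable_EFin_sqr f : measurable_fun setT f ->
  measurable_fun setT (fun x => (f x ^+ 2)%:E).
Proof. by move=> mf; apply/measurable_EFinP; exact: measurable_funX. Qed.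

Lemma sqnormD f g : measurable_fun setT f -> measurable_fun setT g ->
  (sqnorm (fun x => (f x + g x)%R) <= 2%:E * sqnorm f + 2%:E * sqnorm g)%E.
Proof.
move=> mf mg.
have sqr0 h x : [set: T] x -> (0 <= (h x ^+ 2 : R)%:E)%E by rewrite lee_fin sqr_ge0.
have [mf2 mg2] := (measurable_EFin_sqr mf, measurable_EFin_sqr mg).
rewrite -!ge0_integralZl// -?ge0_integralD//; first last.
- exact: sqr0.
- exact: sqr0.
- exact: emeasurable_funM.
- by move=> x Tx; rewrite mule_ge0// sqr0.
- exact: emeasurable_funM.
- by move=> x Tx; rewrite mule_ge0// sqr0.
apply: ge0_le_integral => //.
- exact: (sqr0 (fun x => f x + g x)).
- by apply: measurable_EFin_sqr; exact: measurable_funD.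
- by apply: emeasurable_funD; exact: emeasurable_funM.
- move=> x _; rewrite -!EFinM -EFinD lee_fin.
  by have := sqr_ge0 (f x - g x); nra.
Qed.

Lemma sqnormB_sym f g :
  sqnorm (fun x => f x - g x) = sqnorm (fun x => g x - f x).
Proof. by apply: eq_integral => x _; rewrite -sqrrN opprB. Qed.

Lemma sqnorm_triangle f g h : measurable_fun setT f -> measurable_fun setT g ->
  measurable_fun setT h ->
  (sqnorm (fun x => (f x - h x)%R) <=
    2%:E * sqnorm (fun x => (f x - g x)%R) + 2%:E * sqnorm (fun x => (g x - h x)%R))%E.
Proof.
move=> mf mg mh.
have -> : (fun x => f x - h x) = fun x => (f x - g x) + (g x - h x).
  by apply/funext => x; lra.
by apply: sqnormD; exact: measurable_funB.
Qed.

Lemma sqint_integrable2 f : sqint f ->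
  m.-integrable setT (EFin \o (fun x => f x ^+ 2)).
Proof.
move=> [mf f2]; apply/integrableP; split.
  by apply/measurable_EFinP; exact: measurable_funX.
by under eq_integral do rewrite /= ger0_norm ?sqr_ge0//.
Qed.

Lemma sqintM f g : sqint f -> sqint g ->
  m.-integrable setT (EFin \o (fun x => f x * g x)).
Proof.
move=> Hf Hg.
apply: (@le_integrable _ _ _ _ _ _ _ (EFin \o (fun x => f x ^+ 2 + g x ^+ 2))).
- exact: measurableT.
- by apply/measurable_EFinP; apply: measurable_funM; [case: Hf|case: Hg].
- move=> x _ /=; rewrite lee_fin.
  have f0 := sqr_ge0 (f x); have g0 := sqr_ge0 (g x).
  rewrite (ger0_norm (addr_ge0 f0 g0)) normrM -(real_normK (num_real (f x))).
  rewrite -(real_normK (num_real (g x))).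
  have := sqr_ge0 (`|f x| - `|g x|); have := normr_ge0 (f x); have := normr_ge0 (g x).
  by nra.
- rewrite (_ : EFin \o _ = (EFin \o (fun x => f x ^+ 2)) \+ (EFin \o (fun x => g x ^+ 2))).
    by apply: integrableD => //; exact: sqint_integrable2.
  by apply/funext => x.
Qed.

Lemma sqintD f g : sqint f -> sqint g -> sqint (fun x => f x + g x).
Proof.
move=> [mf f2] [mg g2]; split; first exact: measurable_funD.
by rewrite (le_lt_trans (sqnormD mf mg))// lte_add_pinfty// lte_mul_pinfty.
Qed.

Lemma sqintZ (a : R) f : sqint f -> sqint (fun x => a * f x).
Proof.
move=> [mf f2]; split; first exact: measurable_funM.
rewrite /sqnorm; under eq_integral do rewrite exprMn EFinM.
rewrite ge0_integralZl_EFin ?sqr_ge0//.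
- by rewrite lte_mul_pinfty// lee_fin sqr_ge0.
- by move=> x _; rewrite lee_fin sqr_ge0.
- by apply/measurable_EFinP; exact: measurable_funX.
Qed.

Lemma sqintB f g : sqint f -> sqint g -> sqint (fun x => f x - g x).
Proof.
move=> sf sg; rewrite (_ : (fun x => _) = fun x => f x + (-1) * g x).
  by apply: sqintD => //; exact: sqintZ.
by apply/funext => x; lra.
Qed.

Lemma sqint0 : sqint (fun=> 0).
Proof.
split => //; rewrite /sqnorm.
by under eq_integral do rewrite expr0n/=; rewrite integral0.
Qed.

Lemma sqint_sum I (l : seq I) (f : I -> T -> R) :
  (forall i, sqint (f i)) -> sqint (fun x => \sum_(i <- l) f i x).
Proof.
move=> sf; elim: l => [|i l ih].
  by under [X in sqint X]funext do rewrite big_nil; exact: sqint0.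
rewrite (_ : (fun x => _) = fun x => f i x + \sum_(j <- l) f j x).
  exact: sqintD.
by apply/funext => x; rewrite big_cons.
Qed.

Lemma sqnorm_Rintegral f : sqint f -> sqnorm f = (\int[m]_x (f x ^+ 2))%:E.
Proof.
by move=> /sqint_integrable2 i2; rewrite fineK//; exact: integrable_fin_num.
Qed.

Lemma Rintegral_sqrB f g : sqint f -> sqint g ->
  \int[m]_x ((f x - g x) ^+ 2) =
  \int[m]_x (f x ^+ 2) - 2 * \int[m]_x (f x * g x) + \int[m]_x (g x ^+ 2).
Proof.
move=> sf sg; have i1 := sqint_integrable2 sf; have i2 := sqintM sf sg.
have i3 := sqint_integrable2 sg; have i4 := integrableZ_EFin (-2) i2.
rewrite (_ : (fun x => _) = fun x => f x ^+ 2 + ((-2) * (f x * g x) + g x ^+ 2)).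
  rewrite (RintegralD measurableT i1 (integrableD_EFin i4 i3)).
  by rewrite (RintegralD measurableT i4 i3) RintegralZl//; ring.
by apply/funext => x; ring.
Qed.

Lemma sqint_bndM f g (M : R) : measurable_fun setT f ->
  (forall x, `|f x| <= M) -> sqint g -> sqint (fun x => f x * g x).
Proof.
move=> mf fM sg; split; first by apply: measurable_funM => //; case: sg.
have [mg g2] := sqintZ M sg; apply: le_lt_trans g2.
apply: ge0_le_integral => //.
- by move=> x _; rewrite lee_fin sqr_ge0.
- by apply/measurable_EFinP; apply: measurable_funX; apply: measurable_funM => //; case: sg.
- exact: measurable_EFin_sqr.
- move=> x _; rewrite lee_fin !exprMn ler_wpM2r ?sqr_ge0//.
  rewrite -(real_normK (num_real (f x))) lerXn2r ?nnegrE//.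
  exact: le_trans (normr_ge0 _) (fM x).
Qed.

Lemma sqnorm0_ae f : measurable_fun setT f -> sqnorm f = 0%E ->
  {ae m, forall x, f x = 0}.
Proof.
move=> mf f20.
have mf2 : measurable_fun setT (fun x => (f x ^+ 2)%:E).
  by apply/measurable_EFinP; exact: measurable_funX.
have : (\int[m]_x `|(f x ^+ 2)%:E| = 0)%E.
  by rewrite -f20; apply: eq_integral => x _ /=; rewrite ger0_norm ?sqr_ge0.
move=> /(ae_eq_integral_abs m measurableT mf2).
apply: filterS => x /(_ I)/= [] /eqP.
by rewrite sqrf_eq0 => /eqP.
Qed.

Lemma ae_eq_sqnorm f g : measurable_fun setT f -> measurable_fun setT g ->
  {ae m, forall x, f x = g x} -> sqnorm f = sqnorm g.
Proof.
move=> mf mg fg; apply: ae_eq_integral => //.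
- by apply/measurable_EFinP; exact: measurable_funX.
- by apply/measurable_EFinP; exact: measurable_funX.
- by apply: filterS fg => x /= ->.
Qed.

Lemma sqnorm_le0_ae f g : measurable_fun setT f -> measurable_fun setT g ->
  (forall e : R, 0 < e -> (sqnorm (fun x => (f x - g x)%R) <= e%:E)%E) ->
  {ae m, forall x, f x = g x}.
Proof.
move=> mf mg fge.
have : {ae m, forall x, f x - g x = 0}.
  apply: sqnorm0_ae; first exact: measurable_funB.
  apply/eqP; rewrite eq_le sqnorm_ge0 andbT.
  by apply/lee_addgt0Pr => e e0; rewrite add0e fge.
by apply: filterS => x /eqP; rewrite subr_eq0 => /eqP.
Qed.

End square_norm.

Section square_norm_probability.
Context {d : measure_display} {T : measurableType d} {R : realType}.
Variable P : probability T R.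
Implicit Types f g h : T -> R.

Lemma Rintegral_probability_cst (c : R) : \int[P]_x c = c.
Proof.
have -> : \int[P]_x c = c * fine (P setT) by rewrite -Rintegral_cst.
by rewrite probability_setT mulr1.
Qed.

Lemma sqint_bounded f (M : R) : measurable_fun setT f ->
  (forall x, `|f x| <= M) -> sqint P f.
Proof.
move=> mf fM; split => //.
apply: (@le_lt_trans _ _ (\int[P]_x (M ^+ 2)%:E)%E).
  apply: ge0_le_integral => //.
  - by move=> x _; rewrite lee_fin sqr_ge0.
  - exact: measurable_EFin_sqr.
  - move=> x _; rewrite lee_fin -(real_normK (num_real (f x))) lerXn2r ?nnegrE//.
    exact: le_trans (normr_ge0 _) (fM x).
have -> : (\int[P]_x (M ^+ 2)%:E = (M ^+ 2)%:E * P setT)%E by rewrite -integral_cst.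
by rewrite probability_setT mule1 ltry.
Qed.

Lemma sqint_cst (c : R) : sqint P (fun=> c).
Proof. by apply: (@sqint_bounded _ `|c|). Qed.

Lemma sqint_integrable f : sqint P f -> P.-integrable setT (EFin \o f).
Proof.
move=> sf; have := sqintM sf (sqint_cst 1).
by under [X in EFin \o X]funext do rewrite mulr1.
Qed.

Lemma Rintegral_sqr_shift f (c : R) : sqint P f ->
  \int[P]_x ((f x - c) ^+ 2) = \int[P]_x (f x ^+ 2) - 2 * (\int[P]_x f x * c) + c ^+ 2.
Proof.
move=> sf; rewrite (Rintegral_sqrB sf (sqint_cst c)) RintegralZr//.
  by rewrite Rintegral_probability_cst.
exact: sqint_integrable.
Qed.

(** The variance is nonnegative. *)
Lemma sqr_Rintegral_le f : sqint P f ->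
  (((\int[P]_x f x) ^+ 2)%:E <= sqnorm P f)%E.
Proof.
move=> sf; rewrite sqnorm_Rintegral// lee_fin.
have : 0 <= \int[P]_x (f x - \int[P]_x f x) ^+ 2.
  by apply: Rintegral_ge0 => x _; exact: sqr_ge0.
by rewrite Rintegral_sqr_shift//; nra.
Qed.

End square_norm_probability.

(** * Completeness of [L^2] over a sub-sigma-field *)

Section completeness.
Context {d : measure_display} {T : measurableType d} {R : realType}.
Variable m : {measure set T -> \bar R}.

Lemma geometric_half_le2 n : \sum_(0 <= k < n) (2^-1 : R) ^+ k <= 2.
Proof.
have := @geometric_le_lim R n 1 2^-1; rewrite /series/=.
under eq_bigr do rewrite mul1r.
rewrite (_ : 1 - 2^-1 = 2^-1 :> R) ?mul1r ?invrK; last by lra.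
by apply => //; rewrite ger0_norm//; lra.
Qed.

(** An increment [t] satisfies [|t| <= 2^k t^2 + 2^-k], because [s <= s^2 + 1] for [s = 2^k |t|]; so
    the increments are absolutely summable. *)
Lemma weighted_square_cvg (u : nat -> R) :
  (\sum_(k <oo) (2 ^+ k * (u k.+1 - u k) ^+ 2)%:E < +oo)%E -> cvgn u.
Proof.
move=> D.
pose dd k := u k.+1 - u k.
have cd : cvgn (series dd).
  apply: normed_cvg.
  pose S : R := fine (\sum_(k <oo) (2 ^+ k * (u k.+1 - u k) ^+ 2)%:E)%E.
  have Spart n : \sum_(0 <= k < n) (2 ^+ k * dd k ^+ 2) <= S.
    rewrite -lee_fin /S fineK; last first.
      rewrite ge0_fin_numE//; apply: nneseries_ge0 => k _ _.
      by rewrite lee_fin mulr_ge0 ?sqr_ge0 ?exprn_ge0.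
    rewrite -sumEFin; apply: (@nneseries_lim_ge _ (fun k => (2 ^+ k * dd k ^+ 2)%:E) xpredT 0).
    by move=> k _ _; rewrite lee_fin mulr_ge0 ?sqr_ge0 ?exprn_ge0.
  apply: nondecreasing_is_cvgn.
    by apply/nondecreasing_series => k _ _; exact: normr_ge0.
  exists (S + 2) => _ [n _ <-].
  have H k : `|dd k| <= 2 ^+ k * dd k ^+ 2 + 2^-1 ^+ k.
    have k0 : 0 < (2 : R) ^+ k by rewrite exprn_gt0.
    rewrite -(ler_pM2l k0) mulrDr -exprMn mulfV// expr1n.
    rewrite -(real_normK (num_real (dd k))).
    have := sqr_ge0 (2 ^+ k * `|dd k| - 1); have := sqr_ge0 (2 ^+ k * `|dd k|).
    rewrite !expr2 => ? ?; nra.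
  rewrite /series/=; apply: le_trans (ler_sum _ (fun k _ => H k)) _.
  rewrite big_split/= lerD//.
  exact: geometric_half_le2.
have -> : u = (fun n => u 0%N + series dd n).
  by apply/funext => n; rewrite /series/= telescope_sumr//; lra.
by apply: is_cvgD => //; exact: is_cvg_cst.
Qed.

(** Riesz-Fischer, with a limit that is [G]-measurable as a function and not merely almost
    everywhere equal to one that is. *)
Lemma sqnorm_complete (G : set (set T)) (f : nat -> T -> R) :
  sigma_algebra setT G -> G `<=` measurable ->
  (forall n, measurable_wrt setT G (f n)) ->
  (forall e : R, 0 < e -> exists N, forall i j, (N <= i)%N -> (N <= j)%N ->
     (sqnorm m (fun x => (f i x - f j x)%R) <= e%:E)%E) ->
  exists2 g : T -> R, measurable_wrt setT G g &
    forall e : R, 0 < e -> exists N, forall n, (N <= n)%N ->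
      (sqnorm m (fun x => (f n x - g x)%R) <= e%:E)%E.
Proof.
move=> sG Gm Gf cauchy.
have mG (h : T -> R) : measurable_wrt setT G h -> measurable_fun setT h.
  by move=> Gh _ Y mY; apply/Gm/Gh; exists Y.
have mf n : measurable_fun setT (f n) by exact: mG.
have /choice[N HN] : forall k, exists N, forall i j, (N <= i)%N -> (N <= j)%N ->
    (sqnorm m (fun x => (f i x - f j x)%R) <= (4^-1 ^+ k)%:E)%E.
  by move=> k; apply: cauchy; rewrite exprn_gt0// invr_gt0.
(* Both [n k] and [n (k+1)] lie beyond [N k], so consecutive terms have squared distance at most
   [4^-k]; the weight [2^k] then leaves the summable [2^-k]. *)
pose n k := (k + \sum_(i < k.+1) N i)%N.
have nN k : (N k <= n k)%N by rewrite /n big_ord_recr/= addnA leq_addl.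
have nNS k : (N k <= n k.+1)%N.
  rewrite /n !big_ord_recr/=.
  by rewrite addnA (leq_trans _ (leq_addr _ _))// addnA leq_addl.
have nk k : (k <= n k)%N by rewrite /n leq_addr.
pose dd k x := f (n k.+1) x - f (n k) x.
pose D x := (\sum_(k <oo) (2 ^+ k * (dd k x) ^+ 2)%:E)%E.
have mdd k : measurable_fun setT (fun x => (2 ^+ k * (dd k x) ^+ 2)%:E).
  apply/measurable_EFinP; apply: measurable_funM => //.
  by apply: measurable_funX; exact: measurable_funB.
have dd0 k x : (0 <= (2 ^+ k * (dd k x) ^+ 2)%:E)%E.
  by rewrite lee_fin mulr_ge0 ?sqr_ge0 ?exprn_ge0.
have mD : measurable_fun setT D by apply: ge0_emeasurable_sum => //.
have D0 x : (0 <= D x)%E by apply: nneseries_ge0 => k _ _; exact: dd0.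
have iD : (\int[m]_x D x < +oo)%E.
  rewrite integral_nneseries//.
  apply: (@le_lt_trans _ _ (\sum_(k <oo) (2^-1 ^+ k)%:E)%E).
    apply: lee_nneseries => [k _ _|k _]; first exact: integral_ge0.
    under eq_integral do rewrite EFinM.
    rewrite ge0_integralZl_EFin ?exprn_ge0//; last 2 first.
    - by move=> x _; rewrite lee_fin sqr_ge0.
    - by apply: measurable_EFin_sqr; exact: measurable_funB.
    apply: le_trans (lee_wpmul2l _ (HN k _ _ (nNS k) (nN k))) _.
      by rewrite lee_fin exprn_ge0.
    by rewrite -EFinM lee_fin -exprMn (_ : 2 * 4^-1 = 2^-1 :> R)//; lra.
  rewrite (@le_lt_trans _ _ 2%:E) ?ltry//; apply: lime_le.
    by apply: is_cvg_nneseries => k _ _; rewrite lee_fin exprn_ge0.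
  near=> k; rewrite sumEFin lee_fin.
  exact: geometric_half_le2.
have iD' : m.-integrable setT D.
  apply/integrableP; split => //; apply: le_lt_trans iD.
  by rewrite le_eqVlt; apply/orP; left; apply/eqP/eq_integral => x _; rewrite gee0_abs.
(* The upper limit exists at every point and is therefore [G]-measurable; [fine] gives the value 0
   where it is infinite. *)
pose g x := fine (limn_esup (fun k => (f (n k) x)%:E)).
have fg : {ae m, forall x, f (n k) x @[k --> \oo] --> g x}.
  have := integrable_ae measurableT iD'; apply: filterS => x /(_ I).
  rewrite ge0_fin_numE// => /weighted_square_cvg cv.
  have : (f (n k) x)%:E @[k --> \oo] --> (limn (fun k => f (n k) x))%:E.
    by apply: cvg_EFin; [exact: nearW|exact: cv].
  by rewrite /g => /cvg_limn_einf_sup[_ ->].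
have Gg : measurable_wrt setT G g.
  apply/measurable_wrtP => //.
  apply: measurableT_comp; first exact: fine_measurable.
  apply: measurable_fun_limn_esup => k; apply/measurable_EFinP.
  by apply/measurable_wrtP.
exists g => //.
move=> e e0; have [N0 HN0] := cauchy e e0.
exists N0 => j N0j.
have mjk k : measurable_fun setT (fun x => ((f j x - f (n k) x) ^+ 2)%:E).
  by apply: measurable_EFin_sqr; exact: measurable_funB.
have mjg : measurable_fun setT (fun x => ((f j x - g x) ^+ 2)%:E).
  by apply: measurable_EFin_sqr; apply: measurable_funB => //; exact: mG.
have sqr0 k x : (0 <= ((f j x - f (n k) x) ^+ 2)%:E)%E by rewrite lee_fin sqr_ge0.
rewrite /sqnorm.
(* Fatou along the subsequence, with [j] fixed, bounds the distance to [g] for the whole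
   sequence. *)
have -> : (\int[m]_x ((f j x - g x) ^+ 2)%:E =
    \int[m]_x limn_einf (fun k => ((f j x - f (n k) x) ^+ 2)%:E))%E.
  apply: ae_eq_integral => //; first last.
    apply: filterS fg => x fgx _.
    have : ((f j x - f (n k) x) ^+ 2)%:E @[k --> \oo] --> ((f j x - g x) ^+ 2)%:E.
      apply: cvg_EFin; first exact: nearW.
      rewrite /comp/=; under eq_cvg do rewrite expr2.
      by rewrite expr2; apply: cvgM; apply: cvgB => //; exact: cvg_cst.
    by move=> /cvg_limn_einf_sup[->].
  apply: measurableT_comp => //; apply: measurable_fun_limn_esup => k.
  exact: measurableT_comp.
apply: le_trans (fatou _ _ _ _) _ => //.
rewrite limn_einf_lim; apply: lime_le; first exact: is_cvg_einfs.
near=> k; apply: (@le_trans _ _ (sqnorm m (fun x => (f j x - f (n k) x)%R))%E).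
  by apply: ereal_inf_lbound; exists k => /=.
apply: HN0 => //; apply: (leq_trans _ (nk k)); near: k; exact: nbhs_infty_ge.
Unshelve. all: by end_near. Qed.
End completeness.

(** * Moments of Poisson counts *)

Section exponential_series.
Context {R : realType}.
Implicit Types x : R.

Lemma eseries_exp x : 0 <= x ->
  (\sum_(k <oo) (x ^+ k / k`!%:R)%:E = (expR x)%:E)%E.
Proof.
move=> x0; rewrite expRE -EFin_lim; last first.
  rewrite /pseries/=; under eq_fun do rewrite mulrC.
  exact: is_cvg_series_exp_coeff.
apply/congr_lim/funext => n/=; rewrite /pseries/= /series/= -sumEFin//.
by under eq_bigr do rewrite mulrC.
Qed.

(** For [k >= j] the falling factorial cancels into [1 / (k - j)!]; the terms with [k < j] vanish,
    and a shifted exponential series remains. *)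
Lemma eseries_exp_ffact x (j : nat) : 0 <= x ->
  (\sum_(k <oo) ((k ^_ j)%:R * (x ^+ k / k`!%:R))%:E = (x ^+ j * expR x)%:E)%E.
Proof.
move=> x0.
have t0 k : (0 <= ((k ^_ j)%:R * (x ^+ k / k`!%:R))%:E)%E.
  by rewrite lee_fin mulr_ge0// divr_ge0// exprn_ge0.
rewrite (@nneseries_split _ _ 0 j)//= add0n big1_seq ?add0e; last first.
  by move=> k; rewrite mem_index_iota => /andP[_ /andP[_ kj]]; rewrite ffact_small// mul0r.
rewrite -nneseries_addn// EFinM -eseries_exp// -nneseriesZl; last first.
  by move=> k _; rewrite lee_fin divr_ge0// exprn_ge0.
apply: eq_eseriesr => k _; rewrite -EFinM; congr EFin.
have <- : ((k + j) ^_ j)%:R / (k + j)`!%:R = k`!%:R^-1 :> R.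
  have -> : ((k + j)`! = (k + j) ^_ j * k`!)%N.
    by rewrite -(ffact_fact (leq_addl k j)) addnK.
  rewrite natrM invfM mulrA mulfV ?mul1r// pnatr_eq0 -lt0n ffact_gt0.
  exact: leq_addl.
by rewrite exprD; ring.
Qed.

End exponential_series.

Section poisson.
Context {dO dE : measure_display} {Omega : measurableType dO}.
Context {E : measurableType dE} {R : realType}.
Variables (P : probability Omega R) (mu : set E -> \bar R).
Variable N : Omega -> {measure set E -> \bar R}.
Hypothesis N_poisson : poisson_random_measure P mu N.
Implicit Types A B : set E.

Lemma measurable_count A : measurable A ->
  measurable_fun setT (fun w => N w A : \bar R).
Proof. by have [mN _ _ _] := N_poisson; exact: mN. Qed.

Section law.
Variable A : set E.
Hypotheses (mA : measurable A) (mu0 : (0 <= mu A)%E) (muA : (mu A < +oo)%E).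
Let lambda := fine (mu A).

Let lambda0 : 0 <= lambda. Proof. exact: fine_ge0. Qed.

Let p k : R := lambda ^+ k / k`!%:R * expR (- lambda).

Lemma poisson_law k : P [set w | N w A = k%:R%:E] = (p k)%:E.
Proof.
have [_ lawN _ _] := N_poisson; rewrite lawN// /poisson_prob -/lambda.
case: ifPn => l0.
  by rewrite esum_set1 /p /poisson_pmf ?l0// lee_fin !mulr_ge0// ?exprn_ge0// ?expR_ge0.
(* For rate 0, [poisson_prob] is the Dirac mass at 0. *)
have {l0}l0 : lambda = 0 by apply/eqP; rewrite eq_le lambda0 leNgt l0.
rewrite diracE /p l0 oppr0 expR0 mulr1 expr0n; case: k => [|k].
  by rewrite mem_set//= fact0 divr1.
by rewrite memNset//= mul0r.
Qed.

Let F k := [set w | N w A = k%:R%:E].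

Let mF k : measurable (F k).
Proof.
have := measurable_count mA measurableT (emeasurable_set1 (k%:R : R)%:E).
by rewrite setTI.
Qed.

Let tF : trivIset setT F.
Proof.
move=> i j _ _ [w [Fi Fj]].
have : (i%:R : R)%:E = (j%:R : R)%:E by rewrite -Fi -Fj.
by move=> [/eqP]; rewrite eqr_nat => /eqP.
Qed.

(** The Poisson masses sum to 1, so the count is almost surely a natural number. *)
Lemma poisson_count_ae : P (~` \bigcup_k F k) = 0%E.
Proof.
rewrite probability_setC; last exact: bigcupT_measurable.
rewrite (_ : P (\bigcup_k F k) = 1%E) ?subee//.
rewrite measure_bigcup//=; under eq_eseriesl do rewrite in_setT.
transitivity (\sum_(k <oo) ((expR (- lambda))%:E * (lambda ^+ k / k`!%:R)%:E))%E.
  by apply: eq_eseriesr => k _; rewrite poisson_law -EFinM mulrC.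
rewrite nneseriesZl; last by move=> k _; rewrite lee_fin divr_ge0// exprn_ge0.
by rewrite eseries_exp// -EFinM -expRD addNr expR0.
Qed.

Lemma poisson_integral (phi : \bar R -> R) : measurable_fun setT phi ->
  (forall x, 0 <= phi x) ->
  (\int[P]_w (phi (N w A))%:E = \sum_(k <oo) (phi k%:R%:E * p k)%:E)%E.
Proof.
move=> mphi phi0.
have mf : measurable_fun setT (fun w => (phi (N w A))%:E).
  by apply/measurable_EFinP; apply: measurableT_comp => //; exact: measurable_count.
have mU : measurable (\bigcup_k F k) by exact: bigcupT_measurable.
rewrite (@ge0_negligible_integral _ _ _ P setT (~` \bigcup_k F k))//; last 3 first.
- exact: measurableC.
- by move=> w _; rewrite lee_fin.
- exact: poisson_count_ae.
rewrite setTD setCK ge0_integral_bigcup//; last 2 first.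
- exact: measurable_funTS.
- by move=> w _; rewrite lee_fin.
apply: eq_eseriesr => k _.
rewrite (eq_integral (cst (phi k%:R%:E)%:E)); last first.
  by move=> w; rewrite inE => /= ->.
by rewrite integral_cst//= poisson_law EFinM.
Qed.

Definition rcount w : R := fine (N w A).

Lemma measurable_rcount : measurable_fun setT rcount.
Proof.
apply: (measurableT_comp (f := fine)); first exact: fine_measurable.
exact: measurable_count.
Qed.

Lemma poisson_fin_ae : {ae P, forall w, N w A \is a fin_num}.
Proof.
exists (~` \bigcup_k F k); split.
- by apply: measurableC; exact: bigcupT_measurable.
- exact: poisson_count_ae.
- by move=> w /= nfin [k _ Fk]; apply: nfin; rewrite Fk.
Qed.

(** The factor [e^(-c k)] only replaces the rate by [x = lambda e^-c]. One formula covers the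
    Laplace transform ([j = 0]), minus its derivative ([j = 1]) and, for [c = 0], the factorial
    moments. *)
Let moment_series (c : R) (j : nat) : 0 <= c ->
  (\sum_(k <oo) ((k ^_ j)%:R * expR (- (c * k%:R)) * p k)%:E =
    ((lambda * expR (- c)) ^+ j * expR (- (lambda * (1 - expR (- c)))))%:E)%E.
Proof.
move=> c0; pose x := lambda * expR (- c).
have x0 : 0 <= x by rewrite mulr_ge0// expR_ge0.
transitivity ((expR (- lambda))%:E *
    \sum_(k <oo) ((k ^_ j)%:R * (x ^+ k / k`!%:R))%:E)%E.
  rewrite -nneseriesZl; last first.
    by move=> k _; rewrite lee_fin mulr_ge0// divr_ge0// exprn_ge0.
  apply: eq_eseriesr => k _; rewrite -EFinM; congr EFin.
  rewrite /p /x exprMn -expRM_natr mulNr; ring.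
rewrite eseries_exp_ffact// -EFinM; congr EFin.
rewrite mulrCA -expRD -/x; congr (_ * expR _).
by rewrite /x; ring.
Qed.

Let moment (c : R) (j : nat) (phi : R -> R) : 0 <= c ->
  measurable_fun setT phi -> (forall x, 0 <= phi x) ->
  (forall k, phi k%:R = (k ^_ j)%:R * expR (- (c * k%:R))) ->
  (\int[P]_w (phi (rcount w))%:E =
    ((lambda * expR (- c)) ^+ j * expR (- (lambda * (1 - expR (- c)))))%:E)%E.
Proof.
move=> c0 mphi phi0 phiE.
rewrite (@poisson_integral (phi \o fine))//; last 2 first.
- by apply: measurableT_comp => //; exact: fine_measurable.
- by move=> x; exact: phi0.
by rewrite -moment_series//; apply: eq_eseriesr => k _; rewrite /= phiE.
Qed.

Lemma poisson_laplace (c : R) : 0 <= c ->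
  \int[P]_w expR (- (c * rcount w)) = expR (- (lambda * (1 - expR (- c)))).
Proof.
move=> c0; rewrite /Rintegral (moment (c := c) (j := 0%N) (phi := fun x => expR (- (c * x))))//.
- by rewrite expr0 mul1r.
- by apply: measurableT_comp => //; apply: measurableT_comp => //; exact: measurable_funM.
- by move=> k; rewrite ffactn0 mul1r.
Qed.

Let mfexp c : measurable_fun setT (fun x : R => expR (- (c * x))).
Proof. by apply: measurableT_comp => //; apply: measurableT_comp => //; exact: measurable_funM. Qed.

Lemma poisson_laplace1 (c : R) : 0 <= c ->
  \int[P]_w (rcount w * expR (- (c * rcount w))) =
    lambda * expR (- c) * expR (- (lambda * (1 - expR (- c)))).
Proof.
move=> c0; rewrite -[in RHS](expr1 (lambda * _)) /Rintegral.
transitivity (fine ((lambda * expR (- c)) ^+ 1 *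
  expR (- (lambda * (1 - expR (- c)))))%:E) => //.
(* [Num.max 0 x] agrees with [x] on counts and keeps the integrand nonnegative on the whole line. *)
rewrite -(moment (c := c) (j := 1%N) (phi := fun x => Num.max 0 x * expR (- (c * x)))).
- congr fine; apply: eq_integral => w _; congr (_ * _)%:E.
  by apply/esym/max_idPr; exact: fine_ge0.
- by [].
- by apply: measurable_funM => //; exact: measurable_maxr.
- by move=> x; rewrite mulr_ge0 ?expR_ge0// le_max lexx.
- by move=> k; rewrite ffactn1; congr (_ * _); apply/max_idPr.
Qed.

Let second_moment : sqnorm P rcount = (lambda ^+ 2 + lambda)%:E.
Proof.
rewrite /sqnorm (@poisson_integral (fun x => fine x ^+ 2))//; last 2 first.
- by apply: measurable_funX; exact: fine_measurable.
- by move=> x; exact: sqr_ge0.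
(* [k^2 = k (k - 1) + k], a sum of falling factorials. *)
transitivity (\sum_(k <oo) ((k ^_ 2)%:R * expR (- (0 * k%:R)) * p k)%:E +
  \sum_(k <oo) ((k ^_ 1)%:R * expR (- (0 * k%:R)) * p k)%:E)%E; last first.
  rewrite !moment_series// oppr0 expR0 subrr mulr0 oppr0 expR0 !mulr1 expr1.
  by rewrite EFinD.
have p0 k : 0 <= p k by rewrite mulr_ge0 ?expR_ge0// divr_ge0// exprn_ge0.
rewrite -nneseriesD; last 2 first.
- by move=> k _ _; rewrite lee_fin mulr_ge0// mulr_ge0// expR_ge0.
- by move=> k _ _; rewrite lee_fin mulr_ge0// mulr_ge0// expR_ge0.
apply: eq_eseriesr => k _; rewrite -EFinD -mulrDl -mulrDl; congr (_ * _)%:E.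
rewrite mul0r oppr0 expR0 mulr1 /=; case: k => [|k].
  by rewrite ffact0n ffactn1 addr0 expr0n.
rewrite ffactSS !ffactn1 natrM -natr1; ring.
Qed.

Lemma poisson_sqint : sqint P rcount.
Proof. by split; [exact: measurable_rcount|rewrite second_moment ltry]. Qed.

Lemma poisson_mean : \int[P]_w rcount w = lambda.
Proof.
have := poisson_laplace1 (lexx 0).
rewrite oppr0 expR0 subrr !mulr0 oppr0 expR0 !mulr1 => <-.
by apply: eq_Rintegral => w _; rewrite mul0r oppr0 expR0 mulr1.
Qed.

Lemma poisson_var : \int[P]_w ((rcount w - lambda) ^+ 2) = lambda.
Proof.
rewrite (Rintegral_sqr_shift _ poisson_sqint) poisson_mean.
by have := second_moment; rewrite (sqnorm_Rintegral poisson_sqint) => -[->]; ring.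
Qed.

End law.
End poisson.

(** * Independence over disjoint regions *)

Section generated_independence.
Context {d : measure_display} {T : measurableType d} {R : realType}.
Variable P : probability T R.

(** As functions of [A], both sides of the product formula are finite measures; they agree on a
    pi-system, hence on the sigma-field it generates. *)
Lemma independent_events_sigma (C : set (set T)) (K : set T) :
  setI_closed C -> C setT -> C `<=` measurable -> measurable K ->
  (forall A, C A -> independent_events P A K) ->
  forall A, <<s C >> A -> independent_events P A K.
Proof.
move=> IC CT Cm mK CK A sA.
have PK0 : 0 <= fine (P K) by exact: fine_ge0.
have PK : P K = (fine (P K))%:E by rewrite fineK// fin_num_measure.
suff : mrestr P mK A = mscale (NngNum PK0) P A.
  by rewrite /independent_events /mrestr /mscale/= -PK muleC.
apply: (g_sigma_algebra_measure_unique C Cm (fun=> setT)) => //.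
- by rewrite bigcup_const.
- by move=> B CB; rewrite /= /mrestr /mscale/= CK// PK muleC.
- move=> _; rewrite /= /mrestr; apply: le_lt_trans (probability_le1 _ _) _.
    exact: measurableI.
  exact: ltry.
Qed.

Lemma independent_eventsC (A B : set T) : measurable A -> measurable B ->
  independent_events P A B -> independent_events P A (~` B).
Proof.
rewrite /independent_events => mA mB AB.
rewrite probability_setC// -setDE measureD//; last first.
  by rewrite (le_lt_trans (probability_le1 _ _)) ?ltry.
transitivity (P A - P A * P B)%E; first by rewrite -AB.
by rewrite muleBr ?mule1// ?fin_num_measure// fin_num_adde_defr// fin_num_measure.
Qed.

Lemma independent_indic (f : T -> R) (K : set T) : measurable K ->
  measurable_fun setT f ->
  (forall A, measurable A -> independent_events P (f @^-1` A) K) ->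
  independent_RV P f (\1_K : T -> R).
Proof.
move=> mK mf fK A B mA mB; rewrite preimage_indic.
have mfA : measurable (f @^-1` A) by rewrite -[X in measurable X]setTI; exact: mf.
case: ifPn => _; case: ifPn => _.
- by rewrite /independent_events setIT probability_setT mule1.
- exact: fK.
- by apply: independent_eventsC => //; exact: fK.
- by rewrite /independent_events setI0 measure0 mule0.
Qed.

Lemma bounded_Rintegral_cvg (f : nat -> T -> R) (M : R) (g : T -> R) :
  (forall n, measurable_fun setT (f n)) -> (forall n x, `|f n x| <= M) ->
  (forall x, f n x @[n --> \oo] --> g x) ->
  measurable_fun setT g /\
  \int[P]_x f n x @[n --> \oo] --> \int[P]_x g x.
Proof.
move=> mf fM fg.
have mg : measurable_fun setT g.
  by apply: (measurable_fun_cvg (h := f)) => // x _; exact: fg.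
split => //.
have [ig _ cv] : [/\ P.-integrable setT (EFin \o g),
    [sequence \int[P]_x (`|(f n x)%:E - (g x)%:E|)]_n @ \oo --> 0 &
    [sequence \int[P]_x (f n x)%:E]_n @ \oo --> \int[P]_x (g x)%:E]%E.
  apply: (@dominated_convergence _ _ _ P setT measurableT
    (fun n x => (f n x)%:E) (EFin \o g) (cst M%:E)).
  - by move=> n; apply/measurable_EFinP.
  - by apply/measurable_EFinP.
  - by apply: aeW => x _; apply: cvg_EFin; [exact: nearW|exact: fg].
  - exact: sqint_integrable (sqint_cst P M).
  - by apply: aeW => x n _ /=; rewrite lee_fin.
by apply: fine_cvg; rewrite fineK//; exact: integrable_fin_num.
Qed.

End generated_independence.

Section poisson_independence.
Context {dO dE : measure_display} {Omega : measurableType dO}.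
Context {E : measurableType dE} {R : realType}.
Variables (P : probability Omega R) (mu : {measure set E -> \bar R}).
Variable N : Omega -> {measure set E -> \bar R}.
Hypothesis N_poisson : poisson_random_measure P mu N.

Let mN A : measurable A -> measurable_fun setT (fun w => N w A : \bar R).
Proof. exact: measurable_count N_poisson A. Qed.

Let mNY A Y : measurable A -> measurable Y -> measurable [set w | Y (N w A)].
Proof. by move=> mA mY; have := mN mA measurableT mY; rewrite setTI. Qed.

Definition rectangle n (D : 'I_n -> set E) (Y : 'I_n -> set (\bar R)) : set Omega :=
  \bigcap_(i in setT) [set w | Y i (N w (D i))].

(** The rectangles form a pi-system; the constraint [setT] on the other coordinates puts every event
    about a single count among them. *)
Lemma independent_finite (n : nat) (D : 'I_n -> set E) (K : set Omega) :
  (forall i, measurable (D i)) -> measurable K ->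
  (forall Y, (forall i, measurable (Y i)) -> independent_events P (rectangle D Y) K) ->
  forall A, sigma_family setT setT (fun i w => N w (D i) : \bar R) A ->
    independent_events P A K.
Proof.
move=> mD mK DK A sA.
pose C : set (set Omega) := [set A | exists2 Y : 'I_n -> set (\bar R),
  forall i, measurable (Y i) & A = rectangle D Y].
have CT : C setT.
  exists (fun=> setT) => //; rewrite /rectangle (_ : \bigcap_(i in _) _ = setT)//.
  by apply/seteqP; split.
apply: (@independent_events_sigma _ _ _ P C) => //.
- move=> _ _ [Y1 mY1 ->] [Y2 mY2 ->]; exists (fun i => Y1 i `&` Y2 i).
    by move=> i; exact: measurableI.
  by rewrite /rectangle -bigcapI.
- move=> _ [Y1 mY1 ->]; apply: fin_bigcap_measurable => //.
  by move=> i _; exact: mNY.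
- by move=> _ [Y1 mY1 ->]; exact: DK.
- suff : sigma_family setT setT (fun i w => N w (D i) : \bar R) `<=` <<s C >> by exact.
  apply: smallest_sub; first exact: smallest_sigma_algebra.
  move=> _ [i _ [Z mZ <-]]; apply: sub_sigma_algebra.
  exists (fun j => if j == i then Z else setT) => [j|]; first by case: ifP.
  apply/seteqP; split => [w [_ Zw] j _ /=|w /(_ i I)/=]; last by rewrite eqxx.
  by case: ifPn => // /eqP ->.
Qed.

(** The points covered exactly [k] times, with multiplicity in the list. Levels are disjoint
    whatever the overlaps of the sets, which is what the independence of counts asks for. *)
Definition level (l : seq (set E)) (k : nat) : set E :=
  [set x | (\sum_(A <- l) (x \in A))%N = k].

Lemma measurable_level l k : all (fun A => `[< measurable A >]) l ->
  measurable (level l k).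
Proof.
rewrite /level; elim: l k => [|A l ih] k /=.
  move=> _; under eq_set do rewrite big_nil.
  by have [->|/eqP k0] := eqVneq k 0%N; [rewrite (_ : mkset _ = setT)//; apply/seteqP; split
   |rewrite (_ : mkset _ = set0)//; apply/seteqP; split => // x /= k0'; rewrite -k0' in k0].
move=> /andP[/asboolP mA ml].
rewrite (_ : mkset _ = (A `&` (if k is k'.+1 then level l k' else set0)) `|`
   (~` A `&` level l k)).
  apply: measurableU; apply: measurableI => //; last 2 first.
  - exact: measurableC.
  - exact: ih.
  by case: k => //= k; exact: ih.
apply/seteqP; split => x /=; rewrite big_cons.
  have [xA|xA] := boolP (x \in A).
    by case: k => [|k]; rewrite add1n// => -[<-]; left; split; rewrite ?inE in xA *.
  by rewrite add0n => <-; right; split => //; rewrite notin_setE in xA.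
move=> [[Ax]|[nAx xl]]; last by rewrite memNset.
by case: k => //= k xl; rewrite mem_set// xl add1n.
Qed.

Lemma level_sum_le (l : seq (set E)) x : (\sum_(A <- l) (x \in A) <= size l)%N.
Proof.
elim: l => [|A l ih]; rewrite ?big_nil// big_cons /=.
by case: (x \in A); rewrite ?add1n ?add0n ?ltnS// (leq_trans ih).
Qed.

Lemma integral_sum_indic (m : {measure set E -> \bar R}) (l : seq (set E)) :
  all (fun A => `[< measurable A >]) l ->
  measurable_fun setT (fun x => (\sum_(A <- l) \1_A x : R)) /\
  (\int[m]_x (\sum_(A <- l) \1_A x)%:E = \sum_(A <- l) m A)%E.
Proof.
elim: l => [_|A l ih].
  rewrite big_nil; split; first by under eq_fun do rewrite big_nil; exact: measurable_cst.
  by under eq_integral do rewrite big_nil; rewrite integral0.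
move=> /= /andP[/asboolP mA /ih[ml il]].
split; first by under eq_fun do rewrite big_cons; exact: measurable_funD.
under eq_integral do rewrite big_cons.
rewrite big_cons -il -[in RHS](setIT A) -integral_indic// -ge0_integralD//.
- by apply/measurable_EFinP.
- by move=> x _; rewrite lee_fin sumr_ge0.
- exact/measurable_EFinP.
Qed.

(** The condition [phi 0 = 0] leaves out level 0, the complement of the union, whose measure may be
    infinite. *)
Lemma level_step_function (phi : nat -> R) l x : phi 0%N = 0 ->
  \sum_(k < size l) phi k.+1 * \1_(level l k.+1) x = phi (\sum_(A <- l) (x \in A))%N.
Proof.
move=> phi0.
have := level_sum_le l x; case E0 : (\sum_(A <- l) (x \in A))%N => [|j] jl.
  rewrite big1// => k _; rewrite indicE memNset ?mulr0//= /level/= => lk.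
  by rewrite lk in E0.
rewrite (bigD1 (Ordinal jl))//= indicE mem_set ?mulr1// big1 ?addr0// => k kj.
rewrite indicE memNset ?mulr0// /level/= E0 => -[jk].
by move/eqP: kj; apply; apply: val_inj.
Qed.

Lemma level_sub l (D : set E) k :
  all (fun A => `[< A `<=` D >]) l -> level l k.+1 `<=` D.
Proof.
move=> lD x; rewrite /level/= => xk.
elim: l lD k xk => [_ k|A l ih /= /andP[/asboolP AD /ih {}ih] k]; first by rewrite big_nil.
rewrite big_cons; have [/set_mem/AD//|_] := boolP (x \in A).
by rewrite add0n; exact: ih.
Qed.

(* Integrating the identity  sum_A 1_A = sum_k k 1_{level k}. *)
Lemma sum_measure_levels (m : {measure set E -> \bar R}) l :
  all (fun A => `[< measurable A >]) l ->
  (\sum_(A <- l) m A = \sum_(k < size l) k.+1%:R%:E * m (level l k.+1))%E.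
Proof.
move=> ml; have [_ <-] := integral_sum_indic m ml.
have mlev k : measurable (level l k) by exact: measurable_level.
transitivity (\int[m]_x \sum_(k < size l) (k.+1%:R%:E * (\1_(level l k.+1) x)%:E))%E.
  apply: eq_integral => x _; rewrite sumEFin.
  rewrite (level_step_function (phi := fun k => k%:R))// natr_sum.
  by congr EFin; apply: eq_bigr => A _; rewrite indicE.
rewrite ge0_integral_sum//.
- apply: eq_bigr => k _; rewrite ge0_integralZl//; last exact/measurable_EFinP.
  by rewrite integral_indic// setIT.
- by move=> k; apply: emeasurable_funM => //; exact/measurable_EFinP.
Qed.

(** Fields indexed by regions of [E] instead of times: past and future become disjoint regions, and
    independence is proved once for all of them. *)
Definition region_sigma (D : set E) : set (set Omega) :=
  sigma_family setT [set A | measurable A /\ A `<=` D]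
    (fun A w => N w A : \bar R).

Lemma sigma_family_sigma_algebra I (J : set I) (X : I -> Omega -> \bar R) :
  sigma_algebra setT (sigma_family setT J X).
Proof. exact: smallest_sigma_algebra. Qed.

Lemma region_sigma_algebra D : sigma_algebra setT (region_sigma D).
Proof. exact: sigma_family_sigma_algebra. Qed.

Lemma sub_sigma_family I (J : set I) (X : I -> Omega -> \bar R) i :
  J i -> measurable_wrt setT (sigma_family setT J X) (X i).
Proof. by move=> Ji A XA; apply: sub_sigma_algebra; exists i. Qed.

Lemma sigma_family_measurable I (J : set I) (X : I -> Omega -> \bar R) :
  (forall i, J i -> measurable_fun setT (X i)) ->
  sigma_family setT J X `<=` measurable.
Proof.
move=> mX; apply: smallest_sub; first exact: sigma_algebra_measurable.
by move=> _ [i Ji [Y mY <-]]; exact: mX.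
Qed.

Lemma region_sigma_measurable D : region_sigma D `<=` measurable.
Proof. by apply: sigma_family_measurable => A [mA _]; exact: mN. Qed.

Lemma measurable_wrt_fun (G : set (set Omega)) d' (V : measurableType d')
    (f : Omega -> V) :
  G `<=` measurable -> measurable_wrt setT G f -> measurable_fun setT f.
Proof. by move=> Gm Gf _ Y mY; apply/Gm/Gf; exists Y. Qed.

(** Disjoint subsets of [D] suffice for the test. The bounded [f] with [E (f 1_K) = E f * P K] form
    a bounded monotone class, so only Laplace functionals need checking, and these are functions of
    the counts of the levels. *)
Lemma independent_region_event (D : set E) (K : set Omega) : measurable K ->
  (forall n (D' : 'I_n -> set E) Y, (forall i, measurable (D' i)) ->
    (forall i, D' i `<=` D) -> trivIset setT D' -> (forall i, measurable (Y i)) ->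
    independent_events P (rectangle D' Y) K) ->
  forall A, region_sigma D A -> independent_events P A K.
Proof.
move=> mK DK A sA.
pose H : set (Omega -> R) := [set f : Omega -> R | [/\ measurable_fun setT f,
   exists M : R, forall w, `|f w| <= M &
   \int[P]_w (f w * \1_K w) = \int[P]_w f w * fine (P K)]].
have mIK : measurable_fun setT (\1_K : Omega -> R) by exact: measurable_indic.
have iK : P.-integrable setT (EFin \o (\1_K : Omega -> R)).
  by apply: sqint_integrable; apply: (@sqint_bounded _ _ _ _ _ 1) => // w;
   rewrite indicE; case: (_ \in _); rewrite ?normr1 ?normr0.
have EK : \int[P]_w (\1_K w : R) = fine (P K).
  by rewrite /Rintegral integral_indic// setIT.
have HH : bounded_monotone_class H.
  split.
  - split => //; first by exists 1 => w; rewrite normr1.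
    rewrite Rintegral_probability_cst mul1r -EK.
    by apply: eq_Rintegral => w _; rewrite mul1r.
  - move=> a f g [mf [M fM] fK] [mg [M' gM] gK]; split.
    + by apply: measurable_funD => //; exact: measurable_funM.
    + exists (`|a| * M + M') => w.
      by rewrite (le_trans (ler_normD _ _))// lerD// normrM ler_wpM2l.
    + have If := sqint_integrable (sqint_bounded P mf fM).
      have Ig := sqint_integrable (sqint_bounded P mg gM).
      have IfK (h : Omega -> R) (M0 : R) : measurable_fun setT h -> (forall w, `|h w| <= M0) ->
          P.-integrable setT (EFin \o (fun w => h w * (\1_K w : R))).
        move=> mh hM; apply: sqintM (sqint_bounded P mh hM) _.
        apply: (@sqint_bounded _ _ _ _ _ 1) => // w.
        by rewrite indicE; case: (_ \in _); rewrite ?normr1 ?normr0.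
      have -> : (fun w => (a * f w + g w) * \1_K w) =
          (fun w => a * (f w * \1_K w) + g w * \1_K w :> R).
        by apply/funext => w; ring.
      rewrite RintegralD//; [|exact: integrableZ_EFin (IfK _ _ mf fM)|exact: IfK mg gM].
      rewrite RintegralZl//; last exact: IfK mf fM.
      rewrite RintegralD//; last exact: integrableZ_EFin.
      by rewrite RintegralZl// fK gK; ring.
  - move=> f M g fH fM fg.
    have mf n : measurable_fun setT (f n) by have [] := fH n.
    have [mg cg] := bounded_Rintegral_cvg P mf fM fg.
    have mfK n : measurable_fun setT (fun w => f n w * \1_K w) by exact: measurable_funM.
    have fKM n w : `|f n w * \1_K w| <= M.
      apply: le_trans (fM n w); rewrite normrM ler_piMr// indicE.
      by case: (_ \in _); rewrite ?normr1 ?normr0.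
    have fgK w : f n w * \1_K w @[n --> \oo] --> g w * \1_K w.
      by apply: cvgMl; exact: fg.
    have [mgK cgK] := bounded_Rintegral_cvg P mfK fKM fgK.
    split => //.
    + by exists M => w; exact: (cvg_norm_le (fg w)).
    + have cgK' : \int[P]_w (f n w * \1_K w) @[n --> \oo] --> \int[P]_w g w * fine (P K).
        rewrite [X in X @ _ --> _](_ : _ = fun n => \int[P]_w f n w * fine (P K)).
          exact: cvgMl.
        by apply/funext => n; have [_ _ ->] := fH n.
      by rewrite -(cvg_lim _ cgK)// -(cvg_lim _ cgK').
suff HA : forall A, region_sigma D A -> H \1_A.
  have mA := region_sigma_measurable sA.
  have [_ _] := HA A sA.
  rewrite (_ : (fun w => \1_A w * \1_K w) = \1_(A `&` K)); last by rewrite indicI.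
  rewrite /Rintegral !integral_indic// ?setIT; last exact: measurableI.
  rewrite /independent_events -/K => ee; rewrite -(fineK (fin_num_measure P (A `&` K) _)).
    by rewrite ee EFinM !fineK// fin_num_measure.
  exact: measurableI.
apply: (sigma_family_laplace (X := fun A w => N w A : \bar R)) => //.
move=> l Jl.
have ml : all (fun A => `[< measurable A >]) l.
  by apply: sub_all Jl => C /asboolP[mC _]; exact/asboolP.
have lD k : level l k.+1 `<=` D.
  by apply: level_sub; apply: sub_all Jl => C /asboolP[_ CD]; exact/asboolP.
pose Lv (i : 'I_(size l)) := level l i.+1.
pose G := sigma_family setT setT (fun i w => N w (Lv i) : \bar R).
pose f w := expN (\sum_(A <- l) N w A)%E.
have mLv i : measurable (Lv i) by exact: measurable_level.
have sG : sigma_algebra setT G by exact: sigma_family_sigma_algebra.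
have Gf : measurable_wrt setT G f.
  apply/measurable_wrtP => //.
  apply: (measurableT_comp (f := expN)); first exact: measurable_fun_expN.
  rewrite (_ : (fun w => _) = fun w => (\sum_(k < size l) k.+1%:R%:E * N w (Lv k))%E).
    apply: emeasurable_sum => k; apply: emeasurable_funM => //.
    by apply/measurable_wrtP => //; exact: sub_sigma_family.
  by apply/funext => w; exact: sum_measure_levels.
have mf : measurable_fun setT f.
  apply: (measurable_wrt_fun _ Gf); apply: sigma_family_measurable => i _.
  exact: mN.
have f1 w : `|f w| <= 1.
  have /andP[? ?] : 0 <= f w <= 1 by apply: expN_ge0_le1; exact: sume_ge0.
  by rewrite ger0_norm.
have indf : independent_RV P f (\1_K : Omega -> R).
  apply: independent_indic => // A' mA'.
  apply: (independent_finite (D := Lv)) => //; last first.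
    have : G (setT `&` f @^-1` A') by apply: Gf; exists A'.
    by rewrite setTI.
  move=> Y mY; apply: DK => //.
  - by move=> i; exact: lD.
  - by move=> i j _ _ [x [/= xi xj]]; apply/val_inj/succn_inj; rewrite -xi -xj.
split => //; first by exists 1.
have := independent_integrable mf mIK indf
  (sqint_integrable (sqint_bounded P mf f1)) iK.
by rewrite EK => -[].
Qed.

Let rectangle_split n (D : 'I_n.+1 -> set E) (Y : 'I_n.+1 -> set (\bar R)) :
  rectangle D Y = [set w | Y ord0 (N w (D ord0))] `&`
    rectangle (fun i => D (lift ord0 i)) (fun i => Y (lift ord0 i)).
Proof.
apply/seteqP; split => w /= => [h|[h0 hS] i _].
  by split => [|i _]; exact: h.
by case: (unliftP ord0 i) => [j|] ->; [exact: hS|].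
Qed.

(** [B] is adjoined to the disjoint family [D'] at the index [ord0], and the product formula for
    Poisson counts is applied to both families. *)
Let independent_count (D B : set E) (A : set Omega) (Y : set (\bar R)) :
  measurable B -> D `&` B = set0 -> region_sigma D A -> measurable Y ->
  independent_events P A [set w | Y (N w B)].
Proof.
move=> mB DB sA mY; apply: (independent_region_event _ _ sA); first exact: mNY.
move=> n D' Y' mD' D'D tD' mY'.
have [_ _ _ indN] := N_poisson.
pose D1 (i : 'I_n.+1) := oapp D' B (unlift ord0 i).
pose Y1 (i : 'I_n.+1) := oapp Y' Y (unlift ord0 i).
have mD1 i : measurable (D1 i) by rewrite /D1; case: unlift.
have mY1 i : measurable (Y1 i) by rewrite /Y1; case: unlift.
have D'B i : D' i `&` B = set0.
  by apply/seteqP; split => // x [/D'D Dx Bx]; rewrite -DB.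
have tD1 : trivIset setT D1.
  move=> i j _ _; rewrite /D1.
  case: unliftP => [i'|] ->; case: unliftP => [j'|] ->//=.
  - by move=> /(tD' i' j' I I) ->.
  - by rewrite D'B => -[].
  - by rewrite setIC D'B => -[].
rewrite /independent_events /rectangle indN// muleC.
have := indN n.+1 D1 Y1 mD1 mY1 tD1.
rewrite big_ord_recl /D1 /Y1 unlift_none/=.
under eq_bigr do rewrite liftK/=.
move=> <-; congr (P _); apply/seteqP; split => w /=.
  by move=> [Yw YB] i _; case: unliftP => [j|] _ //=; exact: Yw.
move=> Yw; split; last by have := Yw ord0 I; rewrite unlift_none.
by move=> i _; have := Yw (lift ord0 i) I; rewrite liftK.
Qed.

Lemma region_sigmaS D D' : D `<=` D' -> region_sigma D `<=` region_sigma D'.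
Proof.
move=> DD'; apply: smallest_sub; first exact: sigma_family_sigma_algebra.
move=> _ [A [mA AD] [Y mY <-]]; apply: sub_sigma_algebra; exists A.
  by split => //; exact: subset_trans AD DD'.
by exists Y.
Qed.

Lemma region_sigmaI D A B : region_sigma D A -> region_sigma D B ->
  region_sigma D (A `&` B).
Proof.
exact: (@measurableI _ (g_sigma_algebraType _) A B).
Qed.

(* One set of the finite family is absorbed at a time into the region [D]. *)
Lemma independent_region (D D' : set E) (A K : set Omega) : D `&` D' = set0 ->
  region_sigma D A -> region_sigma D' K -> independent_events P A K.
Proof.
move=> DD' sA sK; apply: (independent_region_event _ _ sA).
  exact: region_sigma_measurable sK.
move=> n B Y mB BD tB mY; rewrite /independent_events setIC muleC.
have {DD'} BD' i : D' `&` B i = set0.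
  by apply/seteqP; split => // x [D'x /BD Dx]; rewrite -DD'.
elim: n B Y mB BD tB mY D' BD' K sK => [|n ih] B Y mB BD tB mY D' BD' K sK.
  rewrite (_ : rectangle B Y = setT) ?setIT ?probability_setT ?mule1//.
  by apply/seteqP; split => // w _ [].
have indN := independent_count (mB ord0) (BD' ord0) _ (mY ord0).
rewrite rectangle_split setIA.
have sK' : region_sigma (D' `|` B ord0) (K `&` [set w | Y ord0 (N w (B ord0))]).
  apply: region_sigmaI; first by apply: region_sigmaS sK; exact: subsetUl.
  apply: sub_sigma_algebra; exists (B ord0); first by split => //; exact: subsetUr.
  by exists (Y ord0); rewrite ?setTI.
have sB0 : region_sigma (B ord0) [set w | Y ord0 (N w (B ord0))].
  apply: sub_sigma_algebra; exists (B ord0); first by split.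
  by exists (Y ord0); rewrite ?setTI.
have tB' : trivIset setT (fun i => B (lift ord0 i)).
  by move=> i j _ _ /(tB _ _ I I)/lift_inj.
have B0 i : B ord0 `&` B (lift ord0 i) = set0.
  by apply: contrapT => /eqP/set0P/(tB _ _ I I).
(* The remaining sets are split off from [D'] enlarged by [B ord0]; below, the induction hypothesis
   with region [B ord0] alone puts [rectangle B Y] together again. *)
rewrite (ih _ _ _ _ _ _ (D' `|` B ord0))//; last first.
  by move=> i; rewrite setIUl BD' B0 setU0.
rewrite indN//.
rewrite -muleA; congr (_ * _)%E.
rewrite (ih _ _ _ _ _ _ (B ord0))//.
Qed.

Lemma independent_region_RV (D D' : set E) (V W : Omega -> R) :
  D `&` D' = set0 -> measurable_wrt setT (region_sigma D) V ->
  measurable_wrt setT (region_sigma D') W -> independent_RV P V W.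
Proof.
move=> DD' DV DW A B mA mB.
have : region_sigma D (setT `&` V @^-1` A) by apply: DV; exists A.
have : region_sigma D' (setT `&` W @^-1` B) by apply: DW; exists B.
by rewrite !setTI => ? ?; exact: (independent_region DD').
Qed.

Lemma region_integral (D D' : set E) (V W : Omega -> R) :
  D `&` D' = set0 -> measurable_wrt setT (region_sigma D) V ->
  measurable_wrt setT (region_sigma D') W ->
  P.-integrable setT (EFin \o V) -> P.-integrable setT (EFin \o W) ->
  P.-integrable setT (EFin \o (fun w => V w * W w)) /\
  \int[P]_w (V w * W w) = \int[P]_w V w * \int[P]_w W w.
Proof.
move=> DD' DV DW iV iW; apply: independent_integrable => //.
- by apply: measurable_wrt_fun DV; exact: region_sigma_measurable.
- by apply: measurable_wrt_fun DW; exact: region_sigma_measurable.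
- exact: independent_region_RV DV DW.
Qed.

Lemma measurable_wrtS (G G' : set (set Omega)) d' (V : measurableType d')
    (f : Omega -> V) :
  G `<=` G' -> measurable_wrt setT G f -> measurable_wrt setT G' f.
Proof. by move=> GG' Gf A /Gf /GG'. Qed.

Lemma measurable_count_region (D A : set E) (phi : \bar R -> R) :
  measurable A -> A `<=` D -> measurable_fun setT phi ->
  measurable_wrt setT (region_sigma D) (fun w => phi (N w A)).
Proof.
move=> mA AD mphi; have sG := region_sigma_algebra D.
apply/measurable_wrtP => //; apply: measurableT_comp mphi _.
by apply/measurable_wrtP => //; exact: sub_sigma_family.
Qed.

Lemma measurable_wrtM (D : set E) (f g : Omega -> R) :
  measurable_wrt setT (region_sigma D) f -> measurable_wrt setT (region_sigma D) g ->
  measurable_wrt setT (region_sigma D) (fun w => f w * g w).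
Proof.
have sG := region_sigma_algebra D.
move=> /(measurable_wrtP _ sG) mf /(measurable_wrtP _ sG) mg.
by apply/measurable_wrtP => //; exact: measurable_funM.
Qed.

Lemma measurable_wrtD (D : set E) (f g : Omega -> R) :
  measurable_wrt setT (region_sigma D) f -> measurable_wrt setT (region_sigma D) g ->
  measurable_wrt setT (region_sigma D) (fun w => f w + g w).
Proof.
have sG := region_sigma_algebra D.
move=> /(measurable_wrtP _ sG) mf /(measurable_wrtP _ sG) mg.
by apply/measurable_wrtP => //; exact: measurable_funD.
Qed.

Lemma measurable_wrt_cst (D : set E) (c : R) :
  measurable_wrt setT (region_sigma D) (fun=> c).
Proof. by apply/(measurable_wrtP _ (region_sigma_algebra D)); exact: measurable_cst. Qed.

(** [Nhat] for a general intensity; [NhatE] identifies the two. *)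
Definition compensated (A : set E) (w : Omega) : R := fine (N w A) - fine (mu A).

Lemma measurable_compensated D A : measurable A -> A `<=` D ->
  measurable_wrt setT (region_sigma D) (compensated A).
Proof.
move=> mA AD.
apply: (measurable_count_region (phi := fun x => fine x - fine (mu A))) => //.
by apply: measurable_funB => //; exact: fine_measurable.
Qed.

Lemma compensated_sqint A : measurable A -> (mu A < +oo)%E ->
  sqint P (compensated A).
Proof.
move=> mA muA; apply: sqintB; last exact: sqint_cst.
by have := poisson_sqint N_poisson mA (measure_ge0 _ _) muA.
Qed.

Lemma compensated_mean A : measurable A -> (mu A < +oo)%E ->
  \int[P]_w compensated A w = 0.
Proof.
move=> mA muA; have sr := poisson_sqint N_poisson mA (measure_ge0 _ _) muA.
rewrite /compensated RintegralB//; last 2 first.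
- exact: sqint_integrable sr.
- exact: sqint_integrable (sqint_cst _ _).
rewrite Rintegral_probability_cst (poisson_mean N_poisson mA _ muA)//.
exact: subrr.
Qed.

Lemma compensated_var A : measurable A -> (mu A < +oo)%E ->
  \int[P]_w (compensated A w * compensated A w) = fine (mu A).
Proof.
move=> mA muA; rewrite -[RHS](poisson_var N_poisson mA _ muA)//.
Qed.

(** The equality is only almost sure, since [fine] is additive where both counts are finite. *)
Lemma compensatedU_ae A B : measurable A -> measurable B -> A `&` B = set0 ->
  (mu A < +oo)%E -> (mu B < +oo)%E ->
  {ae P, forall w, compensated (A `|` B) w = compensated A w + compensated B w}.
Proof.
move=> mA mB AB muA muB.
have := poisson_fin_ae N_poisson mA (measure_ge0 _ _) muA.
have := poisson_fin_ae N_poisson mB (measure_ge0 _ _) muB.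
apply: filterS2 => w fB fA; rewrite /compensated !measureU//.
rewrite !fineD//; first by lra.
- by rewrite ge0_fin_numE.
- by rewrite ge0_fin_numE.
Qed.

End poisson_independence.

(** * Covariances and exponentials of compensated counts *)

Section poisson_second_order.
Context {dO dE : measure_display} {Omega : measurableType dO}.
Context {E : measurableType dE} {R : realType}.
Variables (P : probability Omega R) (mu : {measure set E -> \bar R}).
Variable N : Omega -> {measure set E -> \bar R}.
Hypothesis N_poisson : poisson_random_measure P mu N.

Local Notation comp := (compensated mu N).
Local Notation region := (region_sigma N).
Implicit Types (A B D : set E) (W : Omega -> R).

Lemma measurable_wrt_region D W : measurable_wrt setT (region D) W ->
  measurable_fun setT W.
Proof.
move=> DW; apply: (measurable_wrt_fun _ DW).
exact: (region_sigma_measurable N_poisson).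
Qed.

Lemma ae_eq_Rintegral (f g : Omega -> R) :
  measurable_fun setT f -> measurable_fun setT g ->
  {ae P, forall w, f w = g w} -> \int[P]_w f w = \int[P]_w g w.
Proof.
move=> mf mg fg; congr fine; apply: ae_eq_integral => //.
- exact/measurable_EFinP.
- exact/measurable_EFinP.
- by apply: filterS fg => w /= ->.
Qed.

Let sqc A : measurable A -> (mu A < +oo)%E -> sqint P (comp A).
Proof. exact: compensated_sqint. Qed.

Let mc D A : measurable A -> A `<=` D -> measurable_wrt setT (region D) (comp A).
Proof. exact: measurable_compensated. Qed.

(** [A] and [B] are split along their intersection. Products of compensated counts over disjoint
    sets have mean 0 against the weight [W], so only the square over the intersection survives. *)
Lemma compensated_cov D A B W (M : R) :
  measurable A -> measurable B -> (mu A < +oo)%E -> (mu B < +oo)%E ->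
  D `&` A = set0 -> D `&` B = set0 ->
  measurable_wrt setT (region D) W -> (forall w, `|W w| <= M) ->
  \int[P]_w (W w * (comp A w * comp B w)) = \int[P]_w W w * fine (mu (A `&` B)).
Proof.
move=> mA mB muA muB DA DB DW WM.
have mW := measurable_wrt_region DW.
have sW := sqint_bounded P mW WM; have iW := sqint_integrable sW.
have disj A' B' : measurable A' -> measurable B' -> (mu A' < +oo)%E ->
    (mu B' < +oo)%E -> D `&` A' = set0 -> D `&` B' = set0 -> A' `&` B' = set0 ->
    \int[P]_w (W w * (comp A' w * comp B' w)) = 0.
  move=> mA' mB' muA' muB' DA' DB' AB'.
  have DAB : (D `|` A') `&` B' = set0 by rewrite setIUl DB' AB' setU0.
  have [_] := region_integral N_poisson DAB
    (measurable_wrtM (measurable_wrtS (region_sigmaS (@subsetUl _ D A')) DW)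
      (mc mA' (@subsetUr _ D A')))
    (mc mB' (@subset_refl _ B'))
    (sqintM sW (sqc mA' muA')) (sqint_integrable (sqc mB' muB')).
  rewrite (compensated_mean N_poisson mB' muB') mulr0 => <-.
  by apply: eq_Rintegral => w _; rewrite mulrA.
have same A' : measurable A' -> (mu A' < +oo)%E -> D `&` A' = set0 ->
    \int[P]_w (W w * (comp A' w * comp A' w)) = \int[P]_w W w * fine (mu A').
  move=> mA' muA' DA'.
  have [_ ->] := region_integral N_poisson DA' DW
    (measurable_wrtM (mc mA' (@subset_refl _ A')) (mc mA' (@subset_refl _ A'))) iW
    (sqintM (sqc mA' muA') (sqc mA' muA')).
  by rewrite (compensated_var N_poisson mA' muA').
pose I := A `&` B; pose J := A `\` B; pose K := B `\` A.
have [mI mJ mK] : [/\ measurable I, measurable J & measurable K].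
  by split; [exact: measurableI|exact: measurableD|exact: measurableD].
have fin C C' : measurable C -> measurable C' -> (mu C' < +oo)%E -> C `<=` C' -> (mu C < +oo)%E.
  by move=> mC mC' muC' CC'; rewrite (le_lt_trans _ muC')// le_measure ?inE.
have muI : (mu I < +oo)%E by apply: fin muA _ => //; exact: subIsetl.
have muJ : (mu J < +oo)%E by apply: fin muA _ => //; exact: subDsetl.
have muK : (mu K < +oo)%E by apply: fin muB _ => //; exact: subDsetl.
have DS C C' : D `&` C' = set0 -> C `<=` C' -> D `&` C = set0.
  by move=> DC' CC'; apply/seteqP; split => // x [Dx /CC' ?]; rewrite -DC'.
have DI : D `&` I = set0 by apply: DS DA _; exact: subIsetl.
have DJ : D `&` J = set0 by apply: DS DA _; exact: subDsetl.
have DK : D `&` K = set0 by apply: DS DB _; exact: subDsetl.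
have IJ : I `&` J = set0 by apply/seteqP; split => // x [[? ?] []].
have IK : I `&` K = set0 by apply/seteqP; split => // x [[? ?] []].
have JI : J `&` I = set0 by rewrite setIC.
have JK : J `&` K = set0 by apply/seteqP; split => // x [[? ?] []].
have AE : A = I `|` J by rewrite /I /J setUIDK.
have BE : B = I `|` K by rewrite /I /K setIC setUIDK.
have i1 C C' : measurable C -> measurable C' -> (mu C < +oo)%E -> (mu C' < +oo)%E ->
    P.-integrable setT (EFin \o (fun w => W w * (comp C w * comp C' w))).
  move=> mC mC' muC muC'.
  have := sqintM (sqint_bndM mW WM (sqc mC muC)) (sqc mC' muC').
  by under [X in _ -> integrable _ _ (EFin \o X)]eq_fun do rewrite mulrA.
have mcf C : measurable C -> measurable_fun setT (comp C).
  by move=> mC; exact: measurable_wrt_region (mc mC (@subset_refl _ C)).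
transitivity (\int[P]_w (W w * (comp I w * comp I w) + (W w * (comp I w * comp K w)
    + (W w * (comp J w * comp I w) + W w * (comp J w * comp K w))))).
  apply: ae_eq_Rintegral.
  - by apply: measurable_funM => //; apply: measurable_funM; exact: mcf.
  - by repeat (apply: measurable_funD); (apply: measurable_funM => //;
      apply: measurable_funM; exact: mcf).
  - have := compensatedU_ae N_poisson mI mJ IJ muI muJ.
    have := compensatedU_ae N_poisson mI mK IK muI muK.
    by rewrite -AE -BE; apply: filterS2 => w -> ->; ring.
do 3 (rewrite RintegralD//; [|exact: i1|by repeat (apply: integrableD_EFin; [exact: i1|]); exact: i1]).
by rewrite same// !disj// !addr0.
Qed.

Section single_set.
Variables (A : set E) (c : R).
Hypotheses (mA : measurable A) (muA : (mu A < +oo)%E) (c0 : 0 <= c).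
Let lambda := fine (mu A).

(** [e^(-c N(A))] divided by its mean. *)
Definition exp_count w : R :=
  expR (- (c * fine (N w A))) * expR (fine (mu A) * (1 - expR (- c))).

(** The orthogonal projection of [exp_count - 1] on the multiples of the compensated count: the
    difference is orthogonal to it by [exp_count_comp], [exp_comp_mean] and [exp_comp_sqr]. *)
Definition exp_comp w : R := (expR (- c) - 1) * comp A w.

(** At once the variance of [exp_comp], its covariance with [exp_count], and the logarithm of the
    second moment of [exp_count]. *)
Definition exp_rate : R := fine (mu A) * (1 - expR (- c)) ^+ 2.

Let lambda0 : 0 <= lambda. Proof. exact: fine_ge0. Qed.

Let mphi : measurable_fun setT (fun x : \bar R =>
  expR (- (c * fine x)) * expR (fine (mu A) * (1 - expR (- c)))).
Proof.
apply: measurable_funM => //; apply: measurableT_comp => //.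
by apply: measurableT_comp => //; exact: measurable_funM.
Qed.

Lemma exp_count_region : measurable_wrt setT (region A) exp_count.
Proof. exact: (measurable_count_region (phi := fun x => _) mA (@subset_refl _ A) mphi). Qed.

Lemma exp_count_le w : `|exp_count w| <= expR (lambda * (1 - expR (- c))).
Proof.
rewrite ger0_norm ?mulr_ge0 ?expR_ge0// ler_piMl ?expR_ge0//.
by rewrite -[leRHS]expR0 ler_expR oppr_le0 mulr_ge0// fine_ge0.
Qed.

Let ic (k : R) : P.-integrable setT (EFin \o (fun=> k)).
Proof. exact: sqint_integrable (sqint_cst P k). Qed.

Let mexp (b : R) : measurable_fun setT (fun w => expR (- (b * fine (N w A)))).
Proof.
apply: measurableT_comp => //; apply: measurableT_comp => //.
apply: measurable_funM => //.
exact: (measurable_rcount N_poisson mA).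
Qed.

Let sexp (b : R) : 0 <= b -> sqint P (fun w => expR (- (b * fine (N w A)))).
Proof.
move=> b0; apply: (@sqint_bounded _ _ _ _ _ 1) => // w.
by rewrite ger0_norm ?expR_ge0// -[leRHS]expR0 ler_expR oppr_le0 mulr_ge0// fine_ge0.
Qed.

Let laplace (b : R) : 0 <= b ->
  \int[P]_w expR (- (b * fine (N w A))) = expR (- (lambda * (1 - expR (- b)))).
Proof. exact: (poisson_laplace N_poisson mA (measure_ge0 mu A) muA). Qed.

Lemma exp_count_mean : \int[P]_w exp_count w = 1.
Proof.
rewrite RintegralZr//; last by apply: sqint_integrable; exact: sexp.
by rewrite laplace// -expRD addNr expR0.
Qed.

Lemma exp_count_sqr : \int[P]_w (exp_count w ^+ 2) = expR exp_rate.
Proof.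
rewrite (_ : (fun w => _) = fun w => expR (- (2 * c * fine (N w A))) *
    expR (lambda * (1 - expR (- c))) ^+ 2); last first.
  apply/funext => w; rewrite /exp_count exprMn; congr (_ * _).
  by rewrite expr2 -expRD; congr expR; ring.
rewrite RintegralZr//; last by apply: sqint_integrable; apply: sexp; rewrite mulr_ge0.
rewrite laplace ?mulr_ge0// expr2 -!expRD; congr expR.
have -> : expR (- (2 * c)) = expR (- c) ^+ 2 by rewrite expr2 -expRD; congr expR; ring.
by rewrite /exp_rate -/lambda; ring.
Qed.

Lemma exp_comp_region : measurable_wrt setT (region A) exp_comp.
Proof. by apply: measurable_wrtM; [exact: measurable_wrt_cst|exact: mc]. Qed.

Lemma exp_comp_sqint : sqint P exp_comp.
Proof. by apply: sqintZ; exact: sqc. Qed.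

Lemma exp_comp_mean : \int[P]_w exp_comp w = 0.
Proof.
rewrite RintegralZl//; last by apply: sqint_integrable; exact: sqc.
by rewrite (compensated_mean N_poisson)// mulr0.
Qed.

Lemma exp_comp_sqr : \int[P]_w (exp_comp w ^+ 2) = exp_rate.
Proof.
rewrite (_ : (fun w => _) = fun w => (expR (- c) - 1) ^+ 2 * (comp A w * comp A w)); last first.
  by apply/funext => w; rewrite /exp_comp; ring.
rewrite RintegralZl//; last by apply: sqintM; exact: sqc.
by rewrite (compensated_var N_poisson)// /exp_rate; ring.
Qed.

Lemma exp_count_comp : \int[P]_w (exp_count w * exp_comp w) = exp_rate.
Proof.
pose K := (expR (- c) - 1) * expR (lambda * (1 - expR (- c))).
rewrite (_ : (fun w => _) = fun w =>
    K * (fine (N w A) * expR (- (c * fine (N w A)))) +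
    (- (K * lambda)) * expR (- (c * fine (N w A)))); last first.
  by apply/funext => w; rewrite /exp_count /exp_comp /compensated /K -/lambda; ring.
have iM : P.-integrable setT (EFin \o (fun w => fine (N w A) * expR (- (c * fine (N w A))))).
  by apply: sqintM; [exact: (poisson_sqint N_poisson mA (measure_ge0 mu A) muA)|exact: sexp].
have iE := sqint_integrable (sexp c0).
rewrite RintegralD//; [|exact: integrableZ_EFin|exact: integrableZ_EFin].
rewrite !RintegralZl// laplace// (poisson_laplace1 N_poisson mA (measure_ge0 mu A) muA c0).
rewrite -/lambda /exp_rate -/lambda.
transitivity (expR (lambda * (1 - expR (- c))) * expR (- (lambda * (1 - expR (- c)))) *
  (lambda * (1 - expR (- c)) ^+ 2)); first by rewrite /K; ring.
by rewrite -expRD subrr expR0 mul1r.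
Qed.

End single_set.

Section disjoint_family.
Variables (D : nat -> set E) (c : nat -> R).
Hypotheses (mD : forall k, measurable (D k)) (muD : forall k, (mu (D k) < +oo)%E).
Hypotheses (tD : trivIset setT D) (c0 : forall k, 0 <= c k).

Definition exp_prod n w : R := \prod_(k < n) exp_count (D k) (c k) w.
Definition exp_sum n w : R := \sum_(k < n) exp_comp (D k) (c k) w.
Definition exp_total n : R := \sum_(k < n) exp_rate (D k) (c k).
Let reg n := \bigcup_(k < n) D k.

Let reg_disj n : reg n `&` D n = set0.
Proof.
apply/seteqP; split => // x [[k /= kn Dk] Dn].
have /tD : (D k `&` D n) !=set0 by exists x.
by move=> /(_ I I) e; move: kn; rewrite e ltnn.
Qed.

Let reg_sub n : reg n `<=` reg n.+1.
Proof. by move=> x [k /= kn Dk]; exists k => //=; exact: ltnW. Qed.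

Let reg_in n : D n `<=` reg n.+1.
Proof. by move=> x Dx; exists n => /=. Qed.

Let step_region n (f : Omega -> R) : measurable_wrt setT (region (reg n)) f ->
  measurable_wrt setT (region (reg n.+1)) f.
Proof. by apply: measurable_wrtS; apply: region_sigmaS; exact: reg_sub. Qed.

Let step_in n (f : Omega -> R) : measurable_wrt setT (region (D n)) f ->
  measurable_wrt setT (region (reg n.+1)) f.
Proof. by apply: measurable_wrtS; apply: region_sigmaS; exact: reg_in. Qed.

Lemma exp_prod_region n : measurable_wrt setT (region (reg n)) (exp_prod n).
Proof.
rewrite /exp_prod; elim: n => [|n ih].
  by under eq_fun do rewrite big_ord0; exact: measurable_wrt_cst.
under eq_fun do rewrite big_ord_recr/=.
apply: measurable_wrtM; first exact: step_region.
by apply: step_in; exact: exp_count_region.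
Qed.

Lemma exp_sum_region n : measurable_wrt setT (region (reg n)) (exp_sum n).
Proof.
rewrite /exp_sum; elim: n => [|n ih].
  by under eq_fun do rewrite big_ord0; exact: measurable_wrt_cst.
under eq_fun do rewrite big_ord_recr/=.
apply: measurable_wrtD; first exact: step_region.
by apply: step_in; exact: exp_comp_region.
Qed.

Lemma exp_prod_bounded n : exists M : R, forall w, `|exp_prod n w| <= M.
Proof.
elim: n => [|n [M ih]]; first by exists 1 => w; rewrite /exp_prod big_ord0 normr1.
exists (M * expR (fine (mu (D n)) * (1 - expR (- c n)))) => w.
rewrite /exp_prod big_ord_recr/= normrM ler_pM//; first exact: ih.
exact: exp_count_le.
Qed.

Lemma exp_prod_sqint n : sqint P (exp_prod n).
Proof.
have [M HM] := exp_prod_bounded n; apply: sqint_bounded HM.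
exact: (measurable_wrt_region (@exp_prod_region n)).
Qed.

Lemma exp_sum_sqint n : sqint P (exp_sum n).
Proof. by apply: sqint_sum => k; exact: exp_comp_sqint. Qed.

Let count_sqint k : sqint P (exp_count (D k) (c k)).
Proof.
apply: sqint_bounded (exp_count_le (D k) (c0 k)).
exact: (measurable_wrt_region (@exp_count_region (D k) (c k) (mD k))).
Qed.

(** Each step brings in one set whose count is independent of the previous ones. The five moments
    travel together because the cross moments need the means. *)
Lemma exp_family_moments n :
  [/\ \int[P]_w exp_prod n w = 1,
      \int[P]_w (exp_prod n w ^+ 2) = expR (exp_total n),
      \int[P]_w (exp_prod n w * exp_sum n w) = exp_total n,
      \int[P]_w exp_sum n w = 0 &
      \int[P]_w (exp_sum n w ^+ 2) = exp_total n].
Proof.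
elim: n => [|n [W1 W2 WU U1 U2]].
  have p0 : exp_prod 0 = fun=> 1 by apply/funext => w; rewrite /exp_prod big_ord0.
  have s0 : exp_sum 0 = fun=> 0 by apply/funext => w; rewrite /exp_sum big_ord0.
  rewrite p0 s0 /exp_total big_ord0 expR0 !expr2 !mulr1 !mulr0.
  by rewrite !Rintegral_probability_cst.
have [YR ZR] := (@exp_count_region (D n) (c n) (mD n), @exp_comp_region (D n) (c n) (mD n)).
have [PR UR] := (@exp_prod_region n, @exp_sum_region n).
have [sY sZ] := (count_sqint n, exp_comp_sqint (c n) (mD n) (muD n)).
have [sW sU] := (exp_prod_sqint n, exp_sum_sqint n).
have RI := region_integral N_poisson (reg_disj n).
have PS w : exp_prod n.+1 w = exp_prod n w * exp_count (D n) (c n) w.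
  by rewrite /exp_prod big_ord_recr.
have SS w : exp_sum n.+1 w = exp_sum n w + exp_comp (D n) (c n) w.
  by rewrite /exp_sum big_ord_recr.
have TS : exp_total n.+1 = exp_total n + exp_rate (D n) (c n).
  by rewrite /exp_total big_ord_recr.
split.
- under eq_Rintegral do rewrite PS.
  have [_ ->] := RI _ _ PR YR (sqint_integrable sW) (sqint_integrable sY).
  by rewrite W1 exp_count_mean// mulr1.
- under eq_Rintegral do rewrite PS exprMn !expr2.
  have [_ ->] := RI _ _ (measurable_wrtM PR PR) (measurable_wrtM YR YR)
    (sqintM sW sW) (sqintM sY sY).
  by rewrite W2 exp_count_sqr// TS expRD.
- under eq_Rintegral do rewrite PS SS.
  have [i1 e1] := RI _ _ (measurable_wrtM PR UR) YR (sqintM sW sU) (sqint_integrable sY).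
  have [i2 e2] := RI _ _ PR (measurable_wrtM YR ZR) (sqint_integrable sW) (sqintM sY sZ).
  rewrite (_ : (fun w => _) = fun w => exp_prod n w * exp_sum n w * exp_count (D n) (c n) w +
     exp_prod n w * (exp_count (D n) (c n) w * exp_comp (D n) (c n) w)); last first.
    by apply/funext => w; ring.
  rewrite RintegralD// e1 e2 WU W1 exp_count_mean// exp_count_comp// TS.
  by rewrite mulr1 mul1r.
- under eq_Rintegral do rewrite SS.
  rewrite RintegralD//; [|exact: sqint_integrable|exact: sqint_integrable].
  by rewrite U1 exp_comp_mean// addr0.
- under eq_Rintegral do rewrite SS.
  have [i1 e1] := RI _ _ UR ZR (sqint_integrable sU) (sqint_integrable sZ).
  rewrite (_ : (fun w => _) = fun w => exp_sum n w ^+ 2 +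
     (2 * (exp_sum n w * exp_comp (D n) (c n) w) + exp_comp (D n) (c n) w ^+ 2)); last first.
    by apply/funext => w; ring.
  have i3 := integrableZ_EFin 2 i1.
  have [j1 j2] := (sqint_integrable2 sU, sqint_integrable2 sZ).
  rewrite (RintegralD measurableT j1 (integrableD_EFin i3 j2)).
  rewrite (RintegralD measurableT i3 j2) RintegralZl// e1 U1 U2 exp_comp_sqr// TS.
  by rewrite mul0r mulr0 add0r.
Qed.

Definition exp_error n w : R := exp_prod n w - 1 - exp_sum n w.

Lemma exp_error_region n : measurable_wrt setT (region (reg n)) (exp_error n).
Proof.
rewrite (_ : exp_error n = fun w => exp_prod n w + ((-1) + (-1) * exp_sum n w)).
  apply: measurable_wrtD; first exact: exp_prod_region.
  apply: measurable_wrtD; first exact: measurable_wrt_cst.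
  by apply: measurable_wrtM; [exact: measurable_wrt_cst|exact: exp_sum_region].
by apply/funext => w; rewrite /exp_error; ring.
Qed.

Lemma exp_error_sqint n : sqint P (exp_error n).
Proof.
apply: sqintB; last exact: exp_sum_sqint.
by apply: sqintB; [exact: exp_prod_sqint|exact: sqint_cst].
Qed.

Lemma exp_error_mean n : \int[P]_w exp_error n w = 0.
Proof.
have [W1 W2 WU U1 U2] := exp_family_moments n.
have iW := sqint_integrable (exp_prod_sqint n).
have iU := sqint_integrable (exp_sum_sqint n).
have i1 := sqint_integrable (sqint_cst P (1 : R)).
have iW1 := sqint_integrable (sqintB (exp_prod_sqint n) (sqint_cst P 1)).
rewrite RintegralB// RintegralB// W1 U1 Rintegral_probability_cst; lra.
Qed.

(** With [q = exp_total], the product minus 1 has second moment [e^q - 1], and its covariance with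
    the sum and the variance of the sum are both [q]; hence [e^q - 1 - 2 q + q]. *)
Lemma exp_error_sqr n :
  \int[P]_w (exp_error n w ^+ 2) = expR (exp_total n) - 1 - exp_total n.
Proof.
have [W1 W2 WU U1 U2] := exp_family_moments n.
have [sW sU] := (exp_prod_sqint n, exp_sum_sqint n).
have sW1 := sqintB sW (sqint_cst P 1).
rewrite /exp_error (Rintegral_sqrB sW1 sU) (Rintegral_sqr_shift _ sW) W1 W2 U2.
rewrite (_ : (fun w => _) = fun w => exp_prod n w * exp_sum n w - exp_sum n w).
  rewrite RintegralB//; [|exact: sqintM|exact: sqint_integrable].
  by rewrite WU U1; ring.
by apply/funext => w; ring.
Qed.

End disjoint_family.
End poisson_second_order.

(** * The intensity measure *)

Section sigma_finite_measures.
Context {R : realType}.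

(** A copy of [m] indexed by the proof [sf], so that instance inference finds the
    sigma-finiteness. *)
Definition sfm_of d (T : measurableType d) (m : {measure set T -> \bar R})
  (sf : sigma_finite setT m) : set T -> \bar R := m.

Section sfm.
Context d (T : measurableType d) (m : {measure set T -> \bar R}).
Variable sf : sigma_finite setT m.

HB.instance Definition _ := Measure.on (sfm_of sf).
HB.instance Definition _ := Measure_isSigmaFinite.Build _ _ _ (sfm_of sf) sf.
End sfm.

Definition box n (r : R) : set (n.-tuple R) := [set x | forall i, `|tnth x i| <= r].
Arguments box : clear implicits.

Lemma norm_le_itv (r : R) : [set t : R | `|t| <= r] = `[- r, r]%classic.
Proof. by apply/seteqP; split => t /=; rewrite in_itv/= ler_norml. Qed.

Lemma measurable_box n (r : R) : measurable (box n r).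
Proof.
rewrite (_ : box n r = \bigcap_(i in [set: 'I_n])
    ((fun x : n.-tuple R => tnth x i) @^-1` [set t | `|t| <= r])).
  apply: fin_bigcap_measurable => // i _.
  have m1 : measurable [set t : R | `|t| <= r] by rewrite norm_le_itv.
  have := @measurable_tnth _ R n i measurableT _ m1.
  by rewrite setTI.
by apply/seteqP; split => [x h i _|x h i] /=; exact: h.
Qed.

Lemma bigcup_box n : \bigcup_k box n k%:R = [set: n.-tuple R].
Proof.
apply/seteqP; split => // x _.
pose M := \sum_(i < n) `|tnth x i|.
exists (Num.bound M) => // i; apply: le_trans (_ : M <= _).
  by rewrite /M (bigD1 i)//= lerDl sumr_ge0.
by apply/ltW/archi_boundP; rewrite sumr_ge0.
Qed.

(* [lebesgue_measure] lives on [measurableTypeR R]; this is the same set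
   function on the sigma-field with the default display. *)
Definition leb : set R -> \bar R := lebesgue_measure.

Let leb0 : leb set0 = 0%E. Proof. exact: (measure0 lebesgue_measure). Qed.
Let leb_ge0 A : (0 <= leb A)%E. Proof. exact: (measure_ge0 lebesgue_measure). Qed.
Let leb_additive : semi_sigma_additive leb.
Proof. exact: (@measure_semi_sigma_additive _ _ _ lebesgue_measure). Qed.
HB.instance Definition _ := isMeasure.Build _ _ _ leb leb0 leb_ge0 leb_additive.
Let leb_sigma_finite : sigma_finite setT leb.
Proof. exact: (sigma_finiteT lebesgue_measure). Qed.
HB.instance Definition _ := Measure_isSigmaFinite.Build _ _ _ leb leb_sigma_finite.

Lemma leb_itv (b0 b1 : bool) (a b : R) : (a <= b) ->
  leb [set` Interval (BSide b0 a) (BSide b1 b)] = (b - a)%:E.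
Proof.
rewrite /leb lebesgue_measure_itv/= lte_fin le_eqVlt => /orP[/eqP->|->].
  by rewrite ltxx subrr.
by rewrite EFinB.
Qed.

Lemma leb_itv_fin (b0 b1 : bool) (a b : R) :
  (leb [set` Interval (BSide b0 a) (BSide b1 b)] < +oo)%E.
Proof. by rewrite /leb lebesgue_measure_itv/=; case: ifP => // _; rewrite -EFinB ltry. Qed.

(** [lebesgue_tuple] is only a set function; its recursion is followed to realise it as a measure,
    pushing a product measure forward along [cons]. Finiteness on boxes makes each stage
    sigma-finite, as the next product requires. *)
Lemma lebesgue_tuple_sfm n :
  {m : {sigma_finite_measure set (n.-tuple R) -> \bar R} |
    (m : set (n.-tuple R) -> \bar R) = @lebesgue_tuple R n &
    forall r : R, (m (box n r) < +oo)%E}.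
Proof.
elim: n => [|n [m mE mfin]].
  exists (\d_[tuple])%R => //.
  by move=> r; rewrite (le_lt_trans (probability_le1 _ _)) ?ltry//; exact: measurable_box.
pose phi (p : R * n.-tuple R) : n.+1.-tuple R := [tuple of p.1 :: p.2].
have mphi : measurable_fun setT phi.
  exact: (measurable_cons (f := fst) (g := snd)).
pose lm : {measure set (R * n.-tuple R) -> \bar R} := (leb \x m)%E.
pose pm : {measure set (n.+1.-tuple R) -> \bar R} :=
   measure_function_pushforward__canonical__measure_function_Measure lm mphi.
have pmE : (pm : set _ -> \bar R) = @lebesgue_tuple R n.+1.
  by apply/funext => A; rewrite /pm/= /pushforward /= mE.
have pmbox (r : R) : (pm (box n.+1 r) < +oo)%E.
  have -> : pm (box n.+1 r) = (leb \x m)%E ([set t : R | `|t| <= r] `*` box n r).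
    rewrite /pm/= /pushforward; congr (_ _); apply/seteqP; split => -[t x] /=.
      move=> h; split => [|i]; first by have := h ord0; rewrite (tnth_nth 0).
      have := h (lift ord0 i); rewrite !(tnth_nth 0)//.
    move=> [tr xr] i; case: (unliftP ord0 i) => [j|] ->; last by rewrite (tnth_nth 0).
    by have := xr j; rewrite !(tnth_nth 0).
  have m1 : measurable [set t : R | `|t| <= r] by rewrite norm_le_itv.
  rewrite product_measure1E//; last exact: measurable_box.
  rewrite lte_mul_pinfty//.
    by rewrite norm_le_itv ge0_fin_numE//; exact: leb_itv_fin.
have sf : sigma_finite setT pm.
  exists (fun k => box n.+1 k%:R); first by rewrite bigcup_box.
  by move=> k; split => //; exact: measurable_box.
by exists (sfm_of sf).
Qed.

(** Markov's inequality: the integrand is at least [min 1 (e^2)] on [G]. *)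
Lemma levy_fin (nu : {measure set R -> \bar R}) : levy_measure nu ->
  forall G, borel_away_from_0 G -> (nu G < +oo)%E.
Proof.
move=> [nu0 nui] G [mG [e e0 Ge]].
pose c : R := Num.min 1 (e ^+ 2).
have c0 : 0 < c by rewrite lt_min ltr01 exprn_gt0.
have mR0 : measurable (R0 : set R) by exact: measurableC.
have GR0 : G `<=` R0.
  by move=> z /Ge ez /= z0; move: ez; rewrite z0 normr0 leNgt e0.
have mf : measurable_fun setT (fun z : R => (Num.min 1 (`|z| ^+ 2))%:E).
  apply/measurable_EFinP; apply: measurable_minr => //.
  by apply: measurable_funX; exact: normr_measurable.
have f0 (z : R) : (0 <= (Num.min 1 (`|z| ^+ 2) : R)%:E)%E.
  by rewrite lee_fin le_min ler01 exprn_ge0.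
have : (c%:E * nu G <= \int[nu]_(z in R0) (Num.min 1 (`|z| ^+ 2))%:E)%E.
  rewrite -integral_cst//; apply: (@le_trans _ _ (\int[nu]_(z in G) (Num.min 1 (`|z| ^+ 2))%:E)%E).
    apply: ge0_le_integral => //.
    - by move=> z _ /=; rewrite lee_fin ltW.
    - exact: measurable_funTS.
    - move=> z Gz /=; rewrite lee_fin /c ge_min; apply/orP.
      have [?|?] := leP 1 (`|z| ^+ 2); [left|right] => //.
      by rewrite lerXn2r ?nnegrE//; [exact: ltW|exact: Ge].
  by apply: ge0_subset_integral => //; exact: measurable_funTS.
move=> /le_lt_trans /(_ nui); rewrite !ltey; apply: contra => /eqP ->.
by rewrite gt0_muley// lte_fin.
Qed.

(** The complement of an open ball about 0, unbounded despite the name; these sets exhaust [R0]. *)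
Definition annulus (k : nat) : set R := [set z | k.+1%:R^-1 <= `|z|].

Lemma annulus_away k : borel_away_from_0 (annulus k).
Proof.
split; last by exists k.+1%:R^-1 => //; rewrite invr_gt0.
rewrite (_ : annulus k = @Num.norm _ R @^-1` `[k.+1%:R^-1, +oo[%classic); last first.
  by apply/seteqP; split => z /=; rewrite in_itv/= andbT.
have mn : measurable_fun setT (@Num.norm _ R) by exact: normr_measurable.
by rewrite -[X in measurable X]setTI; exact: mn.
Qed.

Lemma bigcup_annulus : \bigcup_k annulus k = R0.
Proof.
apply/seteqP; split => z /=.
  move=> [k _ kz] z0; move: kz; rewrite /annulus/= z0 normr0 leNgt.
  by rewrite invr_gt0 ltr0n.
move=> /eqP z0; exists (Num.bound `|z|^-1) => //=.
rewrite /annulus/= -[leRHS]invrK lef_pV2 ?posrE ?invr_gt0 ?normr_gt0//.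
rewrite -natr1 ler_wpDr//; apply/ltW/archi_boundP.
by rewrite invr_ge0.
Qed.

Lemma levy_sigma_finite (nu : {measure set R -> \bar R}) : levy_measure nu ->
  sigma_finite setT nu.
Proof.
move=> lnu; exists (fun k => if k is k'.+1 then annulus k' else [set 0]).
  apply/seteqP; split => // z _.
  have [->|/eqP z0] := eqVneq z 0; first by exists 0%N.
  have : R0 z by [].
  by rewrite -bigcup_annulus => -[k _ kz]; exists k.+1.
move=> [|k]; first by rewrite (proj1 lnu); split.
by split; [exact: (proj1 (annulus_away k))|exact: levy_fin (annulus_away k)].
Qed.

Definition ltime : set R -> \bar R := mrestr leb (measurable_itv `[0%R, +oo[).

HB.instance Definition _ := Measure.on ltime.
Let ltime_sigma_finite : sigma_finite setT ltime.
Proof.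
have [F FT Ffin] := leb_sigma_finite; exists F => // i.
have [mF fF] := Ffin i; split => //.
rewrite /ltime /mrestr; apply: le_lt_trans fF; apply: le_measure; rewrite ?inE//.
exact: measurableI.
Qed.
HB.instance Definition _ := Measure_isSigmaFinite.Build _ _ _ ltime ltime_sigma_finite.

Lemma ltime_itv (a b : R) : 0 <= a -> a <= b -> ltime `]a, b]%classic = (b - a)%:E.
Proof.
move=> a0 ab; rewrite /ltime /mrestr setIidl ?leb_itv//.
by move=> t /=; rewrite !in_itv/= andbT => /andP[/ltW at_ _]; exact: le_trans at_.
Qed.

Lemma ltime_fin (I : set R) (M : R) : measurable I -> (forall t, I t -> t <= M) ->
  (ltime I < +oo)%E.
Proof.
move=> mI IM; rewrite /ltime /mrestr.
apply: (@le_lt_trans _ _ (leb `[0%R, M]%classic)); last exact: leb_itv_fin.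
apply: le_measure; rewrite ?inE//; first exact: measurableI.
by move=> t [/IM tM /=]; rewrite !in_itv/= andbT => ->.
Qed.

(** The minimum covers the case [b < a] as well, with an empty second slice: a block may end before
    the current time. *)
Lemma measure_time_split n (m : {measure set (txz R n) -> \bar R}) (a b : R)
    (A : set (n.-tuple R)) (G : set R) : 0 <= a -> measurable A -> measurable G ->
  m (`[0%R, b] `*` A `*` G) =
  (m (`[0%R, Num.min a b] `*` A `*` G) + m (`]a, b] `*` A `*` G))%E.
Proof.
move=> a0 mA mG.
have mr (I : set R) : measurable I -> measurable (I `*` A `*` G).
  by move=> mI; apply: measurableX => //; exact: measurableX.
rewrite -measureU; [|exact: mr|exact: mr|]; last first.
  apply/seteqP; split => // -[[t x] z] [[[/= + _] _] [[/= + _] _]].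
  rewrite !in_itv/= le_min => /andP[_ /andP[ta _]] /andP[at_ _].
  by move: (le_lt_trans ta at_); rewrite ltxx.
congr (m _); apply/seteqP; split => -[[t x] z]; rewrite /= !in_itv/= le_min.
  by move=> [[/andP[-> ->] ?] ?]; have [ta|ta] := leP t a; [left|right].
move=> [[[/andP[-> /andP[_ ->]] ?] ?]|[[/andP[at_ ->] ?] ?]]; first by [].
by rewrite (ltW (le_lt_trans a0 at_)).
Qed.

End sigma_finite_measures.
Arguments box {R} n r.

Section intensity_measure.
Context {R : realType} (d : nat).
Variables (nu : {measure set R -> \bar R}) (nu_levy : levy_measure nu).

Definition ltup : {sigma_finite_measure set (d.-tuple R) -> \bar R} :=
  s2val (lebesgue_tuple_sfm d).

Lemma ltupE : (ltup : set (d.-tuple R) -> \bar R) = @lebesgue_tuple R d.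
Proof. exact: s2valP (lebesgue_tuple_sfm d). Qed.

Lemma ltup_fin A : bounded_borel_Rd A -> (ltup A < +oo)%E.
Proof.
move=> [mA [M AM]].
have : (ltup A <= ltup (box d M))%E.
  by apply: le_measure; rewrite ?inE//; exact: measurable_box.
move=> /le_lt_trans; apply; exact: (s2valP' (lebesgue_tuple_sfm d) M).
Qed.

Definition levy_sfm : {sigma_finite_measure set R -> \bar R} :=
  sfm_of (levy_sigma_finite nu_levy).

(* The library's sigma-finiteness instance for [\x] is shadowed by its
   instance for subprobabilities, so it is called by name. *)
Lemma sigma_finite_product d1 d2 (T1 : measurableType d1) (T2 : measurableType d2)
    (m1 : {sigma_finite_measure set T1 -> \bar R})
    (m2 : {sigma_finite_measure set T2 -> \bar R}) :
  sigma_finite setT (m1 \x m2)%E.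
Proof.
have :=
  lebesgue_integral_fubini.measure_function_Measure_isSigmaFinite__to__measure_function_isSigmaFinite m1 m2.
by case.
Qed.

Definition mu_time_space : {sigma_finite_measure set (R * d.-tuple R)%type -> \bar R} :=
  sfm_of (sigma_finite_product ltime ltup).

Definition mu_txz : {sigma_finite_measure set (txz R d) -> \bar R} :=
  sfm_of (sigma_finite_product mu_time_space levy_sfm).

Lemma mu_txzE : (mu_txz : set (txz R d) -> \bar R) = intensity nu.
Proof. by rewrite /mu_txz /mu_time_space /intensity -ltupE. Qed.

Lemma mu_txz_rect (I : set R) (A : set (d.-tuple R)) (G : set R) :
  measurable I -> measurable A -> measurable G ->
  mu_txz (I `*` A `*` G) = (ltime I * ltup A * nu G)%E.
Proof.
move=> mI mA mG; rewrite /mu_txz/= product_measure1E//; last exact: measurableX.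
by rewrite /mu_time_space/= product_measure1E.
Qed.

Lemma mu_txz_fin (I : set R) (A : set (d.-tuple R)) (G : set R) (M : R) :
  measurable I -> (forall t, I t -> t <= M) -> bounded_borel_Rd A ->
  borel_away_from_0 G -> (mu_txz (I `*` A `*` G) < +oo)%E.
Proof.
move=> mI IM bA aG; rewrite mu_txz_rect//; [|by case: bA|by case: aG].
rewrite lte_mul_pinfty ?mule_ge0 ?measure_ge0//; last exact: levy_fin aG.
rewrite ge0_fin_numE ?mule_ge0 ?measure_ge0// lte_mul_pinfty ?measure_ge0//.
  by rewrite ge0_fin_numE ?measure_ge0//; exact: ltime_fin IM.
exact: ltup_fin.
Qed.

Context {dO : measure_display} {Omega : measurableType dO}.
Variable P : probability Omega R.
Implicit Types H : Omega * txz R d -> R.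

(** Processes are total functions with arbitrary values off the slab; once these are set to zero,
    the energy is an [L^2] norm on the whole product space. *)
Definition cutoff (T : R) H (q : Omega * txz R d) : R :=
  H q * \1_(slab `[0, T]) q.

Lemma measurable_slab (I : set R) : measurable I ->
  measurable (@slab dO Omega R d I).
Proof.
move=> mI; apply: measurableX => //; apply: measurableX; last exact: measurableC.
exact: measurableX.
Qed.

(** Tonelli over the factors of [mu_txz]. On [[0, T]] the time factor is Lebesgue measure, and the
    cutoff makes the integrand vanish at [z = 0]. *)
Lemma energyE T H : measurable_fun setT (cutoff T H) ->
  energy P nu T H = sqnorm (P \x mu_txz)%E (cutoff T H).
Proof.
move=> mH; have mF := measurable_EFin_sqr mH.
have F0 q : (0 <= (cutoff T H q ^+ 2)%:E)%E by rewrite lee_fin sqr_ge0.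
rewrite /sqnorm fubini_tonelli1//; apply: eq_integral => w _.
rewrite /fubini_F.
have mFw : measurable_fun setT (fun e => (cutoff T H (w, e) ^+ 2)%:E).
  exact: (measurableT_comp mF (measurable_pair1 w)).
rewrite fubini_tonelli1// /fubini_F.
rewrite fubini_tonelli1//; last 2 first.
- have h := @measurable_fun_fubini_tonelli_F _ _ _ _ _ levy_sfm _ mFw (fun e => F0 (w, e)).
  exact: h.
- by move=> p; exact: integral_ge0.
rewrite /fubini_F.
have mI : measurable (`[0%R, T]%classic : set R) by exact: measurable_itv.
have mR0 : measurable (R0 : set R) by exact: measurableC.
transitivity (\int[ltime]_(t in `[0%R, T]) \int[ltup]_x \int[levy_sfm]_z
    (cutoff T H (w, (t, x, z)) ^+ 2)%:E)%E; last first.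
  rewrite integral_mkcond; apply: eq_integral => t _.
  rewrite patchE; case: ifPn => // tT; apply/esym/integral0_eq => x _.
  apply: integral0_eq => z _; rewrite /cutoff indicE memNset ?mulr0 ?expr0n//.
  by move=> [_ [[/= tI _] _]]; rewrite notin_setE in tT.
rewrite -ltupE; apply/esym.
rewrite (eq_measure_integral leb) => [|A mA AI].
  apply: eq_integral => t tI; apply: eq_integral => x _.
  rewrite [RHS]integral_mkcond; apply: eq_integral => z _.
  rewrite patchE /cutoff indicE; case: ifPn => zR0.
    rewrite mem_set ?mulr1 ?real_normK ?num_real//.
    by split => //; split; [split => //; rewrite inE in tI|rewrite inE in zR0].
  rewrite memNset ?mulr0 ?expr0n//.
  by move=> [_ [_ /= z0]]; rewrite notin_setE in zR0.
rewrite -[LHS]/(leb (A `&` `[0%R, +oo[%classic)) setIidl//.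
apply: subset_trans AI _ => t /=.
by rewrite !in_itv/= andbT => /andP[].
Qed.

End intensity_measure.

(** * The isometry *)

Section gram.
Context {R : realType}.

(** The norm of a finite sum depends only on the Gram matrix of its terms, so the isometry may be
    checked on pairs. *)
Lemma sqnorm_sum_gram d1 d2 (T1 : measurableType d1) (T2 : measurableType d2)
    (m1 : {measure set T1 -> \bar R}) (m2 : {measure set T2 -> \bar R})
    I (l : seq I) (f : I -> T1 -> R) (g : I -> T2 -> R) :
  (forall i, sqint m1 (f i)) -> (forall i, sqint m2 (g i)) ->
  (forall i j, \int[m1]_x (f i x * f j x) = \int[m2]_x (g i x * g j x)) ->
  sqnorm m1 (fun x => \sum_(i <- l) f i x) = sqnorm m2 (fun x => \sum_(i <- l) g i x).
Proof.
have key d (T : measurableType d) (m : {measure set T -> \bar R}) (h : I -> T -> R) :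
    (forall i, sqint m (h i)) ->
    sqnorm m (fun x => \sum_(i <- l) h i x) =
    (\sum_(i <- l) \sum_(j <- l) \int[m]_x (h i x * h j x))%:E.
  move=> sh; rewrite sqnorm_Rintegral; last exact: sqint_sum.
  have ih i j := sqintM (sh i) (sh j).
  have ih2 i := Rintegral_sum l (ih i).
  rewrite -(eq_bigr _ (fun i _ => (ih2 i).2)) -(Rintegral_sum l (fun i => (ih2 i).1)).2.
  congr EFin; apply: eq_Rintegral => x _; rewrite expr2 big_distrl/=.
  by apply: eq_bigr => i _; rewrite big_distrr.
move=> sf sg fg; rewrite !key//; congr EFin.
by apply: eq_bigr => i _; apply: eq_bigr => j _.
Qed.

Lemma measurable_fun_indic_T d (T : measurableType d) (S : set T) :
  measurable S -> measurable_fun setT (\1_S : T -> R).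
Proof. by move=> mS; exact: measurable_indic. Qed.

Lemma integrable_indic_fin d (T : measurableType d) (m : {measure set T -> \bar R})
    (S : set T) : measurable S -> (m S < +oo)%E ->
  m.-integrable setT (EFin \o \1_S).
Proof.
move=> mS fS; apply/integrableP; split.
  by apply/measurable_EFinP; exact: measurable_fun_indic_T.
by under eq_integral do rewrite /= ger0_norm//; rewrite integral_indic// setIT.
Qed.

Lemma product_measure_setT d1 d2 (T1 : measurableType d1) (T2 : measurableType d2)
    (P : probability T1 R) (m : {sigma_finite_measure set T2 -> \bar R}) (S : set T2) :
  measurable S -> (P \x m)%E (setT `*` S) = m S.
Proof.
move=> mS; rewrite product_measure1E//.
by have -> : (P setT * m S = m S)%E by rewrite probability_setT mul1e.
Qed.

Lemma Rintegral_product_indic d1 d2 (T1 : measurableType d1) (T2 : measurableType d2)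
    (P : probability T1 R) (m : {sigma_finite_measure set T2 -> \bar R})
    (W : T1 -> R) (S : set T2) (M : R) :
  measurable_fun setT W -> (forall w, `|W w| <= M) ->
  measurable S -> (m S < +oo)%E ->
  \int[(P \x m)%E]_q (W q.1 * \1_S q.2) = \int[P]_w W w * fine (m S).
Proof.
move=> mW WM mS mSfin.
have mf : measurable_fun setT (fun q : T1 * T2 => W q.1 * \1_S q.2).
  apply: measurable_funM; first exact: measurableT_comp.
  exact: (measurableT_comp (measurable_fun_indic_T mS) measurable_snd).
have mSf : m S \is a fin_num by rewrite ge0_fin_numE.
have iint : (P \x m)%E.-integrable setT (EFin \o (fun q => W q.1 * \1_S q.2)).
  apply: (@le_integrable _ _ _ _ _ _ _ (EFin \o (fun q => M * \1_(setT `*` S) q))).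
  - exact: measurableT.
  - exact/measurable_EFinP.
  - move=> q _ /=; rewrite lee_fin !normrM; apply: ler_pM => //.
      by apply: le_trans (WM _) _; exact: ler_norm.
    by rewrite !indicE in_setX in_setT.
  - apply: integrableZ_EFin; apply: integrable_indic_fin; first exact: measurableX.
    have h : ((P \x m)%E (setT `*` S) < +oo)%E by rewrite (product_measure_setT P m mS).
    exact: h.
rewrite -[RHS]/(fine (\int[P]_w W w * fine (m S))%:E); congr fine.
rewrite -integral12_prod_meas1// /fubini_F/=.
have iW : P.-integrable setT (EFin \o W) by apply: sqint_integrable; exact: sqint_bounded mW WM.
rewrite EFinM [X in (X * _)%E]fineK; last exact: integrable_fin_num.
rewrite -integralZr//; apply: eq_integral => w _ /=.
under eq_integral do rewrite EFinM.
rewrite integralZl//=; last exact: integrable_indic_fin.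
by rewrite integral_indic// setIT (fineK mSf).
Qed.

End gram.

Section isometry.
Context {R : realType} (d : nat).
Context {dO : measure_display} {Omega : measurableType dO}.
Variables (P : probability Omega R) (nu : {measure set R -> \bar R}).
Hypothesis nu_levy : levy_measure nu.
Variable N : Omega -> {measure set (txz R d) -> \bar R}.
Hypothesis N_poisson : poisson_random_measure P (intensity nu) N.
Local Notation mu := (mu_txz d nu_levy).
Local Notation elementary := (elementary N).
Implicit Types (e : elementary) (s : seq (R * elementary)).

Lemma mu_poisson : poisson_random_measure P mu N.
Proof. by rewrite mu_txzE. Qed.

Lemma NhatE A w : Nhat nu N A w = compensated mu N A w.
Proof. by rewrite /Nhat -(mu_txzE d nu_levy). Qed.

Definition past (t : R) : set (txz R d) := [set q | q.1.1 <= t].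

Lemma filtrationN_region t : filtrationN N t `<=` region_sigma N (past t).
Proof.
apply: smallest_sub; first exact: sigma_family_sigma_algebra.
move=> _ [i [/andP[i0 it] [mA _] [mG _]] [Y mY <-]].
apply: sub_sigma_algebra; exists (`[0, i.1.1] `*` i.1.2 `*` i.2); last by exists Y.
split; first by apply: measurableX => //; apply: measurableX.
by move=> q [[/= + _] _]; rewrite in_itv/= => /andP[_ qi]; exact: le_trans it.
Qed.

Section elementary_facts.
Variables (T : R) (e : elementary).

Definition el_set : set (txz R d) :=
  `]Num.min (el_a e) T, Num.min (el_b e) T] `*` el_A e `*` el_G e.

Lemma el_ge0 : 0 <= el_a e. Proof. by case: e => a b X A G /= /andP[]. Qed.

Lemma el_bounded : exists M : R, forall w, `|el_X e w| <= M.
Proof. by case: e. Qed.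

Lemma el_measurable_wrt : measurable_wrt setT (filtrationN N (el_a e)) (el_X e).
Proof. by case: e. Qed.

Lemma el_borel : bounded_borel_Rd (el_A e). Proof. by case: e. Qed.

Lemma el_away : borel_away_from_0 (el_G e). Proof. by case: e. Qed.

Lemma el_region : measurable_wrt setT (region_sigma N (past (el_a e))) (el_X e).
Proof. exact: measurable_wrtS (@filtrationN_region _) el_measurable_wrt. Qed.

Lemma measurable_el : measurable_fun setT (el_X e).
Proof. exact: measurable_wrt_region mu_poisson _ _ el_region. Qed.

Lemma measurable_el_set : measurable el_set.
Proof.
apply: measurableX; last by case: el_away.
by apply: measurableX => //; case: el_borel.
Qed.

Lemma el_set_fin : (mu el_set < +oo)%E.
Proof.
apply: (@mu_txz_fin _ _ _ _ _ _ _ T) => //; [|exact: el_borel|exact: el_away].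
by move=> t /=; rewrite in_itv/= => /andP[_ /le_trans]; apply; rewrite ge_min lexx orbT.
Qed.

(** The time interval is open on the left, which makes the count over [el_set] independent of the
    weight [el_X], known at time [el_a]. *)
Lemma past_el_set : past (el_a e) `&` el_set = set0.
Proof.
apply/seteqP; split => // -[[t x] z] [/= ta] [[/= + _] _].
rewrite in_itv/= le_min gt_min => /andP[/orP[|] h /andP[_ tT]].
  by move: (lt_le_trans h ta); rewrite ltxx.
by move: (lt_le_trans h tT); rewrite ltxx.
Qed.

Lemma elementary_integralE w :
  elementary_integral nu T e w = el_X e w * compensated mu N el_set w.
Proof. by rewrite /elementary_integral NhatE. Qed.

Lemma elementary_integral_sqint : sqint P (elementary_integral nu T e).
Proof.
rewrite (funext elementary_integralE); have [M eM] := el_bounded.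
apply: sqint_bndM eM _; first exact: measurable_el.
exact: (compensated_sqint mu_poisson measurable_el_set el_set_fin).
Qed.

Lemma away_R0 (G : set R) : borel_away_from_0 G -> G `<=` R0.
Proof.
by move=> [_ [r r0 Gr]] z /Gr rz /= z0; move: rz; rewrite z0 normr0 leNgt r0.
Qed.

Lemma cut_elementary q :
  cutoff T (elementary_process e) q = el_X e q.1 * \1_el_set q.2.
Proof.
case: q => w [[t x] z]; rewrite /cutoff /elementary_process/= -!mulrA; congr (_ * _).
rewrite !indicE -!natrM; congr (_%:R).
rewrite /slab /el_set !in_setX/= !mem_setE !in_setT/= !in_itv/= !andbT.
have [zG|zG] := boolP (z \in el_G e); last by rewrite !andbF !muln0.
have -> : z \in R0 by apply/mem_set/(away_R0 el_away); rewrite inE in zG.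
rewrite !andbT mul1n.
case: (x \in el_A e); rewrite ?andbF ?mul0n ?muln0// mul1n !andbT mulnb; congr (nat_of_bool _).
rewrite !le_min gt_min; have e0 := el_ge0.
have [tT|Tt] := leP t T; rewrite ?andbF ?andbT ?orbF//.
have [at_|] := ltP (el_a e) t; rewrite ?andbF//=.
by rewrite (ltW (le_lt_trans e0 at_)) andbT.
Qed.

Lemma cut_elementary_sqint : sqint (P \x mu)%E (cutoff T (elementary_process e)).
Proof.
rewrite (funext cut_elementary).
have [M eM] := el_bounded; apply: (sqint_bndM (M := M)) => //.
- exact: measurableT_comp measurable_el measurable_fst.
- split.
    exact: (measurableT_comp (measurable_fun_indic_T measurable_el_set) measurable_snd).
  rewrite /sqnorm (_ : (fun x => _) = fun q => (\1_(setT `*` el_set) q)%:E).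
    have ms := measurable_el_set.
    rewrite integral_indic// ?setIT; last exact: measurableX.
    have h : ((P \x mu)%E (setT `*` el_set) < +oo)%E.
      by rewrite (product_measure_setT P mu ms); exact: el_set_fin.
    exact: h.
  apply/funext => q; rewrite !indicE in_setX/= in_setT/=.
  by case: (q.2 \in el_set); rewrite ?expr1n ?expr0n.
Qed.

End elementary_facts.

(** Both weights are known at the later starting time [el_a e']. The part of the first set before
    that time joins the weight and pairs to 0 with the centred count over the second set; the part
    after it gives the intensity of the intersection. *)
Lemma elementary_cov T e e' : el_a e <= el_a e' ->
  \int[P]_w (elementary_integral nu T e w * elementary_integral nu T e' w) =
  \int[P]_w (el_X e w * el_X e' w) * fine (mu (el_set T e `&` el_set T e')).
Proof.
move=> aa'.
set S := el_set T e; set S' := el_set T e'; set X := el_X e; set X' := el_X e'.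
pose D := past (el_a e').
have mD : measurable D.
  rewrite (_ : D = `]-oo, el_a e'] `*` setT `*` setT).
    by apply: measurableX => //; exact: measurableX.
  by apply/seteqP; split => [[[t x] z]|[[t x] z]]; rewrite /D /past/= in_itv/=; [|case=> -[]].
have DX : measurable_wrt setT (region_sigma N D) X.
  apply: (measurable_wrtS _ (@el_region e)); apply: region_sigmaS => q.
  by rewrite /past/= => /le_trans; exact.
have DX' : measurable_wrt setT (region_sigma N D) X' by exact: el_region.
have DS' : D `&` S' = set0 := past_el_set T e'.
have mS := measurable_el_set T e; have mS' := measurable_el_set T e'.
have fS := el_set_fin T e; have fS' := el_set_fin T e'.
pose R1 := S `&` D; pose R2 := S `\` D.
have mR1 : measurable R1 by exact: measurableI.
have mR2 : measurable R2 by exact: measurableD.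
have fR1 : (mu R1 < +oo)%E by rewrite (le_lt_trans _ fS)// le_measure ?inE//; exact: subIsetl.
have fR2 : (mu R2 < +oo)%E by rewrite (le_lt_trans _ fS)// le_measure ?inE//; exact: subDsetl.
have DR2 : D `&` R2 = set0 by rewrite /R2 setDE setIC -setIA setICl setI0.
have [M XM] := el_bounded e; have [M' XM'] := el_bounded e'.
pose W w := X w * X' w.
have DW : measurable_wrt setT (region_sigma N D) W by exact: measurable_wrtM.
have WM w : `|W w| <= M * M' by rewrite normrM ler_pM.
have mW := measurable_wrt_region mu_poisson DW.
have sc A (mA : measurable A) (fA : (mu A < +oo)%E) := compensated_sqint mu_poisson mA fA.
have sW1 := sqint_bndM mW WM (sc _ mR1 fR1).
have i1 := sqintM sW1 (sc _ mS' fS').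
have i2 := sqintM (sqint_bndM mW WM (sc _ mR2 fR2)) (sc _ mS' fS').
transitivity (\int[P]_w (W w * compensated mu N R1 w * compensated mu N S' w +
                         W w * compensated mu N R2 w * compensated mu N S' w)).
  apply: ae_eq_Rintegral.
  - apply: measurable_funM; exact: (proj1 (elementary_integral_sqint T _)).
  - apply/measurable_EFinP; apply: measurable_int.
    exact: (integrableD_EFin i1 i2).
  - have R12 : R1 `&` R2 = set0 by apply/seteqP; split => // q [[_ ?] []].
    have SE : S = R1 `|` R2 by rewrite /R1 /R2 setUIDK.
    have := compensatedU_ae mu_poisson mR1 mR2 R12 fR1 fR2.
    apply: filterS => w; rewrite -SE => h.
    by rewrite !elementary_integralE -/S -/S' h /W /X /X'; ring.
rewrite RintegralD//.
have [_ ->] := region_integral mu_poisson DS'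
  (measurable_wrtM DW (measurable_compensated mR1 (@subIsetr _ S D)))
  (measurable_compensated mS' (@subset_refl _ S'))
  (sqint_integrable sW1) (sqint_integrable (sc _ mS' fS')).
rewrite (compensated_mean mu_poisson mS' fS') mulr0 add0r.
under eq_Rintegral do rewrite -mulrA.
rewrite (compensated_cov mu_poisson mR2 mS' fR2 fS' DR2 DS' DW WM).
congr (_ * fine (mu _)); apply/seteqP; split => q; first by move=> [[]].
move=> [Sq S'q]; split => //; split => // Dq.
by have : (D `&` S') q by []; rewrite DS'.
Qed.

Lemma isometry_pair T e e' :
  \int[P]_w (elementary_integral nu T e w * elementary_integral nu T e' w) =
  \int[(P \x mu)%E]_q (cutoff T (elementary_process e) q * cutoff T (elementary_process e') q).
Proof.
wlog aa' : e e' / el_a e <= el_a e' => [hw|].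
  have [/hw//|/ltW/hw h] := leP (el_a e) (el_a e').
  under eq_Rintegral do rewrite mulrC.
  by rewrite h; apply: eq_Rintegral => q _; rewrite mulrC.
rewrite (elementary_cov T aa').
have [M XM] := el_bounded e; have [M' XM'] := el_bounded e'.
rewrite -(@Rintegral_product_indic _ _ _ _ _ _ _ (fun w => el_X e w * el_X e' w) _ (M * M')).
- apply: eq_Rintegral => q _; rewrite !cut_elementary indicI/=; ring.
- by apply: measurable_funM; exact: measurable_el.
- by move=> w; rewrite normrM ler_pM.
- by apply: measurableI; exact: measurable_el_set.
- apply: (le_lt_trans _ (el_set_fin T e)); apply: le_measure; rewrite ?inE; first last.
  + exact: subIsetl.
  + exact: measurable_el_set.
  + by apply: measurableI; exact: measurable_el_set.
Qed.

Lemma simple_integral_sqint T s : sqint P (simple_integral nu T s).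
Proof.
apply: sqint_sum => -[c e]; apply: sqintZ; exact: elementary_integral_sqint.
Qed.

Lemma cut_simpleE T s q : cutoff T (simple_process s) q =
  \sum_(ce <- s) ce.1 * cutoff T (elementary_process ce.2) q.
Proof.
by rewrite /cutoff /simple_process big_distrl/=; apply: eq_bigr => ce _; rewrite mulrA.
Qed.

Lemma cut_simple_sqint T s : sqint (P \x mu)%E (cutoff T (simple_process s)).
Proof.
rewrite (funext (cut_simpleE T s)).
apply: sqint_sum => -[c e]; apply: sqintZ; exact: cut_elementary_sqint.
Qed.

Lemma simple_isometry T s :
  sqnorm P (simple_integral nu T s) = sqnorm (P \x mu)%E (cutoff T (simple_process s)).
Proof.
rewrite (funext (cut_simpleE T s)); apply: sqnorm_sum_gram => [[c e]|[c e]|[c e] [c' e']].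
- by apply: sqintZ; exact: elementary_integral_sqint.
- by apply: sqintZ; exact: cut_elementary_sqint.
- transitivity (c * c' * \int[P]_w (elementary_integral nu T e w * elementary_integral nu T e' w)).
    rewrite -RintegralZl//=; last first.
      exact: (sqintM (elementary_integral_sqint T e) (elementary_integral_sqint T e')).
    by apply: eq_Rintegral => w _; rewrite /=; ring.
  rewrite isometry_pair -RintegralZl//=; last first.
    exact: (sqintM (cut_elementary_sqint T e) (cut_elementary_sqint T e')).
  by apply: eq_Rintegral => w _; rewrite /=; ring.
Qed.

Definition lin_comb (a : R) s s' : seq (R * elementary) :=
  [seq (a * ce.1, ce.2) | ce <- s] ++ s'.

Lemma simple_process_lin a s s' q : simple_process (lin_comb a s s') q =
  a * simple_process s q + simple_process s' q.
Proof.
rewrite /simple_process /lin_comb big_cat big_map/= big_distrr/=; congr (_ + _).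
by apply: eq_bigr => ce _; rewrite mulrA.
Qed.

Lemma simple_integral_lin T a s s' w : simple_integral nu T (lin_comb a s s') w =
  a * simple_integral nu T s w + simple_integral nu T s' w.
Proof.
rewrite /simple_integral /lin_comb big_cat big_map/= big_distrr/=; congr (_ + _).
by apply: eq_bigr => ce _; rewrite mulrA.
Qed.

Lemma simple_isometryB T s s' :
  sqnorm P (fun w => simple_integral nu T s w - simple_integral nu T s' w) =
  sqnorm (P \x mu)%E (fun q => cutoff T (simple_process s) q - cutoff T (simple_process s') q).
Proof.
have := simple_isometry T (lin_comb (-1) s' s).
rewrite (_ : simple_integral _ _ _ = fun w => simple_integral nu T s w - simple_integral nu T s' w).
  by move=> ->; congr sqnorm; apply/funext => q; rewrite /cutoff simple_process_lin; ring.
by apply/funext => w; rewrite simple_integral_lin; ring.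
Qed.

Lemma simple_integral_mean T s : \int[P]_w simple_integral nu T s w = 0.
Proof.
have ii (ce : R * elementary) :
    P.-integrable setT (EFin \o (fun w => ce.1 * elementary_integral nu T ce.2 w)).
  by apply: integrableZ_EFin; exact: sqint_integrable (elementary_integral_sqint T ce.2).
rewrite /simple_integral (Rintegral_sum s ii).2.
apply: big1 => -[c e] _ /=.
  rewrite RintegralZl//=; last exact: sqint_integrable (elementary_integral_sqint T e).
  rewrite (funext (elementary_integralE T e)).
have De := past_el_set T e.
have mS := measurable_el_set T e; have fS := el_set_fin T e; have [M XM] := el_bounded e.
  have [_ ->] := region_integral mu_poisson De (@el_region e)
    (measurable_compensated mS (@subset_refl _ _))
    (sqint_integrable (sqint_bounded P (measurable_el e) XM))
    (sqint_integrable (compensated_sqint mu_poisson mS fS)).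
  by rewrite (compensated_mean mu_poisson mS fS) !mulr0.
Qed.

End isometry.

(** * The predictable sigma-field *)

Section predictable_sigma_field.
Context {R : realType} (d : nat).
Context {dO : measure_display} {Omega : measurableType dO}.
Variables (P : probability Omega R) (nu : {measure set R -> \bar R}).
Hypothesis nu_levy : levy_measure nu.
Variable N : Omega -> {measure set (txz R d) -> \bar R}.
Hypothesis N_poisson : poisson_random_measure P (intensity nu) N.
Local Notation mu := (mu_txz d nu_levy).
Local Notation elementary := (elementary N).
Local Notation pred_sigma := (@predictable_sigma _ Omega R d N).
Local Notation slab := (@slab dO Omega R d).
Implicit Types (e : elementary) (s : seq (R * elementary)).

Lemma predictable_sigma_algebra : sigma_algebra (slab `[0, +oo[) pred_sigma.
Proof. exact: smallest_sigma_algebra. Qed.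

Lemma slabS (T : R) : slab `[0, T] `<=` slab `[0, +oo[.
Proof.
move=> q [? [[/= + ?] ?]]; rewrite in_itv/= => /andP[t0 _].
by split => //; split => //; split => //=; rewrite in_itv/= t0.
Qed.

Lemma predictable_sigma_measurable : pred_sigma `<=` measurable.
Proof.
apply: smallest_sub.
  split => [|A mA|A mA]; first exact: measurable0.
    by apply: measurableD => //; exact: measurable_slab.
  exact: bigcupT_measurable.
move=> _ [s _ [Y mY <-]].
(* Measurability is available for cutoffs at finite horizons, so the half-line of times is exhausted
   by [[0, n]]. *)
rewrite (_ : _ `&` _ = \bigcup_n (slab `[0, n%:R] `&` cutoff n%:R (simple_process s) @^-1` Y)).
  apply: bigcupT_measurable => n; apply: measurableI; first exact: measurable_slab.
  rewrite -[X in measurable X]setTI.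
  by have [mc _] := cut_simple_sqint nu_levy N_poisson n%:R s; exact: mc.
apply/seteqP; split => q.
  move=> [[_ [[/= + ?] ?]] Yq]; rewrite in_itv/= andbT => t0.
  have sq : slab `[0, (Num.bound q.2.1.1)%:R] q.
    split => //; split => //; split => //=.
    by rewrite in_itv/= t0 ltW// archi_boundP.
  by exists (Num.bound q.2.1.1) => //; split => //; rewrite /= /cutoff indicE mem_set// mulr1.
move=> [n _ [sq]]; rewrite /= /cutoff indicE mem_set// mulr1 => Yq.
by split => //; exact: slabS sq.
Qed.

Lemma predictable_rectangle (a b : R) (A : set (d.-tuple R)) (G : set R) :
  0 <= a < b -> bounded_borel_Rd A -> borel_away_from_0 G ->
  pred_sigma (setT `*` (`]a, b] `*` A `*` G)).
Proof.
move=> ab bA aG.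
have F1 : measurable_wrt setT (filtrationN N a) (fun=> 1 : R).
  apply/measurable_wrtP; first exact: smallest_sigma_algebra.
  exact: measurable_cst.
have b1 : exists M : R, forall w : Omega, `|1 : R| <= M.
  by exists 1 => _; rewrite normr1.
pose e := @Elementary _ _ _ _ N a b (fun=> 1) A G ab b1 F1 bA aG.
apply: sub_sigma_algebra; exists [:: (1, e)] => //; exists [set 1] => //.
have [a0 _] := andP ab.
apply/seteqP; split => -[w [[t x] z]]; rewrite /preimage/= /simple_process big_seq1 mul1r /=.
  move=> [[_ [[_ _] zR0]]]; rewrite mul1r !indicE.
  have [/set_mem tab|_] := boolP (t \in _); last by rewrite !mul0r => /eqP; rewrite eq_sym oner_eq0.
  have [/set_mem xA|_] := boolP (x \in _); last by rewrite mulr0 mul0r => /eqP; rewrite eq_sym oner_eq0.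
  have [/set_mem zG|_] := boolP (z \in _); last by rewrite mulr0 => /eqP; rewrite eq_sym oner_eq0.
  by [].
move=> [_ [[tab xA] zG]]; split.
  split => //; split; last exact: away_R0 aG _ zG.
  split => //; move: tab; rewrite /= !in_itv/= andbT => /andP[at_ _].
  by rewrite (le_trans a0)// ltW.
by rewrite !indicE !mem_set// !mulr1.
Qed.

Lemma predictable_sigmaU A B : pred_sigma A -> pred_sigma B -> pred_sigma (A `|` B).
Proof.
have [p0 _ pU] := predictable_sigma_algebra.
by move=> pA pB; rewrite -bigcup2E; apply: (pU) => -[|[|i]].
Qed.

Lemma predictable_sigmaI A B : A `<=` slab `[0, +oo[ ->
  pred_sigma A -> pred_sigma B -> pred_sigma (A `&` B).
Proof.
have [_ pD _] := predictable_sigma_algebra.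
move=> sA pA pB.
rewrite (_ : A `&` B = slab `[0, +oo[ `\` ((slab `[0, +oo[ `\` A) `|` (slab `[0, +oo[ `\` B))).
  by apply: (pD); apply: predictable_sigmaU; exact: pD.
by rewrite setDUr !setDD setIACA setIid [RHS]setIA (setIidr sA).
Qed.

(** Rectangles over []a, b]] with [a >= 0] never meet time 0, so the slab is reached as the
    complement of the times after [T], which countably many rectangles cover. *)
Lemma predictable_slab (T : R) : 0 <= T -> pred_sigma (slab `[0, T]).
Proof.
move=> T0.
pose Q i j k : set (Omega * txz R d) :=
  setT `*` (`]T, T + i.+1%:R] `*` box d j%:R `*` annulus k).
have [_ pD pU] := predictable_sigma_algebra.
have -> : slab `[0, T] = slab `[0, +oo[ `\` \bigcup_i \bigcup_j \bigcup_k Q i j k.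
  apply/seteqP; split => -[w [[t x] z]].
    move=> [_ [[/= + _] zR]]; rewrite in_itv/= => /andP[t0 tT]; split.
      by split => //; split => //; split => //=; rewrite in_itv/= t0.
    move=> [i _ [j _ [k _ [_ [[/= + _] _]]]]]; rewrite in_itv/= => /andP[Tt _].
    by move: (le_lt_trans tT Tt); rewrite ltxx.
  move=> [[_ [[/= + _] zR]]]; rewrite !in_itv/= andbT => t0 nU.
  split => //; split => //; split => //=; rewrite in_itv/= t0/=.
  have [//|Tt] := leP t T; exfalso; apply: nU.
  exists (Num.bound (t - T)) => //.
  have [j _ jx] : (\bigcup_k box d k%:R) x by rewrite bigcup_box.
  have [k _ kz] : (\bigcup_k annulus k) z by rewrite bigcup_annulus.
  exists j => //; exists k => //; split => //; split => //; split => //=.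
  rewrite in_itv/= Tt/= -lerBlDl -natr1 ler_wpDr//.
  by apply/ltW/archi_boundP; rewrite subr_ge0 ltW.
apply: (pD); apply: (pU) => i; apply: (pU) => j; apply: (pU) => k.
apply: predictable_rectangle.
- by rewrite T0/= ltrDl ltr0n.
- by split; [exact: measurable_box|exists j%:R => x jx].
- exact: annulus_away.
Qed.

(** [predictable_sigma] lives on a slab, while completeness is stated for sigma-fields on a whole
    space: these are the measurable sets whose trace on the slab is predictable. *)
Definition predictable_cutoff (T : R) : set (set (Omega * txz R d)) :=
  [set A | measurable A /\ pred_sigma (A `&` slab `[0, T])].

Lemma predictable_cutoff_sigma_algebra (T : R) : 0 <= T ->
  sigma_algebra setT (predictable_cutoff T).
Proof.
move=> T0; have [p0 pD pU] := predictable_sigma_algebra; split.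
- by split; [exact: measurable0|rewrite set0I].
- move=> A [mA pA]; split; first by rewrite setTD; exact: measurableC.
  have -> : (setT `\` A) `&` slab `[0, T] =
    slab `[0, +oo[ `\` ((slab `[0, +oo[ `\` slab `[0, T]) `|` (A `&` slab `[0, T])).
    apply/seteqP; split => q.
      move=> [[_ nA] sq]; split; first exact: slabS sq.
      by move=> [[_]|[]].
    move=> [sq nq].
    have sTq : slab `[0, T] q by apply: contrapT => nsq; apply: nq; left.
    by split => //; split => // Aq; apply: nq; right.
  apply: (pD); apply: predictable_sigmaU => //.
  by apply: (pD); exact: predictable_slab.
- move=> A AG; split; first by apply: bigcupT_measurable => i; case: (AG i).
  by rewrite setI_bigcupl; apply: (pU) => i; case: (AG i).
Qed.

Lemma predictable_cutoff_simple T s : 0 <= T ->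
  measurable_wrt setT (predictable_cutoff T) (cutoff T (simple_process s)).
Proof.
move=> T0 _ [Y mY <-]; rewrite setTI; split.
  rewrite -[X in measurable X]setTI.
  by have [+ _] := cut_simple_sqint nu_levy N_poisson T s; apply.
have -> : cutoff T (simple_process s) @^-1` Y `&` slab `[0, T] =
    (slab `[0, +oo[ `&` simple_process s @^-1` Y) `&` slab `[0, T].
  apply/seteqP; split => q [] /= + sq; rewrite /cutoff indicE mem_set// mulr1.
    by move=> ?; split => //; split => //; exact: slabS sq.
  by move=> [].
apply: predictable_sigmaI; [exact: subIsetl| |exact: predictable_slab].
by apply: sub_sigma_algebra; exists s => //; exists Y.
Qed.

Lemma predictable_cutoffP T H : measurable_wrt setT (predictable_cutoff T) H ->
  predictable N T H.
Proof.
move=> mH _ [Y mY <-].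
have [_] : predictable_cutoff T (setT `&` H @^-1` Y) by apply: mH; exists Y.
by rewrite setTI setIC.
Qed.

Lemma measurable_cutoff_predictable T H : predictable N T H ->
  measurable_fun setT (cutoff T H).
Proof.
move=> pH _ Y mY; rewrite setTI.
have -> : cutoff T H @^-1` Y = (slab `[0, T] `&` H @^-1` Y) `|`
    (~` slab `[0, T] `&` (fun=> 0) @^-1` Y).
  apply/seteqP; split => q; rewrite /cutoff/= indicE.
    by case: (boolP (q \in slab _)) => [/set_mem|/negP]; rewrite ?mulr1 ?mulr0 => sq;
      [left|right; split => //; rewrite inE in sq].
  move=> [[sq]|[nsq]]; first by rewrite mem_set ?mulr1.
  by rewrite memNset ?mulr0.
apply: measurableU.
  by apply: predictable_sigma_measurable; apply: pH; exists Y.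
apply: measurableI; first by apply: measurableC; exact: measurable_slab.
rewrite -[X in measurable X]setTI.
exact: (@measurable_cst _ _ _ _ setT (0:R)).
Qed.

End predictable_sigma_field.

(** * Approximable variables *)

Section extended_limits.
Context {R : realType}.

Lemma cvg0_ereal (u : nat -> \bar R) : (forall n, (0 <= u n)%E) ->
  u n @[n --> \oo] --> 0%E <->
  (forall e : R, 0 < e -> exists N, forall n, (N <= n)%N -> (u n <= e%:E)%E).
Proof.
move=> u0; split => [/fine_cvgP[uf ucv] e e0|h].
  have [N1 _ h1] := uf.
  have /cvgrPdist_lt/(_ e e0)[N2 _ h2] := ucv.
  exists (maxn N1 N2) => n; rewrite geq_max => /andP[/h1 /= fn /h2 /= ne].
  by rewrite -(fineK fn) lee_fin ltW// ltr_normlW// -normrN -sub0r.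
apply/fine_cvgP; split.
  have [N hN] := h 1 ltr01; exists N => // n /= Nn.
  by rewrite ge0_fin_numE//; exact: le_lt_trans (hN _ Nn) (ltry _).
apply/cvgrPdist_le => e e0; have [N hN] := h e e0; exists N => // n /= Nn.
rewrite sub0r normrN ger0_norm ?fine_ge0//.
by rewrite -lee_fin fineK ?hN// ge0_fin_numE//; exact: le_lt_trans (hN _ Nn) (ltry _).
Qed.

(** Matches the factors 2 of [sqnorm_triangle]. *)
Lemma lee_quarters (x y : \bar R) (e : R) : (x <= (e / 4)%:E)%E ->
  (y <= (e / 4)%:E)%E -> (2%:E * x + 2%:E * y <= e%:E)%E.
Proof.
move=> xe ye; rewrite (_ : e%:E = 2%:E * (e / 4)%:E + 2%:E * (e / 4)%:E)%E.
  by rewrite leeD// lee_wpmul2l.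
by rewrite -!EFinM -EFinD; congr EFin; field.
Qed.

Lemma sqnormZ d (U : measurableType d) (m : {measure set U -> \bar R}) (a : R) f :
  measurable_fun setT f ->
  sqnorm m (fun x => a * f x) = ((a ^+ 2)%:E * sqnorm m f)%E.
Proof.
move=> mf; rewrite /sqnorm; under eq_integral do rewrite exprMn EFinM.
rewrite ge0_integralZl_EFin ?sqr_ge0//; first by move=> x _; rewrite lee_fin sqr_ge0.
exact: measurable_EFin_sqr.
Qed.

End extended_limits.

Section dominated_square.
Context {R : realType} {dO : measure_display} {Omega : measurableType dO}.
Variable P : probability Omega R.

Lemma sqnorm_dominated_cvg (f : nat -> Omega -> R) (h F : Omega -> R) :
  (forall n, measurable_fun setT (f n)) -> sqint P h ->
  (forall n w, `|f n w| <= h w) ->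
  (forall w, f n w @[n --> \oo] --> F w) ->
  measurable_fun setT F /\ forall e : R, 0 < e ->
    exists n, (sqnorm P (fun w => F w - f n w)%R <= e%:E)%E.
Proof.
move=> mf sh fh cF.
have mF : measurable_fun setT F.
  by apply: (measurable_fun_cvg (h := f)) => // w _; exact: cF.
split => // e e0.
have Fh w : `|F w| <= h w by exact: cvg_norm_le (cF w) (fh ^~ w).
have [_ _ cv] : [/\ P.-integrable setT (cst 0%E : Omega -> \bar R),
    [sequence \int[P]_x (`|((F x - f n x) ^+ 2)%:E - 0|)]_n @ \oo --> 0 &
    [sequence \int[P]_x ((F x - f n x) ^+ 2)%:E]_n @ \oo --> \int[P]_x (0 : \bar R)]%E.
  (* The limit is bounded by [h] too, so [4 h^2] dominates the squared differences. *)
  apply: (@dominated_convergence _ _ _ P setT measurableT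
    (fun n x => ((F x - f n x) ^+ 2)%:E) (cst 0%E) (EFin \o (fun x => 4 * (h x ^+ 2)))).
  - by move=> n; apply: measurable_EFin_sqr; exact: measurable_funB.
  - exact: measurable_cst.
  - apply: aeW => w _; apply: cvg_EFin; first exact: nearW.
    rewrite (_ : 0 = (F w - F w) ^+ 2); last by rewrite subrr expr0n.
    by apply: cvgM; apply: cvgB; [exact: cvg_cst|exact: cF|exact: cvg_cst|exact: cF].
  - by apply: integrableZ_EFin; exact: sqint_integrable2.
  - apply: aeW => w n _ /=; rewrite lee_fin ger0_norm ?sqr_ge0//.
    rewrite -real_normK ?num_real// (_ : 4 * _ = (h w + h w) ^+ 2); last by ring.
    have h0 := le_trans (normr_ge0 _) (Fh w).
    rewrite lerXn2r ?nnegrE ?addr_ge0//.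
    by apply: le_trans (ler_normB _ _) _; exact: lerD.
have {}cv : (fun n => sqnorm P (fun w => F w - f n w)) @ \oo --> 0%E.
  by move: cv; rewrite integral0.
have [u _] := cvg0_ereal (fun n => sqnorm_ge0 P (fun w => F w - f n w)).
by have [n0 hn] := u cv e e0; exists n0; exact: hn.
Qed.

End dominated_square.

Section approximable.
Context {R : realType} (d : nat).
Context {dO : measure_display} {Omega : measurableType dO}.
Variables (P : probability Omega R) (nu : {measure set R -> \bar R}).
Hypothesis nu_levy : levy_measure nu.
Variable N : Omega -> {measure set (txz R d) -> \bar R}.
Hypothesis N_poisson : poisson_random_measure P (intensity nu) N.
Variables (T : R) (T0 : 0 <= T).
Local Notation mu := (mu_txz d nu_levy).
Local Notation elementary := (elementary N).
Local Notation I_T := (simple_integral nu T).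
Implicit Types (s : seq (R * elementary)) (F G J : Omega -> R).

Lemma measurable_simple_integral s : measurable_fun setT (I_T s).
Proof. by have [] := simple_integral_sqint nu_levy N_poisson T s. Qed.

(** Being defined by approximation and not by an integrand, this class is stable under [L^2] limits
    before any completeness is used. *)
Definition approximable F : Prop := measurable_fun setT F /\
  forall e : R, 0 < e -> exists c : R, exists s : seq (R * elementary),
    (sqnorm P (fun w => F w - (c + I_T s w))%R <= e%:E)%E.

Let mcI (c : R) s : measurable_fun setT (fun w => c + I_T s w).
Proof. by apply: measurable_funD => //; exact: measurable_simple_integral. Qed.

Let scI (c : R) s : sqint P (fun w => c + I_T s w).
Proof. by apply: sqintD; [exact: sqint_cst|exact: simple_integral_sqint]. Qed.

Lemma sqint_of_sqnormB F G : measurable_fun setT F -> sqint P G ->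
  (sqnorm P (fun w => F w - G w)%R < +oo)%E -> sqint P F.
Proof.
move=> mF sG FG; rewrite (_ : F = fun w => (F w - G w) + G w).
  by apply: sqintD => //; split => //; apply: measurable_funB => //; case: sG.
by apply/funext => w; rewrite subrK.
Qed.

Lemma approximable_sqint F : approximable F -> sqint P F.
Proof.
move=> [mF /(_ 1 ltr01) [c [s h]]]; apply: (sqint_of_sqnormB mF (scI c s)).
exact: le_lt_trans h (ltry _).
Qed.

Lemma approximable_lim F : measurable_fun setT F ->
  (forall e : R, 0 < e -> exists2 G, approximable G &
    (sqnorm P (fun w => F w - G w)%R <= e%:E)%E) -> approximable F.
Proof.
move=> mF h; split => // e e0; have e4 : 0 < e / 4 by rewrite divr_gt0.
have [G [mG aG] FG] := h _ e4; have [c [s Gs]] := aG _ e4; exists c, s.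
apply: (le_trans (sqnorm_triangle P mF mG (mcI c s))).
exact: lee_quarters.
Qed.

Lemma approximableDZ (a : R) F G : approximable F -> approximable G ->
  approximable (fun w => a * F w + G w).
Proof.
move=> [mF aF] [mG aG]; have maF : measurable_fun setT (fun w => a * F w) by exact: measurable_funM.
split; first exact: measurable_funD.
(* Then [2 a^2 (e / k) <= e / 2]; the added 1 keeps [k] positive when [a = 0]. *)
move=> e e0; pose k := 4 * (a ^+ 2 + 1).
have k0 : 0 < k by rewrite mulr_gt0// ltr_pwDr// sqr_ge0.
have [c [s Fs]] := aF (e / k) (divr_gt0 e0 k0).
have [c' [s' Gs]] := aG (e / 4) (divr_gt0 e0 (ltr0n _ 4)).
exists (a * c + c'), (lin_comb a s s').
rewrite (_ : (fun w => _) = fun w => a * (F w - (c + I_T s w)) + (G w - (c' + I_T s' w))); last first.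
  by apply/funext => w; rewrite simple_integral_lin; ring.
apply: (le_trans (sqnormD _ _ _)).
- by apply: measurable_funM => //; exact: measurable_funB.
- exact: measurable_funB.
rewrite sqnormZ; last exact: measurable_funB.
apply: (@le_trans _ _ (2%:E * ((a ^+ 2)%:E * (e / k)%:E) + 2%:E * (e / 4)%:E)%E).
  by rewrite leeD// ?lee_wpmul2l// lee_fin sqr_ge0.
rewrite -!EFinM -EFinD lee_fin.
have : a ^+ 2 * (e / k) <= e / 4.
  rewrite mulrA ler_pdivrMr// (_ : e / 4 * k = a ^+ 2 * e + e) ?lerDl ?(ltW e0)//.
  by rewrite /k; field.
by lra.
Qed.

Lemma approximable_cst (c : R) : approximable (fun=> c).
Proof.
split => // e e0; exists c, [::].
rewrite (_ : (fun w => _) = fun=> 0); last first.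
  by apply/funext => w; rewrite /simple_integral big_nil addr0 subrr.
by rewrite /sqnorm; under eq_integral do rewrite expr0n/=; rewrite integral0 lee_fin ltW.
Qed.

Lemma approximable_bmc : bounded_monotone_class approximable.
Proof.
split; [exact: approximable_cst|exact: approximableDZ|].
move=> f M g fa fM fg.
have [mg h] := sqnorm_dominated_cvg (fun n => (fa n).1) (sqint_cst P M) fM fg.
by apply: approximable_lim => // e e0; have [n hn] := h e e0; exists (f n).
Qed.

Lemma approximable_ae F G : measurable_fun setT G -> approximable F ->
  {ae P, forall w, F w = G w} -> approximable G.
Proof.
move=> mG aF FG; apply: approximable_lim => // e e0; exists F => //.
rewrite (@ae_eq_sqnorm _ _ _ P _ (fun=> 0)) => [||//|].
- by rewrite /sqnorm; under eq_integral do rewrite expr0n/=; rewrite integral0 lee_fin ltW.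
- by apply: measurable_funB => //; case: aF.
- by apply: filterS FG => w ->; rewrite subrr.
Qed.

Lemma energy_cutoff s H : measurable_fun setT (cutoff T H) ->
  energy P nu T (fun q => simple_process s q - H q) =
  sqnorm (P \x mu)%E (fun q => cutoff T (simple_process s) q - cutoff T H q).
Proof.
move=> mH.
have E : cutoff T (fun q => simple_process s q - H q) =
    fun q => cutoff T (simple_process s) q - cutoff T H q.
  by apply/funext => q; rewrite /cutoff mulrBl.
rewrite (energyE nu_levy) E//.
by apply: measurable_funB => //; case: (cut_simple_sqint nu_levy N_poisson T s).
Qed.

Lemma expectation_sqr (f : Omega -> R) :
  'E_P[fun w => (`|f w| ^+ 2)%R]%E = sqnorm P f.
Proof.
rewrite unlock /sqnorm; apply: eq_integral => w _.
by rewrite real_normK// num_real.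
Qed.

(** Completeness is applied over [predictable_cutoff], so the limit of the integrands is itself
    predictable and not only almost everywhere equal to a predictable process. *)
Lemma approximable_representation F : approximable F ->
  exists psi, [/\ predictable N T psi, (energy P nu T psi < +oo)%E &
    is_stoch_integral P nu N T psi (fun w => F w - \int[P]_w F w)].
Proof.
move=> aF; have sF := approximable_sqint aF; have [mF aF'] := aF.
pose J w := F w - \int[P]_w F w.
have sJ : sqint P J by apply: sqintB => //; exact: sqint_cst.
have mJ : measurable_fun setT J by case: sJ.
(* Simple integrals are centred, so [(E F - c)^2] is at most the squared error; exchanging [c] for
   [E F] costs the factor [4 = 2 + 2]. *)
have app n : exists s, (sqnorm P (fun w => J w - I_T s w)%R <= (4 * n.+1%:R^-1)%:E)%E.
  have n0 : (0 : R) < n.+1%:R^-1 by rewrite invr_gt0.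
  have [c [s Fs]] := aF' _ n0; exists s.
  have sd : sqint P (fun w => F w - (c + I_T s w)) by exact: sqintB.
  have mean : \int[P]_w (F w - (c + I_T s w)) = \int[P]_w F w - c.
    rewrite RintegralB//; [|exact: sqint_integrable|exact: sqint_integrable].
    rewrite RintegralD//; [|exact: sqint_integrable (sqint_cst P c)|
      exact: sqint_integrable (simple_integral_sqint nu_levy N_poisson T s)].
    by rewrite Rintegral_probability_cst (simple_integral_mean nu_levy N_poisson) addr0.
  have := sqr_Rintegral_le sd; rewrite mean => cb.
  rewrite (_ : (fun w => _) = fun w => (F w - (c + I_T s w)) + (c - \int[P]_w F w)); last first.
    by apply/funext => w; rewrite /J; ring.
  apply: (le_trans (sqnormD _ (proj1 sd) _)) => //.
  have -> : sqnorm P (fun=> c - \int[P]_w F w) = ((\int[P]_w F w - c) ^+ 2)%:E.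
    rewrite sqnorm_Rintegral; last exact: sqint_cst.
    by rewrite Rintegral_probability_cst -sqrrN opprB.
  have cb' := le_trans cb Fs.
  have q4 : 4 / n.+1%:R / 4 = n.+1%:R^-1 :> R by rewrite mulrC mulKf ?pnatr_eq0.
  by apply: lee_quarters; rewrite q4.
have [s sP] := choice app.
have small (e : R) : 0 < e -> exists n0, forall n, (n0 <= n)%N ->
    (sqnorm P (fun w => J w - I_T (s n) w)%R <= e%:E)%E.
  move=> e0; exists (Num.bound (4 / e)) => n hn; apply: le_trans (sP n) _.
  have en : 4 / e <= n.+1%:R.
    apply: (@le_trans _ _ (Num.bound (4 / e))%:R); last by rewrite ler_nat leqW.
    by apply/ltW/archi_boundP; rewrite divr_ge0// ltW.
  by rewrite lee_fin ler_pdivrMr ?ltr0n// mulrC -ler_pdivrMr.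
have Icauchy (e : R) : 0 < e -> exists n0, forall i j, (n0 <= i)%N -> (n0 <= j)%N ->
    (sqnorm P (fun w => I_T (s i) w - I_T (s j) w)%R <= e%:E)%E.
  move=> e0; have e4 : 0 < e / 4 by rewrite divr_gt0.
  have [n0 hn] := small _ e4; exists n0 => i j hi hj.
  apply: (le_trans (sqnorm_triangle P (measurable_simple_integral _) mJ (measurable_simple_integral _))).
  by apply: lee_quarters; [rewrite sqnormB_sym hn|exact: hn].
have [g gG gs] : exists2 g : Omega * txz R d -> R, measurable_wrt setT (predictable_cutoff N T) g &
    forall e : R, 0 < e -> exists n0, forall n, (n0 <= n)%N ->
    (sqnorm (P \x mu)%E (fun q => cutoff T (simple_process (s n)) q - g q)%R <= e%:E)%E.
  apply: sqnorm_complete.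
  - exact: (predictable_cutoff_sigma_algebra N T0).
  - by move=> A [].
  - by move=> n; exact: (predictable_cutoff_simple nu_levy N_poisson).
  - move=> e e0; have [n0 hn] := Icauchy e e0; exists n0 => i j hi hj.
    by rewrite -(simple_isometryB nu_levy N_poisson); exact: hn.
have pg : predictable N T g by exact: predictable_cutoffP.
have mg := measurable_cutoff_predictable nu_levy N_poisson pg.
have mg0 : measurable_fun setT g by apply: measurable_wrt_fun gG; move=> A [].
have mdiff n : measurable_fun setT (fun q => cutoff T (simple_process (s n)) q - g q).
  by apply: measurable_funB => //; case: (cut_simple_sqint nu_levy N_poisson T (s n)).
(* [g] may be nonzero off the slab; cutting it off only decreases the distance. *)
have en n : (energy P nu T (fun q => simple_process (s n) q - g q)%R <=
    sqnorm (P \x mu)%E (fun q => cutoff T (simple_process (s n)) q - g q)%R)%E.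
  rewrite energy_cutoff//; apply: ge0_le_integral => //.
  - by move=> q _; rewrite lee_fin sqr_ge0.
  - apply: measurable_EFin_sqr; apply: measurable_funB => //.
    by case: (cut_simple_sqint nu_levy N_poisson T (s n)).
  - exact: measurable_EFin_sqr.
  - move=> q _; rewrite lee_fin /cutoff indicE.
    by case: (_ \in _); rewrite ?mulr1// !mulr0 subrr expr0n/= sqr_ge0.
exists g; split => //.
- rewrite (energyE nu_levy)//.
  have [n0 hn] := gs 1 ltr01.
  have sg : sqint (P \x mu)%E (cutoff T g).
    have s1 := cut_simple_sqint nu_levy N_poisson T (s n0).
    rewrite (_ : cutoff T g = fun q => cutoff T (simple_process (s n0)) q -
       (cutoff T (simple_process (s n0)) q - cutoff T g q)).
      apply: sqintB => //; split; first by apply: measurable_funB => //; case: s1.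
      have := le_trans (en n0) (hn n0 (leqnn _)).
      by rewrite energy_cutoff// => h; exact: le_lt_trans h (ltry _).
    by apply/funext => q; ring.
  by case: sg.
- split => //; exists s; split.
    apply/cvg0_ereal => [n|e e0].
      by rewrite energy_cutoff// sqnorm_ge0.
    have [n0 hn] := gs e e0; exists n0 => n nn.
    exact: le_trans (en n) (hn n nn).
  apply/cvg0_ereal => [n|e e0]; first by rewrite expectation_sqr sqnorm_ge0.
  have [n0 hn] := small e e0; exists n0 => n nn.
  by rewrite expectation_sqr sqnormB_sym; exact: hn.
Qed.

Lemma stoch_integral_approx H J (e : R) : measurable_fun setT (cutoff T H) ->
  is_stoch_integral P nu N T H J -> 0 < e ->
  exists s : seq (R * elementary),
    (sqnorm (P \x mu)%E (fun q => cutoff T (simple_process s) q - cutoff T H q)%R <= e%:E)%E /\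
    (sqnorm P (fun w => I_T s w - J w)%R <= e%:E)%E.
Proof.
move=> mH [_ [s [sH sJ]]] e0.
have [|h1 _] := @cvg0_ereal R (fun n => energy P nu T (fun q => simple_process (s n) q - H q)).
  by move=> n; rewrite energy_cutoff// sqnorm_ge0.
have [|h2 _] := @cvg0_ereal R (fun n => 'E_P[fun w => (`|I_T (s n) w - J w| ^+ 2)%R]%E).
  by move=> n; rewrite expectation_sqr sqnorm_ge0.
have [[n1 {}h1] [n2 {}h2]] := (h1 sH e e0, h2 sJ e e0).
exists (s (maxn n1 n2)); split; first by rewrite -energy_cutoff// h1// leq_maxl.
by rewrite -expectation_sqr h2// leq_maxr.
Qed.

Lemma stoch_integral_unique H H' J J' :
  measurable_fun setT (cutoff T H) -> measurable_fun setT (cutoff T H') ->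
  is_stoch_integral P nu N T H J -> is_stoch_integral P nu N T H' J' ->
  {ae P, forall w, J w = J' w} ->
  {ae (P \x mu)%E, forall q, cutoff T H q = cutoff T H' q}.
Proof.
move=> mH mH' iJ iJ' JJ'; have [[mJ _] [mJ' _]] := (iJ, iJ').
have mI := measurable_simple_integral.
have mc s0 : measurable_fun setT (cutoff T (@simple_process _ _ _ d N s0)).
  by have [] := cut_simple_sqint nu_levy N_poisson T s0.
apply: sqnorm_le0_ae => // e e0.
(* Three nested triangle inequalities: two through the simple processes and, after the isometry, one
   through [J = J']. *)
have c0 : 0 < e / 4 / 4 / 4 by rewrite !divr_gt0.
have [s [sH sJ]] := stoch_integral_approx mH iJ c0.
have [s' [sH' sJ']] := stoch_integral_approx mH' iJ' c0.
have weaken (x : \bar R) (a : R) : (x <= (e / 4 / 4 / 4)%:E)%E ->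
    e / 4 / 4 / 4 <= a -> (x <= a%:E)%E by move=> /le_trans + ?; apply; rewrite lee_fin.
apply: le_trans (sqnorm_triangle _ mH (mc s) mH') _.
apply: lee_quarters; first by rewrite sqnormB_sym; apply: weaken sH _; lra.
apply: le_trans (sqnorm_triangle _ (mc s) (mc s') mH') _.
apply: lee_quarters; last by apply: weaken sH' _; lra.
rewrite -(simple_isometryB nu_levy N_poisson).
apply: le_trans (sqnorm_triangle _ (mI _) mJ (mI _)) _.
apply: lee_quarters => //; rewrite sqnormB_sym.
rewrite (@ae_eq_sqnorm _ _ _ P _ (fun w => I_T s' w - J' w))//.
- exact: measurable_funB.
- exact: measurable_funB.
- by apply: filterS JJ' => w ->.
Qed.

End approximable.

(** * Expansion of exponentials over blocks *)

Section level_identities.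
Context {R : realType} {dE : measure_display} {E : measurableType dE}.
Implicit Types (l : seq (set E)) (L : seq (R * set E)).

(** Applied to the intensity and also, almost surely, to the random measures [N w]. *)
Definition good_set (m : {measure set E -> \bar R}) (A : set E) : Prop :=
  measurable A /\ (m A < +oo)%E.

Lemma all_measurable_good m l : all (fun A => `[< good_set m A >]) l ->
  all (fun A => `[< measurable A >]) l.
Proof. by apply: sub_all => A /asboolP[mA _]; apply/asboolP. Qed.

Lemma level_le_sum (m : {measure set E -> \bar R}) l k :
  all (fun A => `[< measurable A >]) l -> (m (level l k.+1) <= \sum_(A <- l) m A)%E.
Proof.
elim: l k => [|A l ih] k ml.
  by rewrite (_ : level [::] k.+1 = set0) ?measure0 ?big_nil//;
    apply/seteqP; split => // x; rewrite /level/= big_nil.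
have [mA ml'] : measurable A /\ all (fun A => `[< measurable A >]) l.
  by move: ml => /= /andP[/asboolP].
rewrite big_cons; apply: (@le_trans _ _ (m (A `|` level l k.+1))).
  apply: le_measure; rewrite ?inE; [exact: measurable_level|
    apply: measurableU => //; exact: measurable_level|].
  move=> x; rewrite /level/= big_cons.
  by have [/set_mem|_] := boolP (x \in A); [left|rewrite add0n; right].
apply: (le_trans (measureU2 _ mA _)); first exact: measurable_level.
by rewrite leeD2l// ih.
Qed.

Lemma sum_good_fin (m : {measure set E -> \bar R}) l : all (fun A => `[< good_set m A >]) l ->
  (\sum_(A <- l) m A < +oo)%E.
Proof.
elim: l => [|A l ih]; first by rewrite big_nil.
by move=> /= /andP[/asboolP[mA fA] /ih fl]; rewrite big_cons lte_add_pinfty.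
Qed.

Lemma level_good (m : {measure set E -> \bar R}) l k :
  all (fun A => `[< good_set m A >]) l -> good_set m (level l k.+1).
Proof.
move=> gl; have ml := all_measurable_good gl.
split; first exact: measurable_level.
exact: le_lt_trans (level_le_sum m k ml) (sum_good_fin gl).
Qed.

(** Both sides integrate the same function of the number of overlaps, written over [L] and over the
    levels. Taken for [mu] and for [N w], this equates compensated sums over rectangles with
    compensated sums over levels. *)
Lemma sum_fine_levels (m : {measure set E -> \bar R}) (phi : nat -> R) l L :
  phi 0%N = 0 ->
  (forall x, \sum_(cB <- L) cB.1 * \1_(cB.2) x = phi (\sum_(A <- l) (x \in A))%N) ->
  all (fun A => `[< good_set m A >]) l ->
  all (fun cB => `[< good_set m cB.2 >]) L ->
  \sum_(cB <- L) cB.1 * fine (m cB.2) =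
  \sum_(k < size l) phi k.+1 * fine (m (level l k.+1)).
Proof.
move=> phi0 LE gl gL.
have ind (A : set E) : good_set m A -> m.-integrable setT (EFin \o \1_A) /\
    \int[m]_x \1_A x = fine (m A) :> R.
  move=> [mA fA]; split; first exact: integrable_indic_fin.
  by rewrite /Rintegral integral_indic// setIT.
have sumL : m.-integrable setT (EFin \o (fun x => \sum_(cB <- L) cB.1 * \1_(cB.2) x)) /\
    \int[m]_x (\sum_(cB <- L) cB.1 * \1_(cB.2) x) = \sum_(cB <- L) cB.1 * fine (m cB.2).
  elim: L {LE} gL => [_|[c B] L ih /= /andP[/asboolP gB /ih [ih1 ih2]]].
    under [X in EFin \o X]funext do rewrite big_nil.
    under [X in Rintegral _ _ X]funext do rewrite big_nil.
    split; first exact: integrable0.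
    by rewrite big_nil /Rintegral integral0.
  have [i1 i2] := ind _ gB; have i3 := integrableZ_EFin c i1.
  under [X in EFin \o X]funext do rewrite big_cons.
  under [X in Rintegral _ _ X]funext do rewrite big_cons.
  split; first exact: (integrableD_EFin i3 ih1).
  by rewrite RintegralD// RintegralZl//= i2 ih2 big_cons.
have il (k : 'I_(size l)) : m.-integrable setT
    (EFin \o (fun x => phi k.+1 * \1_(level l k.+1) x)).
  by apply: integrableZ_EFin; have [] := ind _ (level_good k gl).
have [_ <-] := sumL.
transitivity (\int[m]_x (\sum_(k < size l) phi k.+1 * \1_(level l k.+1) x)).
  by apply: eq_Rintegral => x _; rewrite LE level_step_function.
have [_ ->] := Rintegral_sum (index_enum _) il; apply: eq_bigr => k _.
have [i1 i2] := ind _ (level_good k gl).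
by rewrite RintegralZl// i2.
Qed.

End level_identities.

Section blocks.
Context {R : realType} (d : nat).
Context {dO : measure_display} {Omega : measurableType dO}.
Variables (P : probability Omega R) (nu : {measure set R -> \bar R}).
Hypothesis nu_levy : levy_measure nu.
Variable N : Omega -> {measure set (txz R d) -> \bar R}.
Hypothesis N_poisson : poisson_random_measure P (intensity nu) N.
Variables (T : R) (T0 : 0 <= T).
Local Notation mu := (mu_txz d nu_levy).
Local Notation elementary := (elementary N).
Local Notation I_T := (simple_integral nu T).
Local Notation block := (R * set (d.-tuple R) * set R)%type.
Implicit Types (a b : R) (B : block) (l : seq block) (X : Omega -> R).

(** A block stores its end time; the start [a] is shared by all blocks of a step, so that their
    intersections are again blocks. *)
Definition block_set a B : set (txz R d) := `]a, B.1.1] `*` B.1.2 `*` B.2.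

Definition block_ok B : Prop :=
  [/\ B.1.1 <= T, bounded_borel_Rd B.1.2 & borel_away_from_0 B.2].

Lemma block_set_good a B : block_ok B -> good_set mu (block_set a B).
Proof.
move=> [BT bB aB]; split.
  apply: measurableX; last by case: aB.
  by apply: measurableX => //; case: bB.
apply: (@mu_txz_fin _ _ _ _ _ _ _ B.1.1) => //.
by move=> t /=; rewrite in_itv/= => /andP[].
Qed.

Definition blockI B B' : block :=
  (Num.min B.1.1 B'.1.1, B.1.2 `&` B'.1.2, B.2 `&` B'.2).

Lemma block_setI a B B' : block_set a (blockI B B') = block_set a B `&` block_set a B'.
Proof.
apply/seteqP; split => -[[t x] z]; rewrite /block_set/= !in_itv/= !le_min.
  by move=> [[/andP[-> /andP[-> ->]] [? ?]] [? ?]].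
by move=> [[[/andP[-> ->] ?] ?] [[/andP[_ ->] ?] ?]].
Qed.

Lemma blockI_ok B B' : block_ok B -> block_ok B' -> block_ok (blockI B B').
Proof.
move=> [BT [mA [M AM]] [mG [e e0 Ge]]] [BT' [mA' _] [mG' _]]; split => /=.
- by rewrite ge_min BT.
- by split; [exact: measurableI|exists M => x [/AM]].
- by split; [exact: measurableI|exists e => // z [/Ge]].
Qed.

(* The coefficients come from expanding  \prod_A (1 - (1 - e^-1) 1_A) - 1. *)
Fixpoint block_expansion l : seq (R * block) :=
  if l is A :: l' then
    (expR (-1) - 1, A) :: block_expansion l' ++
      [seq ((expR (-1) - 1) * cB.1, blockI A cB.2) | cB <- block_expansion l']
  else [::].

Lemma block_expansion_ok l : all (fun B => `[< block_ok B >]) l ->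
  all (fun cB => `[< block_ok cB.2 >]) (block_expansion l).
Proof.
elim: l => //= A l ih /andP[okA /ih okl]; rewrite okA all_cat okl /= all_map.
apply: sub_all okl => -[c B] /= /asboolP okB; apply/asboolP.
by apply: blockI_ok => //; apply/asboolP.
Qed.

Lemma block_expansionE a l q :
  \sum_(cB <- block_expansion l) cB.1 * \1_(block_set a cB.2) q =
  expR (- (\sum_(B <- l) (q \in block_set a B))%:R) - 1.
Proof.
elim: l => [|A l ih]; first by rewrite !big_nil oppr0 expR0 subrr.
rewrite /= !big_cons big_cat/= big_map/= ih natrD opprD expRD.
have -> : \sum_(cB <- block_expansion l) (expR (-1) - 1) * cB.1 *
    \1_(block_set a (blockI A cB.2)) q = (expR (-1) - 1) * \1_(block_set a A) q *
    (expR (- (\sum_(B <- l) (q \in block_set a B))%:R) - 1).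
  rewrite -ih big_distrr/=; apply: eq_bigr => cB _.
  by rewrite block_setI indicI/=; ring.
rewrite indicE; case: (q \in block_set a A) => /=; first by ring.
by rewrite oppr0 expR0; ring.
Qed.

Lemma block_simple_integral a X (M c : R) B : 0 <= a ->
  measurable_wrt setT (filtrationN N a) X -> (forall w, `|X w| <= M) ->
  block_ok B ->
  exists s : seq (R * elementary), forall w,
    I_T s w = c * (X w * compensated mu N (block_set a B) w).
Proof.
move=> a0 FX XM [BT bB aB].
(* An elementary process needs [a < b]; a block that ends no later than [a] is empty and is given
   the empty list. *)
have [ab|ba] := ltP a B.1.1; last first.
  exists [::] => w; rewrite /simple_integral big_nil.
  have -> : block_set a B = set0.
    apply/seteqP; split => // -[[t x] z] [[/= + _] _].
    by rewrite in_itv/= => /andP[at_ tB]; move: (lt_le_trans at_ tB); rewrite ltNge ba.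
  by rewrite /compensated !measure0 subrr !mulr0.
have ab' : 0 <= a < B.1.1 by rewrite a0.
exists [:: (c, @Elementary _ _ _ _ N a B.1.1 X B.1.2 B.2 ab' (ex_intro _ M XM) FX bB aB)] => w.
rewrite /simple_integral big_seq1 /elementary_integral/= (NhatE nu_levy).
by rewrite (min_l (le_trans (ltW ab) BT)) (min_l BT).
Qed.

Lemma expansion_simple_integral a X (M : R) (L : seq (R * block)) : 0 <= a ->
  measurable_wrt setT (filtrationN N a) X -> (forall w, `|X w| <= M) ->
  all (fun cB => `[< block_ok cB.2 >]) L ->
  exists s : seq (R * elementary), forall w,
    I_T s w = X w * \sum_(cB <- L) cB.1 * compensated mu N (block_set a cB.2) w.
Proof.
move=> a0 FX XM; elim: L => [_|[c B] L ih /= /andP[/asboolP okB /ih [s sE]]].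
  by exists [::] => w; rewrite /simple_integral !big_nil mulr0.
have [s' s'E] := block_simple_integral c a0 FX XM okB.
exists (s' ++ s) => w; rewrite /simple_integral big_cat/=.
rewrite -!/(simple_integral _ _ _ _) sE s'E big_cons/=; ring.
Qed.

Lemma good_sets_ae (L : seq (set (txz R d))) : all (fun A => `[< good_set mu A >]) L ->
  {ae P, forall w, all (fun A => `[< good_set (N w) A >]) L}.
Proof.
elim: L => [_|A L ih /= /andP[/asboolP[mA fA] /ih h]]; first by apply: aeW.
have h1 := poisson_fin_ae (mu_poisson nu_levy N_poisson) mA (measure_ge0 mu A) fA.
apply: filterS2 h1 h => w fw ->; rewrite andbT; apply/asboolP; split => //.
by rewrite ltey_eq fw.
Qed.

End blocks.

(** * Laplace functionals are approximable *)

Section exponential_bounds.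
Context {R : realType}.

(** [e^q <= 1 / (1 - q)] since [e^-q >= 1 - q]; the restriction [q <= 1/2] keeps the remainder
    [q^2 (1 - 2 q)] nonnegative. *)
Lemma expR_quadratic (q : R) : 0 <= q <= 2^-1 -> expR q - 1 - q <= 2 * q ^+ 2.
Proof.
move=> /andP[q0 q1].
have h : expR q * (1 - q) <= 1.
  by rewrite -[leRHS](expRxMexpNx_1 q) ler_pM2l ?expR_gt0//; exact: expR_ge1Dx.
have q2 : 0 < 1 - q by lra.
have : expR q <= 1 / (1 - q) by rewrite ler_pdivlMr.
suff : 1 / (1 - q) <= 1 + q + 2 * q ^+ 2 by lra.
rewrite ler_pdivrMr// -subr_ge0.
have -> : (1 + q + 2 * q ^+ 2) * (1 - q) - 1 = q ^+ 2 * (1 - 2 * q) by ring.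
by rewrite mulr_ge0 ?sqr_ge0//; lra.
Qed.

End exponential_bounds.

Section laplace.
Context {R : realType} (d : nat).
Context {dO : measure_display} {Omega : measurableType dO}.
Variables (P : probability Omega R) (nu : {measure set R -> \bar R}).
Hypothesis nu_levy : levy_measure nu.
Variable N : Omega -> {measure set (txz R d) -> \bar R}.
Hypothesis N_poisson : poisson_random_measure P (intensity nu) N.
Variables (T : R) (T0 : 0 <= T).
Local Notation mu := (mu_txz d nu_levy).
Local Notation elementary := (elementary N).
Local Notation I_T := (simple_integral nu T).
Local Notation block := (R * set (d.-tuple R) * set R)%type.
Variable l : seq block.
Hypothesis l_ok : all (fun B => `[< block_ok T B >]) l.

Definition cap b (B : block) : block := (Num.min b B.1.1, B.1.2, B.2).

Definition past_count (t : R) (w : Omega) : \bar R :=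
  (\sum_(B <- l) N w (`[0%R, (cap t B).1.1] `*` B.1.2 `*` B.2))%E.

Definition increments (a b : R) : seq (set (txz R d)) :=
  [seq block_set a (cap b B) | B <- l].

Definition increment_count a b w : \bar R := (\sum_(A <- increments a b) N w A)%E.

(** Mass per unit of time, counted with multiplicity and as if no block ended during the step; hence
    the inequality in [increments_mass]. *)
Definition total_rate : R := \sum_(B <- l) fine (ltup d B.1.2 * nu B.2)%E.

Lemma cap_ok b B : b <= T -> block_ok T B -> block_ok T (cap b B).
Proof. by move=> bT [BT ? ?]; split => //=; rewrite ge_min bT. Qed.

Lemma all_cap_ok b : b <= T -> all (fun B => `[< block_ok T B >]) (map (cap b) l).
Proof.
move=> bT; rewrite all_map; apply: sub_all l_ok => B /asboolP okB.
by apply/asboolP; exact: cap_ok.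
Qed.

Lemma increments_good (a b : R) : b <= T ->
  all (fun A => `[< good_set mu A >]) (increments a b).
Proof.
move=> bT; rewrite /increments all_map; apply: sub_all l_ok => B /asboolP okB.
by apply/asboolP; apply: block_set_good; exact: cap_ok okB.
Qed.

Lemma past_count_split (a b : R) w : 0 <= a -> a <= b ->
  past_count b w = (past_count a w + increment_count a b w)%E.
Proof.
move=> a0 ab; rewrite /past_count /increment_count /increments big_map.
have : all (fun B => `[< block_ok T B >]) l by [].
elim: l => [|B l' ih]; first by rewrite !big_nil adde0.
move=> /= /andP[/asboolP[_ [mB _] [mG _]] /ih {}ih].
rewrite !big_cons ih addeACA; congr (_ + _)%E.
rewrite (measure_time_split _ _ a0 mB mG); congr (N w (`[0%R, _] `*` _ `*` _) + _)%E.
by rewrite /= minA (min_l ab).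
Qed.

Lemma increments_mass (a b : R) : 0 <= a -> a <= b -> b <= T ->
  \sum_(A <- increments a b) fine (mu A) <= (b - a) * total_rate.
Proof.
move=> a0 ab bT; rewrite /increments big_map /total_rate big_distrr/=.
have : all (fun B => `[< block_ok T B >]) l by [].
elim: l => [|B l' ih]; first by rewrite !big_nil.
move=> /= /andP[/asboolP okB /ih {}ih]; rewrite !big_cons; apply: lerD => //.
have [_ bB aB] := okB; have [[mB _] [mG _]] := (bB, aB).
have [m1 f1] := block_set_good nu_levy a (cap_ok bT okB).
have tg : block_ok T ((b, B.1.2, B.2) : block) by split.
have [m2 f2] := block_set_good nu_levy a tg.
have -> : (b - a) * fine (ltup d B.1.2 * nu B.2)%E = fine (mu (block_set a (b, B.1.2, B.2))).
  rewrite /block_set/= mu_txz_rect// ltime_itv//.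
  rewrite -muleA -[LHS]/(fine (b - a)%:E * _) -fineM//.
  have fl := ltup_fin bB; have fn := levy_fin nu_levy aB.
  by rewrite fin_numM// ge0_fin_numE.
rewrite fine_le ?ge0_fin_numE//; apply: le_measure; rewrite ?inE//.
move=> [[t x] z]; rewrite /block_set/= !in_itv/= le_min.
by move=> [[/andP[-> /andP[-> _]] ?] ?].
Qed.

(** [lam] and [zeta] are found before the weight [X]. The normalised exponential of the increment is
    a product of independent mean-one factors over the levels, and [zeta] is what remains of it
    after 1 and the first order part. Rewritten over blocks and multiplied by [X], that part is a
    simple integral. *)
Lemma laplace_step (a b : R) : 0 <= a -> a <= b -> b <= T ->
  (b - a) * total_rate <= 2^-1 ->
  exists (lam : R) (zeta : Omega -> R),
  [/\ 0 <= lam <= (b - a) * total_rate,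
      measurable_wrt setT (region_sigma N (`]a, b] `*` setT `*` setT)) zeta,
      sqint P zeta,
      \int[P]_w zeta w = 0 /\
      \int[P]_w (zeta w ^+ 2) <= 2 * ((b - a) * total_rate) ^+ 2 &
      forall (X : Omega -> R) (M : R),
        measurable_wrt setT (filtrationN N a) X -> (forall w, `|X w| <= M) ->
        exists s : seq (R * elementary), {ae P, forall w,
          X w * (expN (increment_count a b w) * expR lam) =
          X w + I_T s w + X w * zeta w}].
Proof.
move=> a0 ab bT small.
pose A := increments a b; have gA := increments_good a bT : all _ A.
(* A point covered [k+1] times contributes [k+1] to the sum of counts, hence the coefficient
   [c k]. *)
pose D k := level A k.+1; pose c k : R := k.+1%:R; pose m := size A.
have gD k : good_set mu (D k) by exact: level_good.
have mD k : measurable (D k) by case: (gD k).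
have fD k : (mu (D k) < +oo)%E by case: (gD k).
have c0 k : 0 <= c k by [].
have tD : trivIset setT D.
  by move=> i j _ _ [x [Di Dj]]; apply/eqP; rewrite -eqSS; apply/eqP; rewrite -Di -Dj.
have ec k : 0 <= 1 - expR (- c k) <= 1.
  rewrite subr_ge0 gerBl expR_ge0 andbT.
  by rewrite -(expR0 R) ler_expR oppr_le0.
have f0 k : 0 <= fine (mu (D k)) by rewrite fine_ge0.
have mass : \sum_(k < m) fine (mu (D k)) <= (b - a) * total_rate.
  apply: le_trans (increments_mass a0 ab bT).
  (* With coefficients 1 and [phi] the identity, this is the mass with multiplicity; each level
     enters it with a factor [k+1 >= 1]. *)
  have := @sum_fine_levels _ _ _ mu (fun k => k%:R) A [seq (1, B) | B <- A] erefl.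
  rewrite big_map => h; have {h} := h _ gA.
  rewrite all_map => h; have {h} := h _ gA.
  under eq_bigr do rewrite mul1r.
  move=> ->; last first.
    by move=> x; rewrite big_map natr_sum; apply: eq_bigr => B _; rewrite mul1r.
  by apply: ler_sum => k _; rewrite ler_peMl// ler1n.
(* The sum of the logarithms of the normalising constants in [exp_count]. *)
pose lam := \sum_(k < m) fine (mu (D k)) * (1 - expR (- c k)).
have q01 : 0 <= exp_total mu D c m <= (b - a) * total_rate.
  apply/andP; split; first by apply: sumr_ge0 => k _; rewrite mulr_ge0// sqr_ge0.
  apply: le_trans mass; apply: ler_sum => k _; rewrite ler_piMr//.
  by have /andP[e0 e1] := ec k; rewrite expr_le1.
have mp := mu_poisson nu_levy N_poisson.
exists lam, (exp_error mu N D c m); split.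
- apply/andP; split.
    by apply: sumr_ge0 => k _; rewrite mulr_ge0//; case/andP: (ec k).
  by apply: le_trans mass; apply: ler_sum => k _; rewrite ler_piMr//.
- apply: measurable_wrtS (@exp_error_region _ _ _ _ _ mu N D c mD m).
  apply: region_sigmaS => x [k _]; apply: level_sub.
  rewrite /A /increments all_map; apply: sub_all l_ok => B _; apply/asboolP.
  by move=> -[[t y] z]; rewrite /block_set/= !in_itv/= le_min => -[[/andP[-> /andP[-> _]] _] _].
- exact: (exp_error_sqint mp).
- split; first exact: (exp_error_mean mp).
  rewrite (exp_error_sqr mp)//.
  have /andP[q0 q1] := q01.
  apply: (le_trans (expR_quadratic _)); first by rewrite q0 (le_trans q1).
  by rewrite ler_pM2l// lerXn2r// nnegrE (le_trans q0).
- move=> X M FX XM.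
  pose L := block_expansion (map (cap b) l).
  have okL : all (fun cB => `[< block_ok T cB.2 >]) L.
    by apply: block_expansion_ok; exact: all_cap_ok.
  have [s sE] := expansion_simple_integral nu_levy a0 FX XM okL.
  exists s.
  pose L' := [seq (cB.1, block_set a cB.2) | cB <- L].
  have gL : all (fun cB => `[< good_set mu cB.2 >]) L'.
    rewrite all_map; apply: sub_all okL => -[k B] /= /asboolP okB.
    by apply/asboolP; exact: (block_set_good nu_levy a okB).
  have g2 : all (fun B => `[< good_set mu B >]) [seq cB.2 | cB <- L'].
    by rewrite all_map.
  have ph0 : expR (- 0%:R) - 1 = 0 :> R by rewrite oppr0 expR0 subrr.
  have LE x : \sum_(cB <- L') cB.1 * \1_(cB.2) x = expR (- (\sum_(B <- A) (x \in B))%:R) - 1.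
    by rewrite big_map block_expansionE /A /increments !big_map.
  have a1 := good_sets_ae N_poisson gA.
  have a2 := good_sets_ae N_poisson g2.
  apply: filterS2 a1 a2 => w gw.
  rewrite all_map => gwL.
  (* [phi k = e^-k - 1] is both the function expanded over the blocks and, at [k+1], the coefficient
     of [exp_comp] on [D k]. *)
  have sumE : \sum_(cB <- L) cB.1 * compensated mu N (block_set a cB.2) w = exp_sum mu N D c m w.
    transitivity (\sum_(cB <- L') cB.1 * fine (N w cB.2) - \sum_(cB <- L') cB.1 * fine (mu cB.2)).
      by rewrite !big_map -sumrB; apply: eq_bigr => cB _; rewrite /compensated mulrBr.
    rewrite (sum_fine_levels (phi := fun k => expR (- k%:R) - 1) ph0 LE gw gwL).
    rewrite (sum_fine_levels (phi := fun k => expR (- k%:R) - 1) ph0 LE gA gL).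
    by rewrite -sumrB; apply: eq_bigr => k _; rewrite /exp_comp /compensated mulrBr.
  have prodE : expN (increment_count a b w) * expR lam = exp_prod mu N D c m w.
    rewrite /exp_prod /exp_count big_split; congr (_ * _); last by rewrite /lam expR_sum.
    rewrite /increment_count -/A (sum_measure_levels _ (all_measurable_good gw)).
    rewrite expN_sum; last by move=> k; rewrite mule_ge0.
    apply: eq_bigr => k _; have [_ fk] := level_good k gw.
    by rewrite -[N w _]fineK ?ge0_fin_numE// -EFinM expN_fin.
  rewrite prodE sE sumE /exp_error; ring.
Qed.

Lemma total_rate_ge0 : 0 <= total_rate.
Proof. by apply: sumr_ge0 => B _; rewrite fine_ge0// mule_ge0. Qed.

Lemma null_count_ae (A : set (txz R d)) : measurable A -> mu A = 0%E ->
  {ae P, forall w, N w A = 0%E}.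
Proof.
move=> mA A0; have mp := mu_poisson nu_levy N_poisson.
have fA : (mu A < +oo)%E by rewrite A0 ltry.
have := poisson_law mp mA (measure_ge0 mu A) fA 0%N.
rewrite A0 /= expr0 fact0 divr1 oppr0 expR0 mulr1 => P1.
have mS : measurable [set w | N w A = 0%:R%:E].
  have := measurable_count mp mA measurableT (emeasurable_set1 (0%:R%:E)).
  by rewrite setTI.
exists (~` [set w | N w A = 0%:R%:E]); split => //; first exact: measurableC.
by rewrite probability_setC// P1 subee.
Qed.

Hypothesis l_ge0 : all (fun B : block => (0 : R) <= B.1.1) l.

(** The sets [[0, s]] of the filtration contain time 0, but that slice has zero intensity, so its
    count vanishes almost surely. *)
Lemma past_count0_ae : {ae P, forall w, past_count 0 w = 0%E}.
Proof.
rewrite /past_count.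
have : all (fun B => `[< block_ok T B >]) l by [].
elim: l l_ge0 => [_ _|B l' ih /= /andP[B0 /ih {}ih] /andP[/asboolP okB /ih {}ih]].
  by apply: aeW => w; rewrite big_nil.
have [_ [mB _] [mG _]] := okB.
have mS : measurable (`[0%R, Num.min 0 B.1.1] `*` B.1.2 `*` B.2).
  by apply: measurableX => //; exact: measurableX.
have S0 : mu (`[0%R, Num.min 0 B.1.1] `*` B.1.2 `*` B.2) = 0%E.
  rewrite mu_txz_rect// (min_l B0).
  have -> : ltime `[0%R, 0%R]%classic = 0%E :> \bar R.
    apply/eqP; rewrite eq_le measure_ge0 andbT.
    have <- : leb `[0%R, 0%R]%classic = 0%E :> \bar R by rewrite leb_itv// subrr.
    by rewrite /ltime /mrestr; apply: le_measure; rewrite ?inE//; exact: measurableI.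
  by rewrite !mul0e.
by apply: filterS2 (null_count_ae mS S0) ih => w h1 h2; rewrite big_cons h1 add0e.
Qed.

Lemma measurable_wrt_past (t c : R) : 0 <= t ->
  measurable_wrt setT (filtrationN N t) (fun w => expN (past_count t w) * c).
Proof.
move=> t0; apply/measurable_wrtP; first exact: smallest_sigma_algebra.
apply: measurable_funM => //; apply: (measurableT_comp measurable_fun_expN).
rewrite /past_count.
have : all (fun B => `[< block_ok T B >]) l by [].
elim: l l_ge0 => [_ _|B l' ih /= /andP[B0 /ih {}ih] /andP[/asboolP okB /ih {}ih]].
  by under eq_fun do rewrite big_nil; exact: measurable_cst.
under eq_fun do rewrite big_cons; apply: emeasurable_funD => //.
apply/measurable_wrtP; first exact: smallest_sigma_algebra.
have [_ bB aB] := okB.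
apply: (@sub_sigma_family _ _ _ _ _ (fun i w => N w (`[0, i.1.1] `*` i.1.2 `*` i.2) : \bar R) (cap t B)).
by split => //=; rewrite le_min t0 B0/= ge_min lexx.
Qed.

Lemma past_count_ge0 t w : (0 <= past_count t w)%E.
Proof. by apply: sume_ge0 => B _. Qed.

(** Induction along the grid. [Z] collects the terms [X zeta] of the steps taken; [Lam <= i q]
    bounds the weight [X] by [e^(T total_rate)], whence the square of that number in the error of
    each step. *)
Lemma laplace_partial (n i : nat) : (0 < n)%N -> T / n%:R * total_rate <= 2^-1 ->
  (i <= n)%N ->
  let t := i%:R * (T / n%:R) in let q := T / n%:R * total_rate in
  exists (Lam : R) (Z : Omega -> R) (s : seq (R * elementary)),
  [/\ 0 <= Lam <= i%:R * q,
      measurable_wrt setT (region_sigma N (past t)) Z,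
      sqint P Z,
      \int[P]_w (Z w ^+ 2) <= i%:R * (expR (T * total_rate) ^+ 2 * (2 * q ^+ 2)) &
      {ae P, forall w, expN (past_count t w) * expR Lam = 1 + I_T s w + Z w}].
Proof.
move=> n0 small; set h := T / n%:R; set q := h * total_rate.
have h0 : 0 <= h by rewrite divr_ge0.
have q0 : 0 <= q by rewrite mulr_ge0// total_rate_ge0.
have nq : n%:R * q = T * total_rate by rewrite /q /h; field; rewrite pnatr_eq0 -lt0n.
elim: i => [_|i ih ltin] /=.
  exists 0, (fun=> 0), [::]; split.
  - by rewrite mul0r lexx.
  - exact: measurable_wrt_cst.
  - exact: sqint0.
  - under eq_Rintegral do rewrite expr0n/=.
    by rewrite Rintegral_probability_cst mul0r.
  - apply: filterS past_count0_ae => w; rewrite mul0r => ->.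
    by rewrite expN0 expR0 /simple_integral big_nil; ring.
have [Lam [Z [s [/andP[L0 Lq] FZ sZ Z2 ae1]]]] := ih (ltnW ltin).
set t := i%:R * h in FZ ae1 *; set t' := i.+1%:R * h.
have t0 : 0 <= t by rewrite mulr_ge0.
have tt' : t' - t = h by rewrite /t' /t -natr1; ring.
have ltt' : t <= t' by rewrite -subr_ge0 tt'.
have t'T : t' <= T.
  by rewrite /t' /h mulrA ler_pdivrMr ?ltr0n// mulrC ler_wpM2l// ler_nat.
have [|lam [zeta [/andP[l0 lq] Fz sz [z0 z2] step]]] := laplace_step t0 ltt' t'T.
  by rewrite tt'.
rewrite tt' -/q in lq z2.
pose X w := expN (past_count t w) * expR Lam.
have FX : measurable_wrt setT (filtrationN N t) X by exact: measurable_wrt_past.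
have XM w : `|X w| <= expR (T * total_rate).
  have /andP[e0 e1] := expN_ge0_le1 (past_count_ge0 t w).
  rewrite ger0_norm ?mulr_ge0 ?expR_ge0//.
  apply: (@le_trans _ _ (expR Lam)); first by rewrite ler_piMl ?expR_ge0.
  rewrite ler_expR -nq (le_trans Lq)// ler_wpM2r// ler_nat; exact: ltnW.
have [s' ae2] := step X _ FX XM.
have RX := measurable_wrtS (@filtrationN_region _ _ _ _ N t) FX.
have mp := mu_poisson nu_levy N_poisson.
have mX := measurable_wrt_region mp RX.
have sX := sqint_bounded P mX XM.
pose S : set (txz R d) := `]t, t'] `*` setT `*` setT.
have disj : past t `&` S = set0.
  apply/seteqP; split => // -[[u x] z] [/= ut] [[/= + _] _].
  by rewrite in_itv/= => /andP[tu _]; move: (lt_le_trans tu ut); rewrite ltxx.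
have RI := region_integral mp disj.
have [i1 e1] := RI _ _ (measurable_wrtM FZ RX) Fz (sqintM sZ sX) (sqint_integrable sz).
have [i2 e2] := RI _ _ (measurable_wrtM RX RX) (measurable_wrtM Fz Fz) (sqintM sX sX) (sqintM sz sz).
exists (Lam + lam), (fun w => Z w + X w * zeta w), (lin_comb 1 s s'); split.
- by rewrite addr_ge0//= -natr1 mulrDl mul1r lerD.
- apply: measurable_wrtD.
    apply: measurable_wrtS FZ; apply: region_sigmaS => u /= ut; exact: le_trans ltt'.
  apply: measurable_wrtM.
    apply: measurable_wrtS RX; apply: region_sigmaS => u /= ut; exact: le_trans ltt'.
  apply: measurable_wrtS Fz; apply: region_sigmaS => -[[u x] z] [[/= + _] _].
  by rewrite in_itv/= => /andP[].
- by apply: sqintD => //; exact: sqint_bndM mX XM sz.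
- rewrite (_ : (fun w => _) = fun w => Z w ^+ 2 +
      (2 * (Z w * X w * zeta w) + X w * X w * (zeta w * zeta w))); last first.
    by apply/funext => w; ring.
  have j1 := sqint_integrable2 sZ; have j2 := integrableZ_EFin 2 i1.
  rewrite (RintegralD measurableT j1 (integrableD_EFin j2 i2)).
  (* The cross term [Z X zeta] has mean 0, since [zeta] is centred and independent of the past. *)
  rewrite (RintegralD measurableT j2 i2) RintegralZl// e1 e2 z0 !mulr0 add0r.
  rewrite -natr1 mulrDl mul1r; apply: lerD => //.
  have X2 : \int[P]_w (X w * X w) <= expR (T * total_rate) ^+ 2.
    have <- := Rintegral_probability_cst P (expR (T * total_rate) ^+ 2).
    apply: le_Rintegral => //; [exact: sqintM| |].
      exact: sqint_integrable (sqint_cst P _).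
    by move=> w _; rewrite -expr2 -real_normK ?num_real// lerXn2r ?nnegrE// expR_ge0.
  apply: ler_pM => //.
    by apply: Rintegral_ge0 => w _; rewrite -expr2 sqr_ge0.
  by apply: Rintegral_ge0 => w _; rewrite -expr2 sqr_ge0.
- apply: filterS2 ae1 ae2 => w h1 h2.
  rewrite (past_count_split _ t0 ltt') expND ?past_count_ge0//; last first.
    by apply: sume_ge0.
  rewrite expRD simple_integral_lin mul1r.
  transitivity (X w * (expN (increment_count t t' w) * expR lam)); first by rewrite /X; ring.
  by rewrite h2 /X h1; ring.
Qed.

Lemma laplace_approximable :
  approximable P nu N T (fun w => expN (\sum_(B <- l) N w (`[0%R, B.1.1] `*` B.1.2 `*` B.2))%E).
Proof.
have -> : (fun w => expN (\sum_(B <- l) N w (`[0%R, B.1.1] `*` B.1.2 `*` B.2))%E) =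
    fun w => expN (past_count T w).
  apply/funext => w; congr expN; rewrite /past_count.
  have : all (fun B => `[< block_ok T B >]) l by [].
  elim: l => [_|B l' ih /= /andP[/asboolP[BT _ _] /ih {}ih]]; first by rewrite !big_nil.
  by rewrite !big_cons ih (min_r BT).
have mp := mu_poisson nu_levy N_poisson.
have mF : measurable_fun setT (fun w => expN (past_count T w)).
  have := @measurable_wrt_past T 1 T0; under eq_fun do rewrite mulr1.
  by move/(measurable_wrtS (@filtrationN_region _ _ _ _ N T)); exact: measurable_wrt_region mp _ _.
split => // e e0.
pose V := total_rate; have V0 : 0 <= V := total_rate_ge0.
(* [n] errors of size [e^(2 T V) * 2 (T V / n)^2] add up to [c / n]; the condition [2 T V <= n]
   brings the rate of one step below 1/2. *)
pose c := expR (T * V) ^+ 2 * (2 * (T * V) ^+ 2).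
have c0 : 0 <= c by rewrite mulr_ge0 ?sqr_ge0// mulr_ge0 ?sqr_ge0.
have [n [n0 n1 n2]] : exists n : nat, [/\ (0 < n)%N, 2 * (T * V) <= n%:R & c / e <= n%:R].
  exists (Num.bound (2 * (T * V)) + Num.bound (c / e)).+1; split => //.
    apply: (@le_trans _ _ (Num.bound (2 * (T * V)))%:R).
      by apply/ltW/archi_boundP; rewrite !mulr_ge0.
    by rewrite ler_nat leqW// leq_addr.
  apply: (@le_trans _ _ (Num.bound (c / e))%:R).
    by apply/ltW/archi_boundP; rewrite divr_ge0// ltW.
  by rewrite ler_nat leqW// leq_addl.
have n0' : 0 < n%:R :> R by rewrite ltr0n.
have small : T / n%:R * V <= 2^-1 by rewrite mulrAC ler_pdivrMr// ler_pdivlMl.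
have [Lam [Z [s [/andP[L0 _] _ sZ Z2]]]] := laplace_partial n0 small (leqnn _).
have -> : n%:R * (T / n%:R) = T by rewrite mulrC divfK// gt_eqF.
(* Undoing the normalisation multiplies everything by [e^(-Lam) <= 1]; [lin_comb] with the empty
   list is this scaling. *)
move=> ae1; exists (expR (- Lam)), (lin_comb (expR (- Lam)) s [::]).
have mI := measurable_simple_integral nu_levy N_poisson T.
rewrite (@ae_eq_sqnorm _ _ _ P _ (fun w => expR (- Lam) * Z w)).
- rewrite sqnormZ; last by case: sZ.
  apply: (@le_trans _ _ (1%:E * sqnorm P Z)%E).
    rewrite lee_wpmul2r ?sqnorm_ge0// lee_fin expr_le1 ?expR_ge0//.
    by rewrite -expR0 ler_expR oppr_le0.
  rewrite mul1e sqnorm_Rintegral// lee_fin; apply: le_trans Z2 _.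
  rewrite (_ : n%:R * _ = c / n%:R); last first.
    by rewrite /c -/V; field; rewrite gt_eqF.
  by rewrite ler_pdivrMr// mulrC -ler_pdivrMr.
- by apply: measurable_funB => //; apply: measurable_funD.
- by apply: measurable_funM => //; case: sZ.
- apply: filterS ae1 => w h; rewrite simple_integral_lin /simple_integral big_nil addr0.
  have -> : expN (past_count T w) = expR (- Lam) * (expN (past_count T w) * expR Lam).
    by rewrite mulrCA expRN mulVf ?mulr1// gt_eqF// expR_gt0.
  by rewrite h /simple_integral; ring.
Qed.

End laplace.

(** * The filtration of the white noise *)

Section completed_sigma_field.
Context {R : realType} {dO : measure_display} {Omega : measurableType dO}.
Variable P : probability Omega R.
Variable G : set (set Omega).
Hypothesis sG : sigma_algebra setT G.

(** Restricted to measurable sets, so that it stays inside the sigma-field on which [P] is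
    defined. *)
Definition completed : set (set Omega) :=
  [set A | measurable A /\ exists2 B, G B & {ae P, forall w, A w <-> B w}].

Lemma completed_measurable : completed `<=` measurable.
Proof. by move=> A []. Qed.

Lemma completed_sigma_algebra : sigma_algebra setT completed.
Proof.
have [G0 GC GU] := sG; split.
- by split; [exact: measurable0|exists set0 => //; exact: aeW].
- move=> A [mA [B GB AB]]; split; first by rewrite setTD; exact: measurableC.
  exists (setT `\` B); first exact: GC.
  by apply: filterS AB => w [h1 h2]; split => -[_ nA]; split => // ?; apply: nA; [exact: h2|exact: h1].
- move=> A cA; split; first by apply: bigcupT_measurable => i; case: (cA i).
  have cB i : exists B, G B /\ {ae P, forall w, A i w <-> B w}.
    by case: (cA i) => _ [B GB AB]; exists B.
  have [B BP] := choice cB.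
  exists (\bigcup_i B i); first by apply: GU => i; case: (BP i).
  have : {ae P, forall w, forall i, A i w <-> B i w}.
    by apply/ae_foralln => i; case: (BP i).
  by apply: filterS => w h; split => -[i _ /h Bi]; exists i.
Qed.

Lemma completed_ae (f g : Omega -> R) : measurable_fun setT f ->
  measurable_wrt setT completed g -> {ae P, forall w, f w = g w} ->
  measurable_wrt setT completed f.
Proof.
move=> mf mg fg _ [Y mY <-]; split.
  exact: mf.
have [_ [B GB BE]] : completed (setT `&` g @^-1` Y) by apply: mg; exists Y.
exists B => //; apply: filterS2 fg BE => w /= e [h1 h2]; split.
  by rewrite e => h; exact: h1.
by move=> /h2; rewrite /= e.
Qed.

Lemma sub_completed : G `<=` measurable -> G `<=` completed.
Proof. by move=> Gm A GA; split; [exact: Gm|exists A => //; exact: aeW]. Qed.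

End completed_sigma_field.

Section approximable_fields.
Context {R : realType} (d : nat).
Context {dO : measure_display} {Omega : measurableType dO}.
Variables (P : probability Omega R) (nu : {measure set R -> \bar R}).
Hypothesis nu_levy : levy_measure nu.
Variable N : Omega -> {measure set (txz R d) -> \bar R}.
Hypothesis N_poisson : poisson_random_measure P (intensity nu) N.
Variables (T : R) (T0 : 0 <= T).
Local Notation mu := (mu_txz d nu_levy).
Local Notation elementary := (elementary N).
Local Notation I_T := (simple_integral nu T).
Local Notation approx := (approximable P nu N T).
Implicit Types (s : seq (R * elementary)).

Section sigma_field.
Variable G : set (set Omega).
Hypotheses (sG : sigma_algebra setT G) (Gm : G `<=` measurable).
Hypothesis GA : forall A, G A -> approx \1_A.

Let mG f : measurable_wrt setT G f -> measurable_fun setT (f : Omega -> R).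
Proof. exact: measurable_wrt_fun. Qed.

Lemma approximable_sum I (r : seq I) (c : I -> R) (f : I -> Omega -> R) :
  (forall i, approx (f i)) -> approx (fun w => \sum_(i <- r) c i * f i w).
Proof.
move=> af; elim: r => [|i r ih].
  by under eq_fun do rewrite big_nil; exact: approximable_cst.
under eq_fun do rewrite big_cons.
exact: (bmcDZ (approximable_bmc nu_levy N_poisson T)).
Qed.

Import HBNNSimple.

(** The simple functions that increase to [F] are measurable for [G] itself, so their level sets are
    covered by [GA]; [F] serves as the dominating function. *)
Lemma approximable_nonneg (F : Omega -> R) : measurable_wrt setT G F ->
  sqint P F -> (forall w, 0 <= F w) -> approx F.
Proof.
move=> GF sF F0.
have mF : @measurable_fun _ _ (g_sigma_algebraType G) _ setT (EFin \o F).
  by apply/measurable_EFinP; apply/measurable_wrtP.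
pose h n : {nnsfun g_sigma_algebraType G >-> R} := nnsfun_approx measurableT mF n.
have F0' x : setT x -> (0 <= (EFin \o F) x)%E by move=> _; rewrite lee_fin.
have hF n w : h n w <= F w.
  by rewrite -lee_fin /h nnsfun_approxE; exact: (le_approx _ F0').
have Gh n : measurable_wrt setT G (h n).
  by apply/(measurable_wrtP _ sG).
have ah n : approx (h n).
  rewrite (funext (fimfunEord (h n))); apply: approximable_sum => i.
  set y := (_`_i).
  have : G (setT `&` h n @^-1` [set y]) by apply: Gh; exists [set y].
  by rewrite setTI; exact: GA.
apply: (approximable_lim nu_levy N_poisson (mG GF)) => e e0.
have cvh w : h n w @[n --> \oo] --> F w.
  have := @cvg_nnsfun_approx _ _ _ _ measurableT _ mF F0' w I.
  by move=> /fine_cvg.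
have [|n w|_ /(_ e e0)[n hn]] := @sqnorm_dominated_cvg _ _ _ P h F F _ sF _ cvh.
- by move=> n; apply: mG.
- by rewrite ger0_norm.
by exists (h n).
Qed.

Lemma approximable_sqint_sigma (F : Omega -> R) : measurable_wrt setT G F ->
  sqint P F -> approx F.
Proof.
move=> GF sF; have [mF F2] := sF.
have Ga : measurable_wrt setT G (fun w => `|F w|).
  by apply/(measurable_wrtP _ sG); apply: measurableT_comp => //; apply/measurable_wrtP.
have sa : sqint P (fun w => `|F w|).
  split; first exact: mG Ga.
  by rewrite /sqnorm; under eq_integral do rewrite real_normK ?num_real//.
have Gs : measurable_wrt setT G (fun w => `|F w| + F w).
  by apply/(measurable_wrtP _ sG); apply: measurable_funD; apply/(measurable_wrtP _ sG).
rewrite (_ : F = fun w => (-1) * `|F w| + (`|F w| + F w)); last by apply/funext => w; ring.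
apply: (bmcDZ (approximable_bmc nu_levy N_poisson T)); apply: approximable_nonneg => //.
  exact: sqintD.
by move=> w; have := ler_norm (- F w); rewrite normrN; lra.
Qed.

End sigma_field.

Lemma filtrationN_indic_approximable A : filtrationN N T A -> approx \1_A.
Proof.
apply: sigma_family_laplace => //; first exact: approximable_bmc.
move=> l Jl; apply: (@laplace_approximable _ _ _ _ _ _ nu_levy _ N_poisson _ T0 l).
  by apply: sub_all Jl => i /asboolP[/andP[_ iT] ? ?]; apply/asboolP; split.
by apply: sub_all Jl => i /asboolP[/andP[i0 _] _ _].
Qed.

Lemma filtrationN_sigma_algebra t : sigma_algebra setT (filtrationN N t).
Proof. exact: smallest_sigma_algebra. Qed.

Lemma filtrationNS t t' : t <= t' -> filtrationN N t `<=` filtrationN N t'.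
Proof.
move=> tt'; apply: smallest_sub; first exact: filtrationN_sigma_algebra.
move=> _ [i [/andP[i0 it] bA aG] [Y mY <-]]; apply: sub_sigma_algebra.
by exists i; [split => //; rewrite i0 (le_trans it)|exists Y].
Qed.

Lemma filtrationN_measurable t : filtrationN N t `<=` measurable.
Proof.
move=> A /filtrationN_region.
exact: (region_sigma_measurable (mu_poisson nu_levy N_poisson)).
Qed.

Local Notation compl := (completed P (filtrationN N T)).

Lemma completed_indic_approximable A : compl A -> approx \1_A.
Proof.
move=> [mA [B GB AB]].
apply: (approximable_ae nu_levy N_poisson _ (filtrationN_indic_approximable GB)).
  exact: measurable_fun_indic_T.
apply: filterS AB => w [h1 h2]; rewrite !indicE; congr (_%:R); congr nat_of_bool.
by apply/idP/idP => /set_mem ?; apply/mem_set; [exact: h2|exact: h1].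
Qed.

Let sF := filtrationN_sigma_algebra T.

Lemma completed_of_ae (f g : Omega -> R) : measurable_fun setT f ->
  measurable_wrt setT (filtrationN N T) g -> {ae P, forall w, f w = g w} ->
  measurable_wrt setT compl f.
Proof.
move=> mf Fg; apply: completed_ae => //.
by apply: measurable_wrtS Fg; apply: sub_completed; exact: filtrationN_measurable.
Qed.

(** The count over []a, b]] is a difference of two generators of the filtration only where counts
    are finite, so measurability holds up to a null set. *)
Lemma elementary_integral_completed (e : elementary) :
  measurable_wrt setT compl (elementary_integral nu T e).
Proof.
have mI : measurable_fun setT (elementary_integral nu T e).
  by have [] := elementary_integral_sqint nu_levy N_poisson T e.
(* For [T <= el_a e] the weight may be unknown at time [T], but the integral vanishes. *)
have [Ta|aT] := leP T (el_a e).
  have S0 : el_set T e = set0.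
    apply/seteqP; split => // -[[t x] z] [[/= + _] _].
    rewrite in_itv/= (min_r Ta) le_min => /andP[Tt /andP[_ tT]].
    by move: (lt_le_trans Tt tT); rewrite ltxx.
  apply: (completed_of_ae (g := fun=> 0)) => //.
    by apply/(measurable_wrtP _ sF); exact: measurable_cst.
  apply: aeW => w; rewrite (elementary_integralE nu_levy) S0.
  by rewrite /compensated !measure0 subrr mulr0.
pose a := el_a e; pose b := Num.min (el_b e) T; pose C := el_A e; pose G := el_G e.
have a0 : 0 <= a := el_ge0 e.
have ab : a <= b.
  rewrite le_min (ltW aT) andbT.
  by have : 0 <= el_a e < el_b e by [case: (e)]; case/andP => _ /ltW.
have bT : b <= T by rewrite ge_min lexx orbT.
have [bB aG] := (el_borel e, el_away e); have [[mC _] [mG _]] := (bB, aG).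
pose Q t : set (txz R d) := `[0, t] `*` C `*` G.
have gQ t : good_set mu (Q t).
  split; first by apply: measurableX => //; exact: measurableX.
  apply: (@mu_txz_fin _ _ _ _ _ _ _ t) => // u /=.
  by rewrite in_itv/= => /andP[].
have SE : el_set T e = `]a, b] `*` C `*` G by rewrite /el_set (min_l (ltW aT)).
have QS w : N w (Q b) = (N w (Q a) + N w (el_set T e))%E.
  by rewrite /Q (measure_time_split _ b a0 mC mG) (min_l ab) SE.
have FN t : 0 <= t <= T -> measurable_wrt setT (filtrationN N T) (fun w => fine (N w (Q t))).
  move=> tT; apply/(measurable_wrtP _ sF); apply: measurableT_comp => //.
  apply/(measurable_wrtP _ sF).
  exact: (@sub_sigma_family _ _ _ _ _
    (fun i w => N w (`[0, i.1.1] `*` i.1.2 `*` i.2) : \bar R) (t, C, G)).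
have FX : measurable_wrt setT (filtrationN N T) (el_X e).
  by apply: measurable_wrtS (@el_measurable_wrt _ _ _ _ _ e); exact: filtrationNS (ltW aT).
apply: (completed_of_ae (g := fun w => el_X e w *
    (fine (N w (Q b)) - fine (N w (Q a)) - fine (mu (el_set T e))))) => //.
  apply/(measurable_wrtP _ sF); apply: measurable_funM; first exact/(measurable_wrtP _ sF).
  apply: measurable_funB => //; apply: measurable_funB.
    by apply/(measurable_wrtP _ sF); apply: FN; rewrite bT (le_trans a0 ab).
  by apply/(measurable_wrtP _ sF); apply: FN; rewrite a0 (ltW aT).
have gS : good_set mu (el_set T e) by split; [exact: measurable_el_set|exact: el_set_fin].
have fin A : good_set mu A -> {ae P, forall w, N w A \is a fin_num}.
  move=> [mA fA].
  by have := poisson_fin_ae (mu_poisson nu_levy N_poisson) mA (measure_ge0 mu A) fA.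
apply: filterS2 (fin _ (gQ a)) (fin _ gS) => w f1 f2.
rewrite (elementary_integralE nu_levy) QS fineD// /compensated; congr (_ * (_ - _)).
by rewrite addrAC subrr add0r.
Qed.

Lemma simple_integral_completed s : measurable_wrt setT compl (I_T s).
Proof.
have sC := completed_sigma_algebra P sF.
apply/(measurable_wrtP _ sC); apply: measurable_sum => -[c e].
apply: measurable_funM => //; apply/(measurable_wrtP _ sC).
exact: elementary_integral_completed.
Qed.

(** Simple integrals are measurable for the completion, so completeness over it provides a limit
    there, and [J] agrees with that limit almost everywhere. *)
Lemma stoch_integral_completed H J : is_stoch_integral P nu N T H J ->
  measurable_wrt setT compl J.
Proof.
move=> [mJ [s [_ sJ]]].
have small (e : R) : 0 < e -> exists n0, forall n, (n0 <= n)%N ->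
    (sqnorm P (fun w => I_T (s n) w - J w)%R <= e%:E)%E.
  have [h _] := cvg0_ereal (fun n => sqnorm_ge0 P (fun w => I_T (s n) w - J w)).
  by apply: h; move: sJ; under eq_fun do rewrite expectation_sqr.
have mI := measurable_simple_integral nu_levy N_poisson T.
have [g Gg gs] : exists2 g : Omega -> R, measurable_wrt setT compl g &
    forall e : R, 0 < e -> exists n0, forall n, (n0 <= n)%N ->
    (sqnorm P (fun w => I_T (s n) w - g w)%R <= e%:E)%E.
  apply: sqnorm_complete.
  - exact: completed_sigma_algebra.
  - exact: completed_measurable.
  - by move=> n; exact: simple_integral_completed.
  - move=> e e0; have e4 : 0 < e / 4 by rewrite divr_gt0.
    have [n0 hn] := small _ e4; exists n0 => i j hi hj.
    apply: (le_trans (sqnorm_triangle P (mI _) mJ (mI _))).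
    by apply: lee_quarters; [exact: hn|rewrite sqnormB_sym hn].
have mg : measurable_fun setT g by apply: measurable_wrt_fun Gg; exact: completed_measurable.
apply: (completed_ae mJ Gg); apply: sqnorm_le0_ae => // e e0.
have e4 : 0 < e / 4 by rewrite divr_gt0.
have [n1 h1] := small _ e4; have [n2 h2] := gs _ e4.
apply: (le_trans (sqnorm_triangle P mJ (mI (s (maxn n1 n2))) mg)).
by apply: lee_quarters; [rewrite sqnormB_sym h1// leq_maxl|rewrite h2// leq_maxr].
Qed.

Lemma filtrationL_completed (L : set (R * d.-tuple R) -> Omega -> R) :
  levy_white_noise P nu N L -> filtrationL L T `<=` compl.
Proof.
move=> noise; apply: smallest_sub; first exact: completed_sigma_algebra.
move=> _ [[t B] /= [/andP[t0 tT] [mB [M BM]]] [Y mY <-]].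
have bt : bounded_borel_tx (`[0, t] `*` B).
  split; first exact: measurableX.
    by move=> [u x] [/= + _]; rewrite !in_itv/= andbT => /andP[-> _].
  exists (Num.max t M) => -[u x] [/= + Bx]; rewrite in_itv/= => /andP[_ ut].
  by split => [|i]; rewrite le_max ?ut//= BM ?orbT.
have sub : `[0, t] `*` B `<=` `[0, T] `*` setT.
  by move=> [u x] [/= + _]; rewrite !in_itv/= => /andP[-> ut]; rewrite (le_trans ut tT).
(* The noise over [[0, t] x B] is read as an integral with horizon [T], not [t]. *)
apply: (stoch_integral_completed (noise _ bt _ T0 sub)).
by exists Y.
Qed.

Lemma filtrationL_approximable (L : set (R * d.-tuple R) -> Omega -> R) F :
  levy_white_noise P nu N L -> measurable_wrt setT (filtrationL L T) F ->
  (sqnorm P F < +oo)%E -> approx F.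
Proof.
move=> noise LF F2.
have CF := measurable_wrtS (filtrationL_completed noise) LF.
apply: (@approximable_sqint_sigma compl) => //.
- exact: completed_sigma_algebra.
- exact: completed_measurable.
- exact: completed_indic_approximable.
- by split => //; apply: measurable_wrt_fun CF; exact: completed_measurable.
Qed.

End approximable_fields.

(** * The representation *)

Lemma normc_sqr {R : realType} (x : R[i]) :
  Normc.normc x ^+ 2 = complex.Re x ^+ 2 + complex.Im x ^+ 2.
Proof. by case: x => a b /=; rewrite sqr_sqrtr// addr_ge0// sqr_ge0. Qed.

Section complex_parts.
Context {R : realType} (d : nat).
Context {dO : measure_display} {Omega : measurableType dO}.
Variables (P : probability Omega R) (nu : {measure set R -> \bar R}).
Hypothesis nu_levy : levy_measure nu.
Variable N : Omega -> {measure set (txz R d) -> \bar R}.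
Hypothesis N_poisson : poisson_random_measure P (intensity nu) N.
Local Notation mu := (mu_txz d nu_levy).

Lemma measurable_sqrtr : measurable_fun setT (@Num.sqrt R).
Proof. by apply: continuous_measurable_fun; exact: sqrt_continuous. Qed.

Lemma energyC_lty (T : R) (psi : Omega * txz R d -> R[i]) :
  predictableC N T psi ->
  (energy P nu T (fun q => complex.Re (psi q)) < +oo)%E ->
  (energy P nu T (fun q => complex.Im (psi q)) < +oo)%E ->
  (energyC P nu T psi < +oo)%E.
Proof.
move=> [/(measurable_cutoff_predictable nu_levy N_poisson) m1
  /(measurable_cutoff_predictable nu_levy N_poisson) m2].
rewrite !(energyE nu_levy)// /energyC => e1 e2.
have E q : cutoff T (fun q => Normc.normc (psi q)) q = Num.sqrt
    (cutoff T (fun q => complex.Re (psi q)) q ^+ 2 + cutoff T (fun q => complex.Im (psi q)) q ^+ 2).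
  rewrite /cutoff indicE; case: (_ \in _); rewrite ?mulr1 ?mulr0.
    by rewrite -normc_sqr sqrtr_sqr ger0_norm//; case: (psi q) => a b; exact: sqrtr_ge0.
  by rewrite expr0n/= addr0 sqrtr0.
have mE : measurable_fun setT (cutoff T (fun q => Normc.normc (psi q))).
  rewrite (funext E); apply: measurableT_comp; first exact: measurable_sqrtr.
  by apply: measurable_funD; exact: measurable_funX.
rewrite (energyE nu_levy)//.
have -> : sqnorm (P \x mu)%E (cutoff T (fun q => Normc.normc (psi q))) =
    (sqnorm (P \x mu)%E (cutoff T (fun q => complex.Re (psi q))) +
     sqnorm (P \x mu)%E (cutoff T (fun q => complex.Im (psi q))))%E.
  rewrite /sqnorm -ge0_integralD//.
  - by apply: eq_integral => q _; rewrite E sqr_sqrtr ?addr_ge0 ?sqr_ge0// EFinD.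
  - by move=> q _; rewrite lee_fin sqr_ge0.
  - exact: measurable_EFin_sqr.
  - by move=> q _; rewrite lee_fin sqr_ge0.
  - exact: measurable_EFin_sqr.
by rewrite lte_add_pinfty.
Qed.

Lemma L2C_parts (G : set (set Omega)) (F : Omega -> R[i]) :
  L2C P G F -> measurable_fun setT (fun w => complex.Re (F w)) ->
  measurable_fun setT (fun w => complex.Im (F w)) ->
  (sqnorm P (fun w => complex.Re (F w)) < +oo)%E /\
  (sqnorm P (fun w => complex.Im (F w)) < +oo)%E.
Proof.
move=> [_ _]; rewrite unlock => F2 mR mI.
have mN : measurable_fun setT (fun w => (Normc.normc (F w) ^+ 2)%:E).
  apply/measurable_EFinP; under eq_fun do rewrite normc_sqr.
  by apply: measurable_funD; exact: measurable_funX.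
split; apply: le_lt_trans F2; apply: ge0_le_integral => //;
  do ?[by move=> w _; rewrite lee_fin sqr_ge0|exact: measurable_EFin_sqr].
- by move=> w _; rewrite lee_fin normc_sqr lerDl sqr_ge0.
- by move=> w _; rewrite lee_fin normc_sqr lerDr sqr_ge0.
Qed.

Lemma expectation_Rintegral (f : Omega -> R) : fine 'E_P[f]%E = \int[P]_w f w.
Proof. by rewrite unlock. Qed.

End complex_parts.

Theorem theorem4p5 (R : realType) (d : nat)
    (dO : measure_display) (Omega : measurableType dO) (P : probability Omega R)
    (nu : {measure set R -> \bar R}) (nu_levy : levy_measure nu)
    (nu_v : (\int[nu]_(z in R0) (z ^+ 2)%:E < +oo)%E)
    (N : Omega -> {measure set (txz R d) -> \bar R})
    (N_poisson : poisson_random_measure P (intensity nu) N)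
    (L : set (R * d.-tuple R) -> Omega -> R)
    (L_noise : levy_white_noise P nu N L)
    (T : R) (T_gt0 : 0 < T)
    (F : Omega -> R[i]) (F_L2 : L2C P (filtrationL L T) F) :
  exists psi : Omega * txz R d -> R[i],
    is_representation P nu N T F psi /\
    forall psi' : Omega * txz R d -> R[i],
      is_representation P nu N T F psi' ->
      {ae (P \x intensity nu)%E, forall q, slab `[0, T] q -> psi' q = psi q}.
Proof.
have T0 := ltW T_gt0.
have [LR LI _] := F_L2.
have sub : filtrationL L T `<=` measurable.
  by move=> A /(filtrationL_completed nu_levy N_poisson T0 L_noise); exact: completed_measurable.
have [sR sI] := L2C_parts F_L2 (measurable_wrt_fun sub LR) (measurable_wrt_fun sub LI).
have aR := filtrationL_approximable nu_levy N_poisson T0 L_noise LR sR.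
have aI := filtrationL_approximable nu_levy N_poisson T0 L_noise LI sI.
have [psi1 [p1 e1 i1]] := approximable_representation nu_levy N_poisson T0 aR.
have [psi2 [p2 e2 i2]] := approximable_representation nu_levy N_poisson T0 aI.
pose psi q : R[i] := Complex (psi1 q) (psi2 q).
have pC : predictableC N T psi by split; [exact: p1|exact: p2].
have eC : (energyC P nu T psi < +oo)%E.
  by apply: (energyC_lty nu_levy N_poisson pC); [exact: e1|exact: e2].
(* With this version of the integral the representation holds at every [w]. *)
pose J w : R[i] := F w - expectationC P F.
have JR w : complex.Re (J w) = complex.Re (F w) - \int[P]_w complex.Re (F w).
  by rewrite raddfB -expectation_Rintegral.
have JI w : complex.Im (J w) = complex.Im (F w) - \int[P]_w complex.Im (F w).
  by rewrite raddfB -expectation_Rintegral.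
have iC : is_stoch_integralC P nu N T psi J.
  by split; [rewrite (funext JR); exact: i1|rewrite (funext JI); exact: i2].
exists psi; split.
  by split; [exact: pC|exact: eC|exists J => //; apply: aeW => w; rewrite addrC subrK].
move=> psi' [[p1' p2'] _ [J' [j1 j2] FJ]].
have JE : {ae P, forall w, J' w = J w}.
  by apply: filterS FJ => w FE; rewrite /J [in RHS]FE addrC addKr.
have mc := measurable_cutoff_predictable nu_levy N_poisson.
have ae1 : {ae P, forall w, complex.Re (J' w) = complex.Re (J w)}.
  by apply: filterS JE => w ->.
have ae2 : {ae P, forall w, complex.Im (J' w) = complex.Im (J w)}.
  by apply: filterS JE => w ->.
have u1 := stoch_integral_unique nu_levy N_poisson (mc _ _ p1') (mc _ _ p1) j1 (proj1 iC) ae1.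
have u2 := stoch_integral_unique nu_levy N_poisson (mc _ _ p2') (mc _ _ p2) j2 (proj2 iC) ae2.
(* [mu_txz] is the intensity with its sigma-finite structure attached. *)
rewrite -(mu_txzE d nu_levy).
apply: filterS2 u1 u2 => q h1 h2 sq.
move: h1 h2; rewrite /cutoff indicE mem_set// !mulr1 => h1 h2.
by rewrite [LHS]complexE [RHS]complexE h1 h2.
Qed.
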